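(* Let $(N,\omega)$ be an integral closed symplectic manifold, let $\pi:(M,\eta)\to(N,\omega)$ be the associated $S^1$-bundle with contact form $\eta$ satisfying $\pi^*\omega=d\eta$, and let $\bar G_0(M)$ be the Lie group of Hamiltonian symplectic transformations. Then $$|\pi_1(\bar G_0(M))|=\infty .$$
   Context: $(N,\omega)$ is a closed symplectic manifold of dimension $2k$; integral means $[\omega]\in H^2(N,\mathbb Z)$. Then there is an $S^1$-bundle $\pi:M\to N$ and a contact form $\eta$ on $M$ with $\pi^*\omega=d\eta$ (with the usual normalization of $2\pi$ factors). For $H\in C^\infty(N)$, let $H^L=\pi^*H\in C^\infty(M)$ and let $V_{H^L}$ be the vector field on $M$ defined by $$\eta(V_{H^L})=-H^L,\qquad d\eta(V_{H^L},\cdot)=dH^L .$$ It satisfies $L_{V_{H^L}}\eta=0$. Let $\exp(V_{H^L})$ be the time-one map of its flow; it is an element of $\mathrm{Diff}_{\eta,\mathrm{str}}(M)=\{\phi\in\mathrm{Diff}(M):\phi^*\eta=\eta\}$. $G_0(M)$ is the group of all finite products of diffeomorphisms $\exp(V_{H^L})$, $H\in C^\infty(N)$, and $\bar G_0(M)$ is the closure of $G_0(M)$ in $\mathrm{Diff}_{\eta,\mathrm{str}}(M)$, called the Lie group of Hamiltonian symplectic transformations. The topology is induced from $\mathrm{Diff}(M)$ (e.g. the $C^\infty$ topology); $\pi_1$ is based at the identity. *)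

(* Defs.v *)
From HB Require Import structures.
From mathcomp Require Import all_boot all_order all_algebra all_fingroup.
From mathcomp Require Import all_classical all_reals all_analysis.
Set Implicit Arguments.
Unset Strict Implicit.
Unset Printing Implicit Defensive.
Import Order.TTheory GRing.Theory Num.Theory.
Import numFieldNormedType.Exports.
Local Open Scope classical_set_scope.
Local Open Scope ring_scope.

Fixpoint partial (R : realType) n (s : seq 'I_n) (f : 'rV[R]_n -> R) :
    'rV[R]_n -> R :=
  if s is i :: s' then fun x => 'D_(delta_mx 0 i) (partial s' f) x else f.

(* For U open, this is: f is C^oo on U. *)
Definition smooth_on (R : realType) n (U : set 'rV[R]_n) (f : 'rV[R]_n -> R) :=
  forall (s : seq 'I_n) x, U x ->
    {for x, continuous (partial s f)} /\
    forall i, derivable (partial s f) x (delta_mx 0 i).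

(* cmap and cinv are total functions, meaningful on cdom and on
   cmap @` cdom only. *)
Record chart (R : realType) (n : nat) (T : topologicalType) := Chart {
  cdom : set T;
  cmap : T -> 'rV[R]_n;
  cinv : 'rV[R]_n -> T
}.

Definition cimg (R : realType) n (T : topologicalType) (c : chart R n T) :=
  cmap c @` cdom c.

Definition is_chart (R : realType) n (T : topologicalType) (c : chart R n T) :=
  [/\ open (cdom c), open (cimg c),
      forall p, cdom c p -> cinv c (cmap c p) = p,
      forall p, cdom c p -> {for p, continuous (cmap c)} &
      forall x, cimg c x -> {for x, continuous (cinv c)}].

Definition is_atlas (R : realType) n (T : topologicalType)
    (A : set (chart R n T)) :=
  [/\ forall c, A c -> is_chart c,
      forall p, exists2 c, A c & cdom c p &
      forall c d, A c -> A d -> forall i,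
        smooth_on (cimg c `&` cinv c @^-1` cdom d)
                  (fun x => cmap d (cinv c x) 0 i)].

(* Smooth n-dimensional manifold without boundary; the atlas need not be
   maximal. *)
Record manifold (R : realType) (n : nat) := Manifold {
  mspace :> topologicalType;
  atlas : set (chart R n mspace);
  manifold_hausdorff : hausdorff_space mspace;
  manifold_second_countable : @second_countable mspace;
  manifold_atlas : is_atlas atlas
}.

Arguments atlas {R n} m.
Arguments manifold_atlas {R n} m.

Section SmoothMaps.
Variable R : realType.

Definition smooth_from_rV n m (N : manifold R m) (U : set 'rV[R]_n)
    (f : 'rV[R]_n -> N) :=
  (forall x, U x -> {for x, continuous f}) /\
  forall d, atlas N d -> forall i,
    smooth_on (U `&` f @^-1` cdom d) (fun x => cmap d (f x) 0 i).

(* In the next two definitions W is meant to be open. *)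
Definition smooth_map_on n m (M : manifold R n) (N : manifold R m)
    (W : set M) (f : M -> N) :=
  forall c, atlas M c ->
    smooth_from_rV (cmap c @` (cdom c `&` W)) (f \o cinv c).

Definition smooth_fun_on n (M : manifold R n) (W : set M) (f : M -> R) :=
  forall c, atlas M c -> smooth_on (cmap c @` (cdom c `&` W)) (f \o cinv c).

Definition smooth_fun n (M : manifold R n) (f : M -> R) := smooth_fun_on setT f.

Definition smooth_map n m (M : manifold R n) (N : manifold R m) (f : M -> N) :=
  smooth_map_on setT f.

Record Cinf n m (M : manifold R n) (N : manifold R m) := MkCinf {
  cinf_fun :> M -> N;
  cinf_smooth : smooth_map cinf_fun
}.

Lemma smooth_map_id n (M : manifold R n) : smooth_map (@id M).
Proof.
move=> c Ac; have [chA _ compat] := manifold_atlas M.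
have [_ _ _ _ cinvC] := chA c Ac.
rewrite setIT; split=> [x cx|d Ad i]; first exact: cinvC.
exact: compat.
Qed.

Definition Cinf_id n (M : manifold R n) : Cinf M M :=
  MkCinf (@smooth_map_id n M).

(* Subbasic neighbourhoods of the (weak) C^oo topology on C^oo(M, N): the
   derivatives of order at most r of the coordinate expressions of f and g are
   e-close over the compact set K. *)
Definition Cinf_nbhd n m (M : manifold R n) (N : manifold R m) (f : Cinf M N)
    (c : chart R n M) (d : chart R m N) (K : set M) (r : nat) (e : R) :
    set (Cinf M N) :=
  [set g | forall p, K p -> cdom d (g p) /\
     forall (s : seq 'I_n) i, (size s <= r)%N ->
       `|partial s (fun x => cmap d (f (cinv c x)) 0 i) (cmap c p)
         - partial s (fun x => cmap d (g (cinv c x)) 0 i) (cmap c p)| < e].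

Definition Cinf_subbase n m (M : manifold R n) (N : manifold R m) :
    set (set (Cinf M N)) :=
  [set U | exists (f : Cinf M N) c d K r e,
     [/\ atlas M c, atlas N d, compact K, K `<=` cdom c & f @` K `<=` cdom d] /\
     0 < e /\ U = Cinf_nbhd f c d K r e].

HB.instance Definition _ n m (M : manifold R n) (N : manifold R m) :=
  gen_eqMixin (Cinf M N).
HB.instance Definition _ n m (M : manifold R n) (N : manifold R m) :=
  gen_choiceMixin (Cinf M N).
HB.instance Definition _ n m (M : manifold R n) (N : manifold R m) :=
  @isSubBaseTopological.Build (Cinf M N) _ (@Cinf_subbase n m M N) id.

Definition Diff n (M : manifold R n) : set (Cinf M M) :=
  [set f | exists g : Cinf M M, cancel f g /\ cancel g f].

End SmoothMaps.

Section Forms.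
Variable R : realType.

Definition functional n (M : manifold R n) : Type := (M -> R) -> R.

(* T_p M as the space of derivations at p of C^oo(M), extended by 0 to
   non-smooth functions so that Leibniz equality is equality of derivations. *)
Definition tangent n (M : manifold R n) (p : M) : set (functional M) :=
  [set v | [/\ forall f, ~ smooth_fun f -> v f = 0,
    forall (a : R) f g, smooth_fun f -> smooth_fun g ->
      v (fun x => a * f x + g x) = a * v f + v g &
    forall f g, smooth_fun f -> smooth_fun g ->
      v (fun x => f x * g x) = v f * g p + f p * v g]].

Definition dmap n m (M : manifold R n) (N : manifold R m) (phi : M -> N)
    (v : functional M) : functional N :=
  fun f => if `[< smooth_fun f >] then v (f \o phi) else 0.

Definition velocity n (M : manifold R n) (c : R -> M) (t : R) : functional M :=
  fun f => if `[< smooth_fun f >] then derive1 (f \o c) t else 0.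

Definition vector_field n (M : manifold R n) (X : M -> functional M) :=
  (forall p, tangent p (X p)) /\
  forall f, smooth_fun f -> smooth_fun (fun p => X p f).

Definition bracket n (M : manifold R n) (X Y : M -> functional M) :
    M -> functional M :=
  fun p f => X p (fun q => Y q f) - Y p (fun q => X q f).

(* The values of forms outside the tangent spaces are irrelevant. *)
Definition one_form n (M : manifold R n) (eta : M -> functional M -> R) :=
  (forall p (a : R) v w, tangent p v -> tangent p w ->
     eta p (fun f => a * v f + w f) = a * eta p v + eta p w) /\
  forall X, vector_field X -> smooth_fun (fun p => eta p (X p)).

Definition two_form n (M : manifold R n)
    (om : M -> functional M -> functional M -> R) :=
  [/\ forall p (a : R) u v w, tangent p u -> tangent p v -> tangent p w ->
        om p (fun f => a * u f + v f) w = a * om p u w + om p v w,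
      forall p v w, tangent p v -> tangent p w -> om p v w = - om p w v &
      forall X Y, vector_field X -> vector_field Y ->
        smooth_fun (fun p => om p (X p) (Y p))].

Definition extension n (M : manifold R n) (p : M) (v : functional M) :
    M -> functional M :=
  xget (fun _ _ => 0) [set X | vector_field X /\ X p = v].

(* d eta (X, Y) = X (eta Y) - Y (eta X) - eta [X, Y], evaluated at p for
   vector fields X, Y extending v, w. *)
Definition dform n (M : manifold R n) (eta : M -> functional M -> R)
    (p : M) (v w : functional M) : R :=
  let X := extension p v in let Y := extension p w in
  X p (fun q => eta q (Y q)) - Y p (fun q => eta q (X q))
  - eta p (bracket X Y p).

(* d om = 0, by the invariant formula for the exterior derivative. *)
Definition closed_two_form n (M : manifold R n)
    (om : M -> functional M -> functional M -> R) :=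
  forall X Y Z, vector_field X -> vector_field Y -> vector_field Z ->
  forall p,
    X p (fun q => om q (Y q) (Z q)) + Y p (fun q => om q (Z q) (X q))
    + Z p (fun q => om q (X q) (Y q))
    - om p (bracket X Y p) (Z p) - om p (bracket Y Z p) (X p)
    - om p (bracket Z X p) (Y p) = 0.

Definition symplectic n (N : manifold R n)
    (om : N -> functional N -> functional N -> R) :=
  [/\ two_form om, closed_two_form om &
      forall p v, tangent p v ->
        (forall w, tangent p w -> om p v w = 0) -> v = (fun=> 0)].

(* eta /\ (d eta)^k is nowhere zero; the sum is a positive multiple of its
   value on the vectors v_0, ..., v_2k. *)
Definition contact_form k (M : manifold R (2 * k).+1)
    (eta : M -> functional M -> R) :=
  one_form eta /\
  forall p, exists v : 'I_(2 * k).+1 -> functional M,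
    (forall i, tangent p (v i)) /\
    \sum_(s : 'S_(2 * k).+1) (-1) ^+ s * (eta p (v (s ord0)) *
      \prod_(i < k) dform eta p (v (s (inord (2 * i).+1)))
                                (v (s (inord (2 * i).+2)))) != 0.

End Forms.

Section Integrality.
Variable R : realType.

Definition std_simplex q : set 'rV[R]_q.+1 :=
  [set x | (forall i, 0 <= x 0 i) /\ \sum_i x 0 i = 1].

Definition face q (i : 'I_q.+2) (y : 'rV[R]_q.+1) : 'rV[R]_q.+2 :=
  \row_j (if unlift i j is Some l then y 0 l else 0).

(* A map from the standard simplex is represented by a function on the
   ambient space, see cochain below. *)
Definition smooth_simplex q n (N : manifold R n) (sg : 'rV[R]_q.+1 -> N) :=
  exists U : set 'rV[R]_q.+1,
    [/\ open U, @std_simplex q `<=` U & smooth_from_rV U sg].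

Definition cochain q n (N : manifold R n) (A : Type)
    (z : ('rV[R]_q.+1 -> N) -> A) :=
  forall sg sg', {in @std_simplex q, sg =1 sg'} -> z sg = z sg'.

Definition integral_simplex n (N : manifold R n)
    (om : N -> functional N -> functional N -> R) (sg : 'rV[R]_3 -> N) : R :=
  let pt s t : 'rV[R]_3 := \row_(j < 3) [:: 1 - s - t; s; t]`_j in
  (\int[@lebesgue_measure R]_(s in `[0%R, 1%R])
    (\int[@lebesgue_measure R]_(t in `[0%R, (1 - s)%R])
      om (sg (pt s t)) (velocity (fun u => sg (pt u t)) s)
                       (velocity (fun u => sg (pt s u)) t)))%R.

(* The de Rham class of om is the image of a class of H^2(N, Z): the cochain
   c |-> \int_c om differs from an integral (smooth singular) cocycle z by the
   coboundary of a real cochain h. *)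
Definition integral_class n (N : manifold R n)
    (om : N -> functional N -> functional N -> R) :=
  exists (z : ('rV[R]_3 -> N) -> int) (h : ('rV[R]_2 -> N) -> R),
    [/\ cochain z, cochain h,
        forall tau : 'rV[R]_4 -> N, smooth_simplex tau ->
          \sum_(i < 4) (-1) ^+ i * z (tau \o face i) = 0 &
        forall sg : 'rV[R]_3 -> N, smooth_simplex sg ->
          integral_simplex om sg =
            (z sg)%:~R + \sum_(i < 3) (-1) ^+ i * h (sg \o face i)].

End Integrality.

Section CircleBundle.
Variable R : realType.

(* Smooth free action of S^1 = R/Z, given as a 1-periodic action of R. *)
Definition free_circle_action n (M : manifold R n) (rho : R -> M -> M) :=
  [/\ forall p, rho 0 p = p,
      forall s t p, rho (s + t) p = rho s (rho t p),
      forall t p, rho t p = p <-> exists m : int, t = m%:~R &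
      forall c, atlas M c ->
        smooth_from_rV [set z : 'rV[R]_(1 + n) | cimg c (rsubmx z)]
          (fun z => rho (lsubmx z 0 0) (cinv c (rsubmx z)))].

(* Over U, p |-> (pi p, a p + i b p) is an equivariant diffeomorphism onto
   U x S^1, with inverse (u, exp (2 pi i t)) |-> rho t (sec u). *)
Definition local_trivialization n m (M : manifold R n) (N : manifold R m)
    (rho : R -> M -> M) (proj : M -> N) (U : set N)
    (sec : N -> M) (a b : M -> R) :=
  [/\ smooth_map_on U sec /\
        (forall u, U u -> [/\ proj (sec u) = u, a (sec u) = 1 & b (sec u) = 0]),
      smooth_fun_on (proj @^-1` U) a, smooth_fun_on (proj @^-1` U) b,
      forall p, U (proj p) -> a p ^+ 2 + b p ^+ 2 = 1 &
      forall p t, U (proj p) ->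
        a (rho t p) = cos (2 * pi * t) * a p - sin (2 * pi * t) * b p /\
        b (rho t p) = sin (2 * pi * t) * a p + cos (2 * pi * t) * b p].

Definition circle_bundle n m (M : manifold R n) (N : manifold R m)
    (rho : R -> M -> M) (proj : M -> N) :=
  [/\ free_circle_action rho, smooth_map proj,
      forall p q, proj p = proj q <-> exists t, q = rho t p &
      forall x : N, exists U sec a b,
        [/\ open U, U x & local_trivialization rho proj U sec a b]].

End CircleBundle.

Section HamiltonianGroup.
Variables (R : realType) (n m : nat) (M : manifold R n) (N : manifold R m).
Variables (proj : M -> N) (eta : M -> functional M -> R).

Definition strict_Diff : set (Cinf M M) :=
  [set phi | Diff phi /\
     forall p v, tangent p v -> eta (phi p) (dmap phi v) = eta p v].

(* V = V_{H^L}, with H^L = H \o proj; note that dH^L (w) = w (H^L). *)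
Definition lifted_ham_field (H : N -> R) (V : M -> functional M) :=
  [/\ vector_field V,
      forall p, eta p (V p) = - H (proj p) &
      forall p w, tangent p w -> dform eta p (V p) w = w (H \o proj)].

Definition is_flow (V : M -> functional M) (Phi : R -> M -> M) :=
  (forall p, Phi 0 p = p) /\
  forall p f t, smooth_fun f ->
    is_derive t (1 : R) (fun u => f (Phi u p)) (V (Phi t p) f).

Definition is_exp_ham (phi : M -> M) :=
  exists (H : N -> R) V Phi,
    [/\ smooth_fun H, lifted_ham_field H V, is_flow V Phi & Phi 1 = phi].

Inductive ham_product : (M -> M) -> Prop :=
| ham_product_id : ham_product id
| ham_product_comp phi psi :
    is_exp_ham phi -> ham_product psi -> ham_product (phi \o psi).

Definition G0 : set (Cinf M M) := [set phi | ham_product phi].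

Definition G0bar : set (Cinf M M) := closure G0 `&` strict_Diff.

End HamiltonianGroup.

Section FundamentalGroup.
Variables (R : realType) (T : topologicalType) (A : set T) (x : T).

Definition unit_itv : set R := `[0, 1]%classic.

Definition loop (c : R -> T) :=
  [/\ {within unit_itv, continuous c}, forall t, unit_itv t -> A (c t),
      c 0 = x & c 1 = x].

Definition loop_homotopic (c d : R -> T) :=
  exists h : R * R -> T,
    [/\ {within unit_itv `*` unit_itv, continuous h},
        forall s t, unit_itv s -> unit_itv t -> A (h (s, t)),
        forall t, unit_itv t -> h (0, t) = c t,
        forall t, unit_itv t -> h (1, t) = d t &
        forall s, unit_itv s -> h (s, 0) = x /\ h (s, 1) = x].

(* The underlying set of pi_1(A, x); homotopies are relative to endpoints and
   stay in A. *)
Definition pi1 : set (set (R -> T)) :=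
  [set [set d | loop d /\ loop_homotopic c d] | c in loop].

End FundamentalGroup.

(* Main.v *)
(* The circle action has a velocity field V with i_V d eta = 0, and contactness
   forces eta(V) to be nowhere zero. By Cartan's formula the orbit period
   T(p) = int_0^1 eta(V)(rho_s p) ds is killed by every tangent vector, so it is
   locally constant; reparametrising the orbits turns rho into the Reeb flow
   sigma_t, scaled to have period 1, which is smooth, strict and generated by the
   Hamiltonians -r T. Hence the loops c_j(t) = sigma_{jt}, j in Z, lie in the
   group, and their homotopy classes are pairwise distinct:
   strict diffeomorphisms preserving T commute with sigma, so a homotopy
   h(s,t) from c_i to c_j commutes with sigma. As N is compact, there is a
   sigma-equivariant continuous map u from M to C^L \ 0. The map
   z |-> u(h(z_1) ... h(z_L) p) on the cube ([0,1]^2)^L is, on the boundary of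
   each square factor, a rotated copy of its value at a corner of that square.
   Pulling back the angular forms of the L coordinates of C^L and antisymmetrising
   the product of their curvatures, Stokes on a fine grid gives L! (j-i)^L,
   whereas the product vanishes because some coordinate never vanishes on a given
   small cell and so has no curvature there. Thus i = j. *)

Require Import Defs.
From HB Require Import structures.
From mathcomp Require Import all_boot all_order all_algebra all_fingroup finmap.
From mathcomp Require Import all_classical all_reals all_analysis lra zify.
Set Implicit Arguments.
Unset Strict Implicit.
Unset Printing Implicit Defensive.
Import Order.TTheory GRing.Theory Num.Theory.
Import numFieldNormedType.Exports.
Local Open Scope classical_set_scope.
Local Open Scope ring_scope.

(** * Stokes on a grid *)

(** A single point does not detect the loop: its orbit may be contractible in M, as in the Hopf
    fibration. This forces the L-fold composition. Geometrically, gluing the boundary of every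
    square through the prescribed rotations turns the cube into (S^2)^L with a complex line bundle
    whose degree on each factor is j - i, up to a common sign. Its first Chern class is (j - i)(x_1
    + ... + x_L), and the top power of this class is the origin of the factorial. The L components
    of u become sections without common zero, which makes that power vanish. Since the homotopy is
    merely continuous in its two parameters, curvature is taken for cochains on a grid: small cells
    replace differentiability, and the value of a cochain is prescribed on the boundary, where a
    component may be zero and have no angle. The action rho need not preserve eta, hence the
    reparametrisation; and since N may be disconnected, T is only locally constant. *)

Section Alternation.
Variables (R : realFieldType) (T : eqType).
Implicit Types (D l : seq T) (G : seq T -> R).

(** The Laplace expansion along one slot: an element leaves the list with the sign of its
    position. *)
Fixpoint picks D : seq (R * T * seq T) :=
  if D is d :: D' then
    (1, d, D') :: [seq (- p.1.1, p.1.2, d :: p.2) | p <- picks D']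
  else [::].

(** Antisymmetrisation over all orderings of [D], by repeated expansion along the first slot;
    cancellations then reduce to statements about two adjacent slots. *)
Fixpoint alt_rec n D G : R :=
  if n is n'.+1 then
    \sum_(p <- picks D) p.1.1 * alt_rec n' p.2 (fun l => G (p.1.2 :: l))
  else G [::].

Definition alt D G := alt_rec (size D) D G.

Lemma picks_perm D p : p \in picks D -> perm_eq (p.1.2 :: p.2) D.
Proof.
elim: D p => [//|d D IH] p; rewrite inE => /predU1P[->//|/mapP[q qD ->]] /=.
by rewrite (perm_catCA [:: _] [:: _]) /= perm_cons; apply: IH.
Qed.

Lemma size_picks D p : p \in picks D -> size D = (size p.2).+1.
Proof. by move/picks_perm/perm_size => /= <-. Qed.

Lemma altS n D G : size D = n.+1 ->
  alt D G = \sum_(p <- picks D) p.1.1 * alt p.2 (fun l => G (p.1.2 :: l)).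
Proof.
rewrite /alt => eD; rewrite eD /= [LHS]big_seq [RHS]big_seq.
by apply: eq_bigr => p /size_picks; rewrite eD => -[<-].
Qed.

Lemma alt_eq D G G' : (forall l, perm_eq l D -> G l = G' l) -> alt D G = alt D G'.
Proof.
have [n] := ubnP (size D); elim: n D G G' => // n IH [|d D] G G' sD GG'.
  by rewrite /alt /= GG'.
rewrite !(@altS (size D))// [LHS]big_seq [RHS]big_seq; apply: eq_bigr => p pD.
congr (_ * _); apply: IH => [|l lp].
  by move: sD; rewrite ltnS; have /= -> := size_picks pD.
by apply: GG'; rewrite -(permPr (picks_perm pD)) perm_cons.
Qed.

Lemma altB D G G' : alt D (fun l => G l - G' l) = alt D G - alt D G'.
Proof.
rewrite /alt; move: (size D) => n; elim: n D G G' => //= n IH D G G'.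
by rewrite -sumrB; apply: eq_bigr => p _; rewrite IH mulrBr.
Qed.

Lemma altZ D c G : alt D (fun l => c * G l) = c * alt D G.
Proof.
rewrite /alt; move: (size D) => n; elim: n D G => //= n IH D G.
by rewrite mulr_sumr; apply: eq_bigr => p _; rewrite IH mulrCA.
Qed.

Lemma alt0 D : alt D (fun=> 0) = 0.
Proof. by have := altZ D 0 (fun=> 0); rewrite !mul0r. Qed.

(** Taking out d and then d' carries the sign opposite to taking out d' and then d, so the
    contributions of a symmetric [H] cancel in pairs. *)
Lemma pick2_sym D (H : T -> T -> seq T -> R) :
  (forall d d' r, perm_eq [:: d, d' & r] D -> H d d' r = H d' d r) ->
  \sum_(p <- picks D) p.1.1 *
     \sum_(q <- picks p.2) q.1.1 * H p.1.2 q.1.2 q.2 = 0.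
Proof.
elim: D H => [|d D IH] H Hsym /=; first by rewrite big_nil.
rewrite big_cons big_map /= mul1r -big_split/= big_seq.
under eq_bigr => p pD.
  rewrite big_cons big_map /= mul1r (Hsym d p.1.2); last first.
    by rewrite perm_cons picks_perm.
  rewrite mulNr mulrDr opprD addNKr.
  rewrite -mulrN -sumrN.
  under eq_bigr do rewrite mulNr opprK.
  over.
rewrite -big_seq; apply: (IH (fun d1 d2 r => H d1 d2 (d :: r))) => d1 d2 r Dr.
apply: Hsym; rewrite -(perm_cons d) in Dr; rewrite -(permPr Dr).
by rewrite (perm_catCA [:: _; _] [:: _]).
Qed.

(** Symmetry in the first two slots is asked only after antisymmetrising the others, because in the
    applications the two sides may also agree by both vanishing. *)
Lemma alt_pair n D G : size D = n.+2 ->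
  (forall d d' r, perm_eq [:: d, d' & r] D ->
    alt r (fun l => G [:: d, d' & l]) = alt r (fun l => G [:: d', d & l])) ->
  alt D G = 0.
Proof.
move=> sD Gsym; rewrite (altS _ sD) big_seq.
under eq_bigr => p pD.
  rewrite (@altS n); last by apply/eqP; rewrite -eqSS -(size_picks pD) sD.
  over.
rewrite -big_seq.
exact: (pick2_sym (H := fun d d' r => alt r (fun l => G [:: d, d' & l]))).
Qed.

Lemma alt_sym12 n D G : size D = n.+2 ->
  (forall d d' l, perm_eq [:: d, d' & l] D -> G [:: d, d' & l] = G [:: d', d & l]) ->
  alt D G = 0.
Proof.
move=> sD Gsym; apply: (alt_pair sD) => d d' r Dr; apply: alt_eq => l lr.
by apply: Gsym; rewrite -(permPr Dr) !perm_cons.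
Qed.

Lemma alt_sym23 n D G : size D = n.+3 ->
  (forall a d d' l, perm_eq [:: a, d, d' & l] D ->
    G [:: a, d, d' & l] = G [:: a, d', d & l]) ->
  alt D G = 0.
Proof.
move=> sD Gsym; rewrite (altS _ sD) big_seq big1// => p pD.
rewrite (@alt_sym12 n) ?mulr0//.
  by apply/eqP; rewrite -eqSS -(size_picks pD) sD.
move=> d d' l lp; apply: Gsym.
by rewrite -(permPr (picks_perm pD)) perm_cons.
Qed.

End Alternation.

(** * Cup products of curvatures on the integer grid *)

Section Cochains.
Variables (R : realFieldType) (T : eqType).
Implicit Types (x y : T -> nat) (d : T) (D l : seq T).
Implicit Types (e : (T -> nat) -> T -> R).

Definition upd x d v : T -> nat := fun d' => if d' == d then v else x d'.
Definition inc x d := upd x d (x d).+1.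

Lemma upd_id x d v : upd x d v d = v. Proof. by rewrite /upd eqxx. Qed.

Lemma updC x d d' v v' : d != d' -> upd (upd x d v) d' v' = upd (upd x d' v') d v.
Proof.
move=> dd'; apply/funext => c; rewrite /upd.
by case: (eqVneq c d) => [->|//]; rewrite (negbTE dd').
Qed.

Lemma upd_upd x d v v' : upd (upd x d v) d v' = upd x d v'.
Proof. by apply/funext => c; rewrite /upd; case: eqP. Qed.

Lemma incC x d d' : inc (inc x d) d' = inc (inc x d') d.
Proof.
have [->//|dd'] := eqVneq d d'.
rewrite /inc (_ : upd x d _ d' = x d'); last by rewrite /upd eq_sym (negbTE dd').
by rewrite (_ : upd x d' _ d = x d) 1?updC // /upd (negbTE dd').
Qed.

(** Its antisymmetric part in d and d' is the coboundary of [e] on the square at x, that is, the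
    curvature; [alt] selects this part. *)
Definition corner e x d d' := e x d + e (inc x d) d'.

(** The Alexander-Whitney product: each factor is evaluated on the square that starts where the
    preceding one ends. *)
Fixpoint cup (es : seq ((T -> nat) -> T -> R)) x l : R :=
  match es, l with
  | [::], _ => 1
  | e :: es', [:: d, d' & l'] => corner e x d d' * cup es' (inc (inc x d) d') l'
  | _, _ => 0
  end.

(* The antisymmetrised product of the curvatures is closed. *)
Lemma cup_closed es y D : size D = (size es).*2.+1 ->
  alt D (fun l => if l is d :: l' then cup es (inc y d) l' - cup es y l' else 0) = 0.
Proof.
elim: es y D => [|e es IH] y D sD.
  rewrite -[RHS](alt0 _ D); apply: alt_eq => -[|d l]//= _; exact: subrr.
have {}sD : size D = (size es).*2.+3 by rewrite sD doubleS.
pose F (f : T -> T -> T -> seq T -> R) l :=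
  if l is [:: d1, d2, d3 & l'] then f d1 d2 d3 l' else 0.
have altF f f' : (forall d1 d2 d3 l, perm_eq [:: d1, d2, d3 & l] D ->
    f d1 d2 d3 l = f' d1 d2 d3 l) -> alt D (F f) = alt D (F f').
  by move=> ff'; apply: alt_eq => -[|d1 [|d2 [|d3 l]]]//= /ff'.
have sym12 f : (forall d1 d2 d3 l, f d1 d2 d3 l = f d2 d1 d3 l) -> alt D (F f) = 0.
  move=> fs; apply: (alt_sym12 sD) => d d' l Dl.
  by case: l Dl => [|d3 l]// _; rewrite /F fs.
have sym23 f : (forall d1 d2 d3 l, f d1 d2 d3 l = f d1 d3 d2 l) -> alt D (F f) = 0.
  by move=> fs; apply: (alt_sym23 sD) => d d' d'' l _; rewrite /F fs.
have FB f g : alt D (F (fun d1 d2 d3 l => f d1 d2 d3 l - g d1 d2 d3 l)) = alt D (F f) - alt D (F g).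
  by rewrite -altB; apply: alt_eq => -[|d1 [|d2 [|d3 l]]]//= _; rewrite subrr.
have FN f : alt D (F (fun d1 d2 d3 l => - f d1 d2 d3 l)) = - alt D (F f).
  by rewrite -mulN1r -altZ; apply: alt_eq => -[|d1 [|d2 [|d3 l]]]//= _; rewrite ?mulr0 ?mulN1r.
have swap12 f : alt D (F (fun d1 d2 d3 l => f d2 d1 d3 l)) = - alt D (F f).
  apply/eqP; rewrite -addr_eq0 -[X in _ + X]opprK -FN -FB; apply/eqP/sym12 => *.
  by rewrite !opprK addrC.
have swap23 f : alt D (F (fun d1 d2 d3 l => f d1 d3 d2 l)) = - alt D (F f).
  apply/eqP; rewrite -addr_eq0 -[X in _ + X]opprK -FN -FB; apply/eqP/sym23 => *.
  by rewrite !opprK addrC.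
pose z d1 d2 := inc (inc y d1) d2.
transitivity (alt D (F (fun d1 d2 d3 l =>
    corner e (inc y d1) d2 d3 * cup es (inc (z d1 d2) d3) l
    - corner e y d2 d3 * cup es (z d2 d3) l))).
  apply: alt_eq => -[|d1 [|d2 [|d3 l]]]//= /perm_size; rewrite sD//=.
rewrite FB.
(* A cyclic shift of three slots is even. *)
have -> : alt D (F (fun d1 d2 d3 l => corner e y d2 d3 * cup es (z d2 d3) l)) =
    alt D (F (fun d1 d2 d3 l => corner e y d1 d2 * cup es (z d1 d2) l)).
  by rewrite -[RHS]opprK -swap23 -swap12.
(* The induction hypothesis moves the base point of the remaining factors by one step in the
   direction [d3]. *)
have -> : alt D (F (fun d1 d2 d3 l => corner e y d1 d2 * cup es (z d1 d2) l)) =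
    alt D (F (fun d1 d2 d3 l => corner e y d1 d2 * cup es (inc (z d1 d2) d3) l)).
  apply/esym/eqP; rewrite -subr_eq0 -FB; apply/eqP.
  rewrite (altS _ sD) big_seq big1// => p pD.
  have sp : size p.2 = (size es).*2.+2.
    by apply/eqP; rewrite -eqSS -(size_picks pD) sD.
  rewrite (altS _ sp) big_seq big1 ?mulr0// => q qp.
  have sq : size q.2 = (size es).*2.+1.
    by apply/eqP; rewrite -eqSS -(size_picks qp) sp.
  rewrite -[X in _ * X](_ : corner e y p.1.2 q.1.2 * alt q.2 (fun l => if l is d :: l' then
     cup es (inc (z p.1.2 q.1.2) d) l' - cup es (z p.1.2 q.1.2) l' else 0) = _).
    by rewrite (IH _ _ sq) !mulr0.
  rewrite -altZ; apply: alt_eq => -[|d l]/= _; first by rewrite mulr0.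
  by rewrite mulrBr.
rewrite -FB.
(* The common edge in the direction [d2] cancels. The first remaining term is symmetric in [d1],
   [d2], the second in [d2], [d3]. *)
transitivity (alt D (F (fun d1 d2 d3 l => e (z d1 d2) d3 * cup es (inc (z d1 d2) d3) l
    - e y d1 * cup es (inc (z d1 d2) d3) l))).
  apply: altF => d1 d2 d3 l _; rewrite -!mulrBl; congr (_ * _).
  by rewrite /corner -/(z d1 d2); lra.
rewrite FB sym12 ?sym23 ?subrr// => d1 d2 d3 l; rewrite /z.
- by rewrite incC (incC (inc y d1)).
- by rewrite (incC y).
Qed.


(** The Leibniz rule: as the product of the other curvatures is closed, the whole product is the
    coboundary of [e] times that product. *)
Lemma alt_stokes e es x D : size D = (size es).*2.+2 ->
  alt D (cup (e :: es) x) =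
  alt D (fun l => if l is [:: d1, d2 & l'] then
    e (inc x d1) d2 * cup es (inc (inc x d1) d2) l' - e x d2 * cup es (inc x d2) l'
    else 0).
Proof.
move=> sD; pose F (f : T -> T -> seq T -> R) l :=
  if l is [:: d1, d2 & l'] then f d1 d2 l' else 0.
have altF f f' : (forall d1 d2 l, perm_eq [:: d1, d2 & l] D ->
    f d1 d2 l = f' d1 d2 l) -> alt D (F f) = alt D (F f').
  by move=> ff'; apply: alt_eq => -[|d1 [|d2 l]]//= /ff'.
have FB f g : alt D (F (fun d1 d2 l => f d1 d2 l - g d1 d2 l)) = alt D (F f) - alt D (F g).
  by rewrite -altB; apply: alt_eq => -[|d1 [|d2 l]]//= _; rewrite subrr.
have FN f : alt D (F (fun d1 d2 l => - f d1 d2 l)) = - alt D (F f).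
  by rewrite -mulN1r -altZ; apply: alt_eq => -[|d1 [|d2 l]]//= _; rewrite ?mulr0 ?mulN1r.
have swap12 f : alt D (F (fun d1 d2 l => f d2 d1 l)) = - alt D (F f).
  apply/eqP; rewrite -addr_eq0 -[X in _ + X]opprK -FN -FB; apply/eqP.
  apply: (alt_sym12 sD) => d d' l _ /=.
  by rewrite !opprK addrC.
have -> : alt D (cup (e :: es) x) = alt D (F (fun d1 d2 l =>
     e (inc x d1) d2 * cup es (inc (inc x d1) d2) l -
     (- e x d1 * cup es (inc (inc x d1) d2) l))).
  apply: alt_eq => -[|d1 [|d2 l]]//= _; rewrite /corner; lra.
rewrite FB [RHS](FB (fun d1 d2 l => e (inc x d1) d2 * cup es (inc (inc x d1) d2) l)
   (fun d1 d2 l => e x d2 * cup es (inc x d2) l)); congr (_ - _).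
rewrite (swap12 (fun d1 d2 l => e x d1 * cup es (inc x d1) l)) -FN.
apply/eqP; rewrite -subr_eq0 -FB; apply/eqP.
rewrite (altS _ sD) big_seq big1// => p pD.
have sp : size p.2 = (size es).*2.+1.
  by apply/eqP; rewrite -eqSS -(size_picks pD) sD.
rewrite -[X in _ * X](_ : - e x p.1.2 * alt p.2 (fun l => if l is d :: l' then
   cup es (inc (inc x p.1.2) d) l' - cup es (inc x p.1.2) l' else 0) = _).
  by rewrite (cup_closed _ _) // !mulr0.
rewrite -altZ; apply: alt_eq => -[|d l]/= _; first by rewrite mulr0.
lra.
Qed.

Variable K : nat.

Fixpoint gridsum D (Phi : (T -> nat) -> R) x : R :=
  if D is d :: D' then \sum_(v < K) gridsum D' Phi (upd x d v) else Phi x.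

Lemma gridsum_eq D Phi Psi x :
  (forall y, (forall d, d \in D -> (y d < K)%N) ->
             (forall d, d \notin D -> y d = x d) -> Phi y = Psi y) ->
  gridsum D Phi x = gridsum D Psi x.
Proof.
elim: D x => [|d D IH] x /= PP; first exact: PP.
apply: eq_bigr => v _; apply: IH => y yK yx; apply: PP => c.
  rewrite inE; have [->|_ /= /yK//] := eqVneq c d.
  by have [/yK//|/yx] := boolP (d \in D); rewrite upd_id => ->.
by rewrite inE negb_or => /andP[cd /yx]; rewrite /upd (negbTE cd).
Qed.

Lemma gridsumB D Phi Psi x :
  gridsum D (fun y => Phi y - Psi y) x = gridsum D Phi x - gridsum D Psi x.
Proof.
by elim: D x => //= d D IH x; rewrite -sumrB; apply: eq_bigr => v _; exact: IH.
Qed.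

Lemma gridsumZ D c Phi x : gridsum D (fun y => c * Phi y) x = c * gridsum D Phi x.
Proof.
by elim: D x => //= d D IH x; rewrite mulr_sumr; apply: eq_bigr => v _; exact: IH.
Qed.

Lemma gridsum_sum I (r : seq I) D (Phi : I -> _) x :
  gridsum D (fun y => \sum_(i <- r) Phi i y) x = \sum_(i <- r) gridsum D (Phi i) x.
Proof.
elim: D x => //= d D IH x; rewrite exchange_big /=.
by apply: eq_bigr => v _; exact: IH.
Qed.

Lemma gridsum_upd D Phi x d v : d \notin D ->
  gridsum D Phi (upd x d v) = gridsum D (fun y => Phi (upd y d v)) x.
Proof.
elim: D x => //= c D IH x; rewrite inE negb_or => /andP[dc dD].
by apply: eq_bigr => w _; rewrite updC// IH.
Qed.

Lemma gridsum_rem d D Phi x : uniq D -> d \in D ->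
  gridsum D Phi x = gridsum (d :: rem d D) Phi x.
Proof.
elim: D x => //= c D IH x /andP[cD uD]; rewrite inE eq_sym.
have [->//|dc /= dD] := eqVneq c d.
under eq_bigr => w _ do rewrite (IH _ uD dD) /=.
rewrite exchange_big /=; apply: eq_bigr => v _.
by apply: eq_bigr => w _; rewrite updC.
Qed.

Lemma gridsum_perm D D' Phi x : uniq D -> perm_eq D D' ->
  gridsum D Phi x = gridsum D' Phi x.
Proof.
elim: D' D x => [|d D' IH] D x uD DD'; first by move/perm_nilP: DD' => ->.
have dD : d \in D by rewrite (perm_mem DD') mem_head.
rewrite (gridsum_rem _ _ uD dD) /=; apply: eq_bigr => v _.
apply: IH; first exact: rem_uniq.
by rewrite -(perm_cons d) -(permPr DD') perm_sym perm_to_rem.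
Qed.

Lemma gridsum_telescope d D Xi x : d \notin D ->
  gridsum (d :: D) (fun y => Xi (inc y d) - Xi y) x =
  gridsum D (fun y => Xi (upd y d K) - Xi (upd y d 0)) x.
Proof.
move=> dD /=; under eq_bigr => v _.
  rewrite gridsum_upd// (gridsum_eq (Psi := fun y => Xi (upd y d v.+1) - Xi (upd y d v))).
    rewrite gridsumB; over.
  by move=> y _ _; rewrite /inc upd_id upd_upd.
rewrite -(big_mkord xpredT (fun v => gridsum D (fun y => Xi (upd y d v.+1)) x -
  gridsum D (fun y => Xi (upd y d v)) x)).
by rewrite (telescope_sumr (fun v => gridsum D (fun y => Xi (upd y d v)) x))// -gridsumB.
Qed.

End Cochains.

(** * Evaluation on a product of squares *)

Section Pairs.
Variables (R : realFieldType) (I : eqType) (K : nat) (q0 q1 : R).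
Hypothesis K_gt0 : (0 < K)%N.
Local Notation T := (I * bool)%type.
Implicit Types (x y : T -> nat) (b : I) (bs : seq I) (d : T) (D l : seq T).
Implicit Types (e : (T -> nat) -> T -> R) (es : seq ((T -> nat) -> T -> R)).

(** The square of index b has the direction [(b, false)] of the homotopy parameter s and the
    direction [(b, true)] of the loop parameter t. *)
Definition dirs bs : seq T := flatten [seq [:: (b, false); (b, true)] | b <- bs].

Fixpoint picksb bs : seq (I * seq I) :=
  if bs is b :: bs' then (b, bs') :: [seq (c.1, b :: c.2) | c <- picksb bs']
  else [::].

Definition zero x b := upd (upd x (b, false) 0) (b, true) 0.

Definition on_bdry x b :=
  [|| x (b, false) == 0, x (b, false) == K, x (b, true) == 0 | x (b, true) == K].

(* The edge cochain of a function on the grid that, on the boundary of the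
   square of index b, is a rotated copy of its value at the corner. *)
Definition admissible e :=
  [/\ forall x b d, d.1 != b -> on_bdry x b -> e x d = e (zero x b) d,
      forall x b, x (b, false) = 0 -> e x (b, true) = q0,
      forall x b, x (b, false) = K -> e x (b, true) = q1 &
      forall x b, x (b, true) = 0 \/ x (b, true) = K -> e x (b, false) = 0].

Lemma mem_dirs bs d : (d \in dirs bs) = (d.1 \in bs).
Proof.
elim: bs => //= b bs IH; rewrite /dirs /= !inE -/(dirs bs) IH orbA; congr (_ || _).
by case: d {IH} => c [] /=; rewrite !xpair_eqE /= ?andbT ?andbF ?orbF.
Qed.

Lemma uniq_dirs bs : uniq bs -> uniq (dirs bs).
Proof.
elim: bs => //= b bs IH /andP[bbs /IH ubs].
by rewrite -/(dirs bs) inE !mem_dirs xpair_eqE andbF /= (negbTE bbs).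
Qed.

Lemma size_dirs bs : size (dirs bs) = (size bs).*2.
Proof. by elim: bs => //= b bs; rewrite /dirs /= => ->. Qed.

Lemma picksb_perm bs c : c \in picksb bs -> perm_eq (c.1 :: c.2) bs.
Proof.
elim: bs c => [//|b bs IH] c; rewrite inE => /predU1P[->//|/mapP[c' cbs ->]] /=.
by rewrite (perm_catCA [:: _] [:: _]) /= perm_cons; apply: IH.
Qed.

Lemma size_picksb bs : size (picksb bs) = size bs.
Proof. by elim: bs => //= b bs; rewrite size_map => ->. Qed.

(** Passing over both directions of a square changes the sign twice, so extracting [(b, false)] and
    then [(b, true)] always has the sign +1. *)
Lemma pick_pairs bs (H : I -> seq T -> R) : uniq bs ->
  \sum_(p <- picks R (dirs bs)) p.1.1 * (if p.1.2.2 then 0 else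
    \sum_(q <- picks R p.2) q.1.1 *
       (if q.1.2 == (p.1.2.1, true) then H p.1.2.1 q.2 else 0)) =
  \sum_(c <- picksb bs) H c.1 (dirs c.2).
Proof.
elim: bs H => [|b bs IH] H; first by rewrite /= !big_nil.
move=> /= /andP[bbs ubs]; rewrite /dirs /= -/(dirs bs).
rewrite !(big_cons, big_map) /= eqxx !mul1r mulr0 add0r -addrA.
congr (_ + _).
rewrite [X in X + _]big_seq big1 ?add0r => [|p pD]; last first.
  case: eqP => [pb|]; last by rewrite mulr0.
  by move: bbs; rewrite -(mem_dirs bs (b, true)) -pb -(perm_mem (picks_perm pD)) mem_head.
rewrite -(IH (fun c r => H c [:: (b, false), (b, true) & r]))//.
rewrite [LHS]big_seq [RHS]big_seq; apply: eq_bigr => p pD; rewrite opprK.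
have pb : p.1.2.1 != b.
  apply: contraNneq bbs => <-.
  by rewrite -mem_dirs -(perm_mem (picks_perm pD)) mem_head.
congr (_ * _); case: ifP => // _.
rewrite !(big_cons, big_map) /= !xpair_eqE /= andbF eq_sym (negbTE pb).
rewrite !mulr0 !add0r; apply: eq_bigr => q _; rewrite opprK; done.
Qed.

Lemma inc_neq x d d' : d' != d -> inc x d d' = x d'.
Proof. by rewrite /inc /upd => /negbTE ->. Qed.

Lemma zero_inc x b d : d.1 != b -> zero (inc x d) b = inc (zero x b) d.
Proof.
move=> db; have neq c : d != (b, c) by apply: contraNneq db => ->.
rewrite /zero /inc !(updC _ _ _ (neq _)) /upd /=.
by rewrite !(negbTE (neq _)).
Qed.

Lemma zero_inc_pair x b c : zero (inc x (b, c)) b = zero x b.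
Proof.
apply/funext => d; rewrite /zero /inc /upd.
by case: c; do 2![case: eqP => // _].
Qed.

Lemma on_bdry_inc x b d : d.1 != b -> on_bdry (inc x d) b = on_bdry x b.
Proof. by move=> db; rewrite /on_bdry !inc_neq //; apply: contraNneq db => <-. Qed.

Lemma cup_bdry es y b l : {in es, forall e, admissible e} ->
  (forall d, d \in l -> d.1 != b) -> on_bdry y b -> cup es y l = cup es (zero y b) l.
Proof.
elim: es y l => [//|e es IH] y [|d [|d' l]]// adm lb yb /=.
have db : d.1 != b by apply: lb; rewrite mem_head.
have d'b : d'.1 != b by apply: lb; rewrite !inE eqxx orbT.
have [e1 _ _ _] := adm e (mem_head _ _).
rewrite /corner -!zero_inc// -!e1 ?on_bdry_inc//; congr (_ * _).
apply: IH; rewrite ?on_bdry_inc//.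
- by move=> ? ?; apply: adm; rewrite inE orbC; apply/orP; left.
- by move=> c cl; apply: lb; rewrite !inE cl !orbT.
Qed.

(** The sides t = 0 and t = K of a square carry the same values; their boundary contributions will
    cancel. *)
Lemma admissible_tface e z b c : admissible e -> z (b, true) = K ->
  (b, true) != c -> e z c = e (upd z (b, true) 0) c.
Proof.
case=> e1 _ _ e4 zK; case: c => c i; case: (eqVneq c b) => [->|cb _].
  case: i; rewrite ?eqxx// => _.
  by rewrite !e4 ?upd_id; [|left|right].
rewrite (e1 _ b) // /on_bdry ?zK ?eqxx ?orbT//.
rewrite (e1 (upd _ _ _) b) // /on_bdry ?upd_id ?eqxx ?orbT//.
congr (e _ _); apply/funext => d1; rewrite /zero /upd.
by do !case: eqP => // ?.
Qed.

Lemma inc_upd z d c v : d != c -> inc (upd z d v) c = upd (inc z c) d v.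
Proof.
by move=> dc; rewrite /inc [upd _ _ _ c]/upd eq_sym (negbTE dc) updC.
Qed.

Lemma cup_tface es y b l : {in es, forall e, admissible e} ->
  (b, true) \notin l -> y (b, true) = K ->
  cup es y l = cup es (upd y (b, true) 0) l.
Proof.
elim: es y l => [//|e es IH] y [|d [|d' l]]// adm + yK /=.
rewrite !inE !negb_or => /and3P[bd bd' bl].
have eupd := admissible_tface (adm e (mem_head _ _)).
have iK z c : z (b, true) = K -> (b, true) != c -> inc z c (b, true) = K.
  by move=> zK bc; rewrite inc_neq.
rewrite /corner !(inc_upd y 0 bd) (inc_upd (inc y d) 0 bd') -!eupd ?iK//; congr (_ * _).
apply: IH => //; last by rewrite !iK.
by move=> ? ?; apply: adm; rewrite inE orbC; apply/orP; left.
Qed.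

Definition on_face x b := (x (b, false) == 0) || (x (b, false) == K).

Definition face_val x b := if x (b, false) == 0 then q0 else q1.

Lemma admissible_face e x b : admissible e -> on_face x b -> e x (b, true) = face_val x b.
Proof.
by case=> _ e2 e3 _; rewrite /on_face /face_val; case: eqP => [/e2//|_ /= /eqP/e3].
Qed.

Lemma on_face_bdry x b : on_face x b -> on_bdry x b.
Proof. by rewrite /on_face /on_bdry orbA => ->. Qed.

(** On a face s = 0 or s = K the cochain is constant in the direction t, and its values in the other
    directions do not depend on t. Hence the curvature of every square containing the direction t
    vanishes, and this direction is bound to occur in some factor. *)
Lemma alt_face0 es y b D : {in es, forall e, admissible e} ->
  uniq D -> size D = (size es).*2 -> on_face y b ->
  (b, true) \in D -> (b, false) \notin D -> alt D (cup es y) = 0.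
Proof.
elim: es y D => [|e es IH] y D adm uD sD yb tD sND.
  by move/size0nil: sD tD => ->.
have adm' : {in es, forall e, admissible e}.
  by move=> ? ?; apply: adm; rewrite inE orbC; apply/orP; left.
have [e1 _ _ _] := adm e (mem_head _ _).
have aface := admissible_face (adm e (mem_head _ _)).
apply: (@alt_pair _ _ (size es).*2) => // d d' r Dr.
rewrite (altZ _ (corner e y d d')) (altZ _ (corner e y d' d)).
rewrite (incC y).
have dsr c : c \in [:: d, d' & r] -> c != (b, false).
  by rewrite (perm_mem Dr) => cD; apply: contraNneq sND => <-.
have ds : (b, false) != d by rewrite eq_sym; apply: dsr; rewrite mem_head.
have d's : (b, false) != d' by rewrite eq_sym; apply: dsr; rewrite !inE eqxx orbT.
have face_inc z c : (b, false) != c -> on_face (inc z c) b = on_face z b.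
  by move=> cb; rewrite /on_face !inc_neq.
have val_inc z c : (b, false) != c -> face_val (inc z c) b = face_val z b.
  by move=> cb; rewrite /face_val !inc_neq.
have [ur udr] : uniq r /\ uniq [:: d, d' & r].
  by rewrite (perm_uniq Dr); split => //; rewrite -(perm_uniq Dr) in uD; case/and3P: uD.
have [tr|tNr] := boolP ((b, true) \in r).
  rewrite (IH _ r) ?mulr0 ?face_inc//.
    by move/perm_size: Dr; rewrite sD /= doubleS => -[].
  by apply/negP => sr; move: (dsr (b, false)); rewrite !inE sr !orbT eqxx => /(_ isT).
congr (_ * _).
have symt c : (b, false) != c -> c != (b, true) ->
    corner e y (b, true) c = corner e y c (b, true).
  move=> bc cb; rewrite /corner aface // aface ?face_inc// val_inc// addrC; congr (_ + _).
  have cb1 : c.1 != b.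
    by case: (c) bc cb => c1 [] /=; rewrite !xpair_eqE ?andbT ?andbF //= eq_sym.
  rewrite (e1 _ b)// ?(e1 y b)// ?zero_inc_pair//; apply: on_face_bdry => //.
  by rewrite face_inc// xpair_eqE andbF.
move: tD; rewrite -(perm_mem Dr) !inE (negbTE tNr) orbF.
case/orP => /eqP eb; subst.
- by apply: symt => //; move: udr => /andP[]; rewrite inE negb_or eq_sym => /andP[].
- by apply/esym/symt => //; move: udr => /andP[]; rewrite inE negb_or => /andP[].
Qed.

(** A factor without curvature makes the exchange of its two directions harmless, which cancels the
    terms in pairs. The preceding factors move the base vertex, so flatness is required at all
    vertices of the cell of [x]. *)
Lemma cup_flat (es : seq ((T -> nat) -> T -> R)) x D : uniq D -> size D = (size es).*2 ->
  (exists2 e, e \in es & forall y d d', (forall c, x c <= y c <= (x c).+1)%N ->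
     d != d' -> y d = x d -> y d' = x d' -> corner e y d d' = corner e y d' d) ->
  alt D (cup es x) = 0.
Proof.
move=> uD sD [e ees flat].
suff: forall y, (forall c, x c <= y c <= (x c).+1)%N -> {in D, y =1 x} ->
    alt D (cup es y) = 0.
  by apply => // c; rewrite leqnn leqnSn.
elim: es D uD sD ees => [//|e' es IH] D uD sD ees y xy yx.
apply: (@alt_pair _ _ (size es).*2) => // d d' r Dr.
rewrite (altZ _ (corner e' y d d')) (altZ _ (corner e' y d' d)) (incC y).
have : uniq [:: d, d' & r] by rewrite (perm_uniq Dr).
rewrite /= !inE negb_or -!andbA => /and4P[dd' dr d'r ur].
have yd : y d = x d by apply: yx; rewrite -(perm_mem Dr) mem_head.
have yd' : y d' = x d' by apply: yx; rewrite -(perm_mem Dr) !inE eqxx orbT.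
move: ees; rewrite inE => /predU1P[ee'|ees]; first by rewrite -ee' flat.
rewrite IH ?mulr0//.
- by move/perm_size: Dr; rewrite sD /= doubleS => -[].
- move=> c; rewrite /inc /upd.
  case: (c =P d') => [->|_]; first by rewrite eq_sym (negbTE dd') yd' leqnn leqnSn.
  by case: (c =P d) => [->|_]; rewrite ?(negbTE dd') ?yd ?leqnn ?leqnSn ?xy.
- move=> c cr; rewrite !inc_neq ?yx// -?(perm_mem Dr) ?inE ?cr ?orbT//.
  + by apply: contraNneq d'r => <-.
  + by apply: contraNneq dr => <-.
Qed.

(** The product evaluated on the fundamental chain of the grid. *)
Definition pairing bs (es : seq ((T -> nat) -> T -> R)) : R :=
  gridsum K (dirs bs) (fun x => alt (dirs bs) (cup es x)) (fun=> 0%N).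

(** Stokes leaves only faces. The faces in the directions t cancel; on a face in a direction s only
    the terms whose first edge runs in the direction t of the same square survive. They contribute
    [q1] or [q0] once for each of the K positions along t, times the pairing on the remaining
    squares. *)
Lemma pairing_step bs e es : uniq bs -> size bs = (size es).+1 ->
  {in e :: es, forall e, admissible e} ->
  pairing bs (e :: es) =
  \sum_(c <- picksb bs) (q1 - q0) * K%:R * pairing c.2 es.
Proof.
move=> ubs sbs adm.
have [e1 e2 e3 e4] := adm e (mem_head _ _).
have adm' : {in es, forall e, admissible e}.
  by move=> ? ?; apply: adm; rewrite inE orbC; apply/orP; left.
have sD : size (dirs bs) = (size es).*2.+2 by rewrite size_dirs sbs doubleS.
(* The primitive of the product, as in [alt_stokes]. *)
pose Psi x (l : seq T) := if l is d :: l' then e x d * cup es (inc x d) l' else 0.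
rewrite /pairing (gridsum_eq (Psi := fun x => \sum_(p <- picks R (dirs bs))
    p.1.1 * (alt p.2 (Psi (inc x p.1.2)) - alt p.2 (Psi x)))); last first.
  move=> y _ _; rewrite alt_stokes// (altS _ sD); apply: eq_bigr => p _.
  by congr (_ * _); rewrite -altB; apply: alt_eq => -[|d l] _ //=; rewrite subrr.
rewrite gridsum_sum.
transitivity (\sum_(p <- picks R (dirs bs)) p.1.1 * (if p.1.2.2 then 0 else
    \sum_(q <- picks R p.2) q.1.1 *
       (if q.1.2 == (p.1.2.1, true) then
       (q1 - q0) * K%:R * gridsum K q.2 (fun x => alt q.2 (cup es x)) (fun=> 0%N) else 0))).
  rewrite [LHS]big_seq [RHS]big_seq; apply: eq_bigr => p pD.
  rewrite gridsumZ; congr (_ * _).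
  have pp := picks_perm pD.
  have := uniq_dirs ubs; rewrite -(perm_uniq pp) /= => /andP[dr ur].
  rewrite (@gridsum_perm _ _ _ _ (p.1.2 :: p.2)) ?uniq_dirs// 1?perm_sym//.
  rewrite (gridsum_telescope _ (fun x => alt p.2 (Psi x)))//.
  case: p pD pp dr ur => -[sg [b i]] r /= pD pp dr ur; case: i pD pp dr => pD pp dr.
    (* Direction t: the faces at 0 and at K carry the same values. *)
    rewrite (gridsum_eq (Psi := fun=> 0 * 0)) ?gridsumZ ?mul0r// => x _ _.
    rewrite ?mul0r; apply/eqP; rewrite subr_eq0; apply/eqP/alt_eq => -[|d l] dl //=.
    have [td tl] : (b, true) != d /\ (b, true) \notin l.
      by move: dr; rewrite -(perm_mem dl) inE negb_or => /andP[].
    rewrite (admissible_tface (adm e (mem_head _ _)) _ td) ?upd_id// upd_upd.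
    rewrite (cup_tface (b := b)) // ?inc_neq ?upd_id// 1?eq_sym//.
    by rewrite -inc_upd// !upd_upd.
  have sr : size r = (size es).*2.+1.
    by apply/eqP; rewrite -eqSS -sD -(perm_size pp).
  have tr : (b, true) \in r.
    have : (b, true) \in dirs bs by rewrite mem_dirs -(mem_dirs _ (b, false)) -(perm_mem pp) mem_head.
    by rewrite -(perm_mem pp) inE xpair_eqE andbF.
  have faceE v : (v == 0) || (v == K) ->
      gridsum K r (fun y => alt r (Psi (upd y (b, false) v))) (fun=> 0%N) =
      \sum_(q <- picks R r) q.1.1 * (if q.1.2 == (b, true) then
        (if v == 0 then q0 else q1) * K%:R *
         gridsum K q.2 (fun x => alt q.2 (cup es x)) (fun=> 0%N) else 0).
    move=> v0K.
    rewrite (gridsum_eq (Psi := fun y => \sum_(q <- picks R r) q.1.1 *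
      (if q.1.2 == (b, true) then (if v == 0 then q0 else q1) *
         alt q.2 (cup es (zero y b)) else 0))); last first.
      move=> y _ _; rewrite (altS _ sr) [LHS]big_seq [RHS]big_seq.
      apply: eq_bigr => q qr; congr (_ * _).
      set z := upd _ _ _.
      have zface : on_face z b by rewrite /on_face /z upd_id.
      rewrite -[LHS]/(alt q.2 (fun l => e z q.1.2 * cup es (inc z q.1.2) l)) altZ.
      have qp := picks_perm qr.
      move: ur; rewrite -(perm_uniq qp) => /= /andP[qNq uq].
      move: dr; rewrite -(perm_mem qp) inE negb_or => /andP[sq sNq].
      (* Unless the first edge has the direction t, this direction occurs among the curvatures, and
         [alt_face0] applies. *)
      case: eqP => [qt|/eqP qt]; last first.
        rewrite (@alt_face0 _ _ b) ?mulr0//.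
        + by apply/eqP; rewrite -eqSS -sr (size_picks qr).
        + by rewrite /on_face !inc_neq.
        + by move: tr; rewrite -(perm_mem qp) inE eq_sym (negbTE qt).
      rewrite qt (admissible_face (adm e (mem_head _ _)) zface).
      rewrite /face_val {1}/z upd_id; congr (_ * _); apply: alt_eq => l lq.
      rewrite (cup_bdry (b := b))// ?zero_inc_pair.
      + by congr (cup _ _ _); apply/funext => d; rewrite /z /zero /upd; do !case: eqP => // ?.
      + move=> [c i]; rewrite (perm_mem lq) => cq /=; apply/eqP => cb; subst c.
        by case: i cq => cq; [move: qNq; rewrite qt cq|rewrite cq in sNq].
      + by apply: on_face_bdry; rewrite /on_face !inc_neq ?xpair_eqE ?andbF.
    rewrite gridsum_sum [LHS]big_seq [RHS]big_seq; apply: eq_bigr => q qr.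
    rewrite gridsumZ; congr (_ * _); case: eqP => [qt|_]; last first.
      by rewrite -[X in gridsum K r X]/(fun=> 0) (gridsum_eq (Psi := fun=> 0 * 0)) ?gridsumZ ?mul0r// => *; rewrite ?mul0r.
    rewrite gridsumZ -mulrA; congr (_ * _).
    have qp := picks_perm qr.
    rewrite (@gridsum_perm _ _ _ _ (q.1.2 :: q.2)) 1?perm_sym//.
    have qN : q.1.2 \notin q.2 by move: ur; rewrite -(perm_uniq qp) /= => /andP[].
    have sN : (b, false) \notin q.2.
      by move: dr; rewrite -(perm_mem qp) inE negb_or => /andP[].
    (* After [zero] nothing depends on the position along t, which leaves K equal terms. *)
    rewrite /= (eq_bigr (fun=> gridsum K q.2 (fun x => alt q.2 (cup es x)) (fun=> 0%N))).
      by rewrite sumr_const card_ord mulr_natl.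
    move=> w _; rewrite gridsum_upd//; apply: gridsum_eq => y _ y0.
    congr alt; congr cup; apply/funext => d; rewrite /zero qt /upd.
    case: eqP => [->|/eqP dt]; first by rewrite y0 // -qt.
    by case: eqP => [->|//]; rewrite y0.
  rewrite gridsumB !faceE ?eqxx ?orbT//; last first.
  rewrite -sumrB; apply: eq_bigr => q _; rewrite (gtn_eqF K_gt0).
  by case: ifP => _; lra.
by rewrite (pick_pairs (fun b D => (q1 - q0) * K%:R * gridsum K D (fun x => alt D (cup es x)) (fun=> 0%N)) ubs).
Qed.

(** Each step chooses one of the remaining squares, whence the factorial. *)
Lemma pairingE bs es : uniq bs -> size bs = size es ->
  {in es, forall e, admissible e} ->
  pairing bs es = ((q1 - q0) * K%:R) ^+ size es * (size es)`!%:R.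
Proof.
elim: es bs => [|e es IH] bs ubs sbs adm.
  by move/size0nil: sbs => ->; rewrite /pairing /alt /= mulr1.
rewrite pairing_step// big_seq.
under eq_bigr => c cbs.
  have cp := picksb_perm cbs.
  have : uniq (c.1 :: c.2) by rewrite (perm_uniq cp).
  move=> /= /andP[_ uc].
  rewrite IH//; [over| |].
    by apply/eqP; rewrite -eqSS; move/perm_size: cp => /= ->; rewrite sbs.
  by move=> ? ?; apply: adm; rewrite inE orbC; apply/orP; left.
rewrite -big_seq big_const_seq count_predT size_picksb sbs iter_addr_0.
rewrite exprS factS natrM -[LHS]mulr_natl; set a := _ ^+ _.
by set c := (size es).+1%:R; lra.
Qed.
End Pairs.

(** * Angles and the degree obstruction *)

Section Angles.
Variable R : realType.
Implicit Types (z w : R * R).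

Definition rot (th : R) z : R * R :=
  (cos th * z.1 - sin th * z.2, sin th * z.1 + cos th * z.2).

(* Real and imaginary part of [w * conj z]. *)
Definition cdot z w := w.1 * z.1 + w.2 * z.2.
Definition cdet z w := w.2 * z.1 - w.1 * z.2.

(** The oriented angle from z to w when [cdot z w] is positive; it then lies strictly between -pi/2
    and pi/2. *)
Definition angle z w : R := atan (cdet z w / cdot z w).

Lemma rotD a b z : rot (a + b) z = rot a (rot b z).
Proof. by rewrite /rot cosD sinD; congr (_, _) => /=; lra. Qed.

Lemma rot0 z : rot 0 z = z.
Proof. by rewrite /rot cos0 sin0 !mul1r !mul0r subr0 add0r; case: z. Qed.

Lemma rot_sqr a z : (rot a z).1 ^+ 2 + (rot a z).2 ^+ 2 = z.1 ^+ 2 + z.2 ^+ 2.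
Proof.
have := cos2Dsin2 a; rewrite /rot /=.
set c := cos a; set s := sin a => cs.
transitivity ((c ^+ 2 + s ^+ 2) * (z.1 ^+ 2 + z.2 ^+ 2)); first by lra.
by rewrite cs mul1r.
Qed.

Lemma angle_rot a z w : angle (rot a z) (rot a w) = angle z w.
Proof.
have cs := cos2Dsin2 a.
rewrite /angle; congr (atan (_ / _)); rewrite /cdet /cdot /rot /=.
  transitivity ((cos a ^+ 2 + sin a ^+ 2) * (w.2 * z.1 - w.1 * z.2)); first by lra.
  by rewrite cs mul1r.
transitivity ((cos a ^+ 2 + sin a ^+ 2) * (w.1 * z.1 + w.2 * z.2)); first by lra.
by rewrite cs mul1r.
Qed.

Lemma angle_rotr a z : 0 < z.1 ^+ 2 + z.2 ^+ 2 -> - (pi / 2) < a < pi / 2 ->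
  angle z (rot a z) = a.
Proof.
move=> z0 a2; have ca := cos_gt0_pihalf a2.
rewrite /angle (_ : _ / _ = tan a) ?tanK ?in_itv//.
rewrite /tan (_ : cdet _ _ = sin a * (z.1 ^+ 2 + z.2 ^+ 2)).
  rewrite (_ : cdot _ _ = cos a * (z.1 ^+ 2 + z.2 ^+ 2)).
    by rewrite -mulf_div divff ?mulr1// lt0r_neq0.
  by rewrite /cdot /rot /=; lra.
by rewrite /cdet /rot /=; lra.
Qed.

Lemma atanD (x y : R) : `|x| < 1 -> `|y| < 1 ->
  atan x + atan y = atan ((x + y) / (1 - x * y)).
Proof.
move=> x1 y1.
have ha (t : R) : `|t| < 1 -> - (pi / 4%:R) < atan t < pi / 4%:R.
  rewrite ltr_norml => /andP[t0 t1]; rewrite -atan1 -atanN.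
  by rewrite !lt_atan.
have /andP[ax0 ax1] := ha _ x1; have /andP[ay0 ay1] := ha _ y1.
have axy : - (pi / 2) < atan x + atan y < pi / 2.
  by apply/andP; split; lra.
have nz t : cos (@atan R t) != 0.
  rewrite lt0r_neq0// cos_gt0_pihalf//.
  by rewrite atan_gtNpi2 atan_ltpi2.
by rewrite -[LHS]tanK ?in_itv// tanD// ?atanK.
Qed.

(** The hypotheses bound both angles by pi/4, so that their sum stays in the range of [atan]. *)
Lemma angleD z0 z1 z2 : `|cdet z0 z1| < cdot z0 z1 -> `|cdet z1 z2| < cdot z1 z2 ->
  angle z0 z1 + angle z1 z2 = angle z0 z2.
Proof.
move=> q1 q2.
have p1 : 0 < cdot z0 z1 by apply: le_lt_trans q1.
have p2 : 0 < cdot z1 z2 by apply: le_lt_trans q2.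
rewrite /angle atanD ?normrM ?normfV ?(gtr0_norm p1) ?(gtr0_norm p2) ?ltr_pdivrMr ?mul1r//.
congr atan.
set a := cdot z0 z1 in p1 q1 *; set b := cdet z0 z1 in q1 *.
set c := cdot z1 z2 in p2 q2 *; set d := cdet z1 z2 in q2 *.
have n1 : z1.1 ^+ 2 + z1.2 ^+ 2 != 0.
  apply/eqP => /eqP; rewrite paddr_eq0 ?sqr_ge0// !sqrf_eq0 => /andP[/eqP e1 /eqP e2].
  by move: p1; rewrite /a /cdot e1 e2 !mul0r addr0 ltxx.
have acbd : a * c - b * d = (z1.1 ^+ 2 + z1.2 ^+ 2) * cdot z0 z2.
  by rewrite /a /b /c /d /cdot /cdet; lra.
have adbc : a * d + b * c = (z1.1 ^+ 2 + z1.2 ^+ 2) * cdet z0 z2.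
  by rewrite /a /b /c /d /cdot /cdet; lra.
have bdac : b * d < a * c.
  apply: le_lt_trans (ler_norm _) _; rewrite normrM.
  by apply: ltr_pM.
have nc : cdot z0 z2 != 0.
  apply/eqP => c0; move: acbd; rewrite c0 mulr0 => /eqP; rewrite subr_eq0.
  by rewrite (gt_eqF bdac).
transitivity ((a * d + b * c) / (a * c - b * d)).
  have ac0 : a * c != 0 by rewrite mulf_neq0 ?lt0r_neq0.
  rewrite addf_div ?lt0r_neq0// mulf_div -{1}(divff ac0) -mulrBl invf_div mulrA divfK//.
  by congr (_ / _); lra.
by rewrite acbd adbc -mulf_div divff// mul1r.
Qed.

(** Here m is the sup norm of z. Two points within m / 16 of z in both coordinates are seen from 0
    under an angle below pi/4, as [angleD] requires. *)
Lemma near_quadrant z u v (m e : R) : 0 < e -> 16%:R * e <= m ->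
  (m = `|z.1| /\ `|z.2| <= m) \/ (m = `|z.2| /\ `|z.1| <= m) ->
  `|u.1 - z.1| <= e -> `|u.2 - z.2| <= e -> `|v.1 - z.1| <= e -> `|v.2 - z.2| <= e ->
  `|cdet u v| < cdot u v.
Proof.
move=> e0 em zm.
set a1 := u.1 - z.1; set a2 := u.2 - z.2; set b1 := v.1 - z.1; set b2 := v.2 - z.2.
move=> ha1 ha2 hb1 hb2.
have [z1m z2m] : `|z.1| <= m /\ `|z.2| <= m by case: zm => -[-> ->]; rewrite lexx.
have mz : m ^+ 2 <= z.1 ^+ 2 + z.2 ^+ 2.
  by case: zm => -[-> _]; rewrite real_normK ?num_real// ?lerDl ?lerDr sqr_ge0.
have prod (x y p q : R) : `|x| <= p -> `|y| <= q -> `|x * y| <= p * q.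
  by move=> xp yq; rewrite normrM ler_pM.
have := prod _ _ _ _ z1m ha1; have := prod _ _ _ _ z1m ha2.
have := prod _ _ _ _ z1m hb1; have := prod _ _ _ _ z1m hb2.
have := prod _ _ _ _ z2m ha1; have := prod _ _ _ _ z2m ha2.
have := prod _ _ _ _ z2m hb1; have := prod _ _ _ _ z2m hb2.
have := prod _ _ _ _ ha1 hb1; have := prod _ _ _ _ ha2 hb2.
have := prod _ _ _ _ ha1 hb2; have := prod _ _ _ _ ha2 hb1.
have -> : u = (z.1 + a1, z.2 + a2) by rewrite /a1 /a2 ![_ + (_ - _)]addrC !subrK; case: (u).
have -> : v = (z.1 + b1, z.2 + b2) by rewrite /b1 /b2 ![_ + (_ - _)]addrC !subrK; case: (v).
rewrite /cdet /cdot /= !ler_norml ltr_norml.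
rewrite (_ : (z.2 + b2) * (z.1 + a1) - (z.1 + b1) * (z.2 + a2) =
  z.2 * a1 + z.1 * b2 + a1 * b2 - z.1 * a2 - z.2 * b1 - a2 * b1); last by lra.
rewrite (_ : (z.1 + b1) * (z.1 + a1) + (z.2 + b2) * (z.2 + a2) =
  (z.1 ^+ 2 + z.2 ^+ 2) + z.1 * a1 + z.1 * b1 + a1 * b1 + z.2 * a2 + z.2 * b2 + a2 * b2); last by lra.
(* The main term of [cdot] is at least m^2, and [cdot] and [cdet] each have an error of at most 4 m
   e + 2 e^2. *)
have em2 : 8%:R * (m * e) + 4%:R * (e * e) < m ^+ 2 by nra.
move=> /andP[? ?] /andP[? ?] /andP[? ?] /andP[? ?] /andP[? ?] /andP[? ?].
move=> /andP[? ?] /andP[? ?] /andP[? ?] /andP[? ?] /andP[? ?] /andP[? ?].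
by apply/andP; split; lra.
Qed.

End Angles.

(** * The angular cochains of a map on the cube *)

Section NoExtension.
Variables (R : realType) (L : nat).
Local Notation T := ('I_L * bool)%type.
Implicit Types (z : T -> R) (b : 'I_L).

Definition cube z := forall d, 0 <= z d <= 1.

Definition collapse z b : T -> R := fun d => if d.1 == b then 0 else z d.

Variables (G : (T -> R) -> 'I_L -> R * R) (i j : int).

Hypothesis G_unif : forall e, 0 < e -> exists2 dl, 0 < dl & forall z w,
  cube z -> cube w -> (forall d, `|z d - w d| < dl) ->
  forall a, `|(G z a).1 - (G w a).1| <= e /\ `|(G z a).2 - (G w a).2| <= e.
Hypothesis G_far : exists2 dl, 0 < dl & forall z, cube z ->
  exists a, (dl <= `|(G z a).1|) || (dl <= `|(G z a).2|).
Hypothesis G_s0 : forall z b a, cube z -> z (b, false) = 0 ->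
  G z a = rot (2 * pi * i%:~R * z (b, true)) (G (collapse z b) a).
Hypothesis G_s1 : forall z b a, cube z -> z (b, false) = 1 ->
  G z a = rot (2 * pi * j%:~R * z (b, true)) (G (collapse z b) a).
Hypothesis G_t : forall z b a, cube z -> z (b, true) = 0 \/ z (b, true) = 1 ->
  G z a = G (collapse z b) a.

Variable K : nat.
Hypothesis K_gt0 : (0 < K)%N.

(** Clamping at [K] sends every index function into the cube. *)
Definition gpt (x : T -> nat) : T -> R := fun d => (minn (x d) K)%:R / K%:R.

Lemma gpt_cube x : cube (gpt x).
Proof.
move=> d; rewrite /gpt divr_ge0 ?ler0n//= ler_pdivrMr ?ltr0n// mul1r ler_nat.
exact: geq_minr.
Qed.

Lemma gpt_zero x b : gpt (zero x b) = collapse (gpt x) b.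
Proof.
apply/funext => -[c k]; rewrite /gpt /zero /collapse /upd /=.
have [->|cb] := eqVneq c b.
  by case: k; rewrite ?eqxx /= ?min0n ?mul0r// xpair_eqE eqxx /= min0n mul0r.
by rewrite !xpair_eqE (negbTE cb).
Qed.

(** The increment of the angle, in full turns. On the boundary of a square it is prescribed by the
    rotation instead, because the component may vanish there; [edgeE] shows that both agree where
    the component is nonzero. *)
Definition edge (a : 'I_L) (x : T -> nat) (d : T) : R :=
  if d.2 then
    if x (d.1, false) == 0%N then i%:~R / K%:R
    else if x (d.1, false) == K then j%:~R / K%:R
    else angle (G (gpt x) a) (G (gpt (inc x d)) a) / (2 * pi)
  else if (x (d.1, true) == 0%N) || (x (d.1, true) == K) then 0
    else angle (G (gpt x) a) (G (gpt (inc x d)) a) / (2 * pi).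

Lemma G_bdry x b : on_bdry K x b ->
  exists th, forall y a, y (b, false) = x (b, false) -> y (b, true) = x (b, true) ->
    G (gpt y) a = rot th (G (gpt (zero y b)) a).
Proof.
have K0 : K%:R != 0 :> R by rewrite pnatr_eq0 -lt0n.
move=> /or4P[] /eqP xb.
- exists (2 * pi * i%:~R * gpt x (b, true)) => y a ys yt.
  rewrite (@G_s0 _ b) ?gpt_zero//; first by rewrite /gpt yt.
    exact: gpt_cube.
  by rewrite /gpt ys xb min0n mul0r.
- exists (2 * pi * j%:~R * gpt x (b, true)) => y a ys yt.
  rewrite (@G_s1 _ b) ?gpt_zero//; first by rewrite /gpt yt.
    exact: gpt_cube.
  by rewrite /gpt ys xb minnn divff.
- exists 0 => y a ys yt; rewrite rot0 gpt_zero (@G_t _ b)//; first exact: gpt_cube.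
  by left; rewrite /gpt yt xb min0n mul0r.
- exists 0 => y a ys yt; rewrite rot0 gpt_zero (@G_t _ b)//; first exact: gpt_cube.
  by right; rewrite /gpt yt xb minnn divff.
Qed.

Lemma edge_admissible a : admissible K (i%:~R / K%:R) (j%:~R / K%:R) (edge a).
Proof.
split.
- move=> x b d db xb; have [th Gth] := G_bdry xb.
  have zN k : zero x b (d.1, k) = x (d.1, k).
    by rewrite /zero /upd !xpair_eqE (negbTE db).
  rewrite /edge !zN.
  have -> : angle (G (gpt x) a) (G (gpt (inc x d)) a) =
      angle (G (gpt (zero x b)) a) (G (gpt (inc (zero x b) d)) a).
    rewrite -zero_inc// (Gth x)// (Gth (inc x d)) ?angle_rot// inc_neq//.
    + by apply: contraNneq db => <-.
    + by apply: contraNneq db => <-.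
  by [].
- by move=> x b xb; rewrite /edge /= xb eqxx.
- by move=> x b xb; rewrite /edge /= xb eqxx gtn_eqF.
- by move=> x b [] xb; rewrite /edge /= xb eqxx ?orbT.
Qed.

(** One boundary edge then turns by less than a quarter turn, so that [angle] recovers the
    rotation. *)
Hypothesis K_large : (4 * (`|i| + `|j|) < K)%N.

Lemma edgeE a (x : T -> nat) d : (x d < K)%N ->
  0 < (G (gpt x) a).1 ^+ 2 + (G (gpt x) a).2 ^+ 2 ->
  edge a x d = angle (G (gpt x) a) (G (gpt (inc x d)) a) / (2 * pi).
Proof.
have K0 : K%:R != 0 :> R by rewrite pnatr_eq0 -lt0n.
have pi0 := @pi_gt0 R.
case: d => b [] xd G0; rewrite /edge /=; last first.
  case: ifPn => // /orP xb.
  have xE y : y (b, true) = x (b, true) -> G (gpt y) a = G (gpt (zero y b)) a.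
    move=> yx; rewrite gpt_zero (@G_t _ b)//; first exact: gpt_cube.
    by case: xb => /eqP xb; [left|right]; rewrite /gpt yx xb ?min0n ?mul0r// minnn divff.
  rewrite (xE x)// (xE (inc x _)) ?inc_neq ?xpair_eqE ?andbF// zero_inc_pair.
  by rewrite /angle /cdet [X in X - _]mulrC subrr mul0r atan0 mul0r.
have rotE (m : int) : (4 * `|m| < K)%N ->
    (forall y, y (b, false) = x (b, false) ->
       G (gpt y) a = rot (2 * pi * m%:~R * gpt y (b, true)) (G (gpt (zero y b)) a)) ->
    m%:~R / K%:R = angle (G (gpt x) a) (G (gpt (inc x (b, true))) a) / (2 * pi).
  move=> mK Gm; rewrite (Gm (inc x _)) ?inc_neq ?xpair_eqE ?andbF// zero_inc_pair.
  have -> : 2 * pi * m%:~R * gpt (inc x (b, true)) (b, true) =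
      2 * pi * m%:~R / K%:R + 2 * pi * m%:~R * gpt x (b, true).
    have -> : gpt (inc x (b, true)) (b, true) = K%:R^-1 + gpt x (b, true).
      rewrite /gpt /inc upd_id; have -> : minn (x (b, true)).+1 K = (minn (x (b, true)) K).+1.
        by move: xd; lia.
      by rewrite -natr1 mulrDl mul1r addrC.
    by rewrite mulrDr.
  rewrite rotD -Gm// angle_rotr//.
    have c0 : 2 * pi != 0 :> R by rewrite mulf_neq0// lt0r_neq0.
    by rewrite -[X in X / (2 * pi)]mulrA mulrAC divff// mul1r.
  have mK' : `|m%:~R / K%:R| < 4%:R^-1 :> R.
    rewrite normrM normfV normr_nat -intr_norm ltr_pdivrMr ?ltr0n//.
    by rewrite mulrC ltr_pdivlMr// -abszE -pmulrn -natrM ltr_nat mulnC.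
  move: mK'; rewrite ltr_norml => /andP[m1 m2]; apply/andP; split; nra.
case: eqP => [xb|_].
  apply: rotE; first by lia.
  move=> y yx; rewrite (@G_s0 _ b) ?gpt_zero//; first exact: gpt_cube.
  by rewrite /gpt yx xb min0n mul0r.
case: eqP => [xb|_] //.
apply: rotE; first by lia.
move=> y yx; rewrite (@G_s1 _ b) ?gpt_zero//; first exact: gpt_cube.
by rewrite /gpt yx xb minnn divff.
Qed.

(** On a cell where the component stays close to a nonzero value, the edge values are increments of
    one branch of the angle, so both paths around a square give the same sum. *)
Lemma edge_flat x a (e m : R) : (forall d, (x d < K)%N) -> 0 < e -> 16%:R * e <= m ->
  (m <= `|(G (gpt x) a).1|) || (m <= `|(G (gpt x) a).2|) ->
  (forall y, (forall c, x c <= y c <= (x c).+1)%N ->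
    `|(G (gpt y) a).1 - (G (gpt x) a).1| <= e /\
    `|(G (gpt y) a).2 - (G (gpt x) a).2| <= e) ->
  forall y d d', (forall c, x c <= y c <= (x c).+1)%N ->
    d != d' -> y d = x d -> y d' = x d' ->
    corner (edge a) y d d' = corner (edge a) y d' d.
Proof.
move=> xK e0 em mG near y d d' xy dd' yd yd'.
set z := G (gpt x) a in mG near *.
pose m' := if `|z.1| <= `|z.2| then `|z.2| else `|z.1|.
have em' : 16%:R * e <= m'.
  apply: le_trans em _; rewrite /m'.
  case: ifPn => [z12|]; case/orP: mG => // mz; first exact: le_trans z12.
  by rewrite -ltNge => /ltW; exact: le_trans.
have zm : (m' = `|z.1| /\ `|z.2| <= m') \/ (m' = `|z.2| /\ `|z.1| <= m').
  by rewrite /m'; case: ifPn => [?|]; [right|rewrite -ltNge => /ltW; left].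
pose B u := forall c, (x c <= u c <= (x c).+1)%N.
have quad u v : B u -> B v ->
    `|cdet (G (gpt u) a) (G (gpt v) a)| < cdot (G (gpt u) a) (G (gpt v) a).
  move=> /near[u1 u2] /near[v1 v2].
  exact: (near_quadrant e0 em' zm).
have edgeB u c : B u -> u c = x c ->
    edge a u c = angle (G (gpt u) a) (G (gpt (inc u c)) a) / (2 * pi).
  move=> uB uc; apply: edgeE; first by rewrite uc.
  by apply: le_lt_trans (quad u u uB uB); rewrite normr_ge0.
have incB u c : B u -> u c = x c -> B (inc u c).
  move=> uB uc b; rewrite /inc /upd; case: eqP => [->|_]; last exact: uB.
  by rewrite uc leqnSn leqnn.
have d'i : inc y d d' = x d' by rewrite inc_neq 1?eq_sym.
have di : inc y d' d = x d by rewrite inc_neq.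
rewrite /corner !edgeB//; [|exact: incB..].
have iB := incB _ _ xy yd; have i'B := incB _ _ xy yd'.
have iiB := incB _ _ iB d'i; have i'iB := incB _ _ i'B di.
rewrite -!mulrDl (angleD (quad _ _ xy iB) (quad _ _ iB iiB)).
by rewrite (angleD (quad _ _ xy i'B) (quad _ _ i'B i'iB)) [in RHS]incC.
Qed.

End NoExtension.

(* Discrete Stokes: the antisymmetrised product of the L curvatures sums to
   L! (j - i)^L over the grid, whereas near each point some component of G is
   bounded away from 0 and has zero curvature there. *)
Lemma degree_obstruction (R : realType) (L : nat)
    (G : ('I_L * bool -> R) -> 'I_L -> R * R) (i j : int) :
  (forall e, 0 < e -> exists2 dl, 0 < dl & forall z w,
    cube z -> cube w -> (forall d, `|z d - w d| < dl) ->
    forall a, `|(G z a).1 - (G w a).1| <= e /\ `|(G z a).2 - (G w a).2| <= e) ->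
  (exists2 dl, 0 < dl & forall z, cube z ->
    exists a, (dl <= `|(G z a).1|) || (dl <= `|(G z a).2|)) ->
  (forall z b a, cube z -> z (b, false) = 0 ->
    G z a = rot (2 * pi * i%:~R * z (b, true)) (G (collapse z b) a)) ->
  (forall z b a, cube z -> z (b, false) = 1 ->
    G z a = rot (2 * pi * j%:~R * z (b, true)) (G (collapse z b) a)) ->
  (forall z b a, cube z -> z (b, true) = 0 \/ z (b, true) = 1 ->
    G z a = G (collapse z b) a) ->
  i = j.
Proof.
move=> Gu [m m0 Gfar] G0 G1 Gt.
have e0 : 0 < m / 16%:R by rewrite divr_gt0.
have [dl dl0 Gdl] := Gu _ e0.
(* The mesh is finer than the modulus of continuity for the error m / 16 of [near_quadrant], and
   boundary edges turn by less than a quarter turn. *)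
pose K := (Num.truncn dl^-1 + 4 * (`|i| + `|j|)).+1.
have K0 : (0 < K)%N by [].
have Kl : (4 * (`|i| + `|j|) < K)%N by rewrite /K; lia.
have K0' : K%:R != 0 :> R by rewrite pnatr_eq0.
have Kdl : K%:R^-1 < dl.
  rewrite -[dl]invrK ltf_pV2 ?posrE ?invr_gt0 ?ltr0n//.
  have /(lt_le_trans (truncnS_gt _)) : (Num.truncn dl^-1).+1%:R <= K%:R :> R.
    by rewrite ler_nat /K; lia.
  exact.
pose es := [seq edge G i j K a | a <- enum 'I_L].
have ses : size es = L by rewrite size_map size_enum_ord.
have adm : {in es, forall e, admissible K (i%:~R / K%:R : R) (j%:~R / K%:R) e}.
  by move=> _ /mapP[a _ ->]; exact: edge_admissible.
have : pairing K (enum 'I_L) es = 0.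
  rewrite /pairing (gridsum_eq (Psi := fun=> 0 * 0)) ?gridsumZ ?mul0r// => x xK _.
  rewrite ?mul0r; apply: cup_flat.
    exact/uniq_dirs/enum_uniq.
    by rewrite size_dirs ses size_enum_ord.
  have {}xK d : (x d < K)%N by apply: xK; rewrite mem_dirs mem_enum.
  have [a Ga] := Gfar _ (gpt_cube R K0 x).
  exists (edge G i j K a); first by apply: map_f; rewrite mem_enum.
  apply: (edge_flat G0 G1 Gt K0 Kl xK e0 _ Ga); first by rewrite mulrC divfK.
  move=> y xy; apply: Gdl; do ?exact: gpt_cube.
  move=> d; rewrite /gpt -mulrBl normrM normfV normr_nat.
  apply: le_lt_trans Kdl; rewrite ler_pdivrMr ?ltr0n// mulVf//.
  have := xy d; have := xK d; move: (x d) (y d) => p q pK /andP[pq qp].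
  have : (minn q K = p \/ minn q K = p.+1) /\ minn p K = p by lia.
  by move=> [[->|->] ->]; rewrite ?subrr ?normr0// -natr1 addrAC subrr add0r normr1.
rewrite (pairingE K0 _ _ adm) ?enum_uniq ?ses ?size_enum_ord//.
move/eqP; rewrite mulf_eq0 pnatr_eq0 (gtn_eqF (fact_gt0 _)) orbF expf_eq0 => /andP[_].
rewrite mulf_eq0 (negbTE K0') orbF -mulrBl mulf_eq0 invr_eq0 (negbTE K0') orbF.
by rewrite subr_eq0 eqr_int => /eqP.
Qed.

Lemma compact_unif (R : realType) (N : nat) (C : set 'rV[R]_N) (g : 'rV[R]_N -> R) e :
  compact C -> continuous g -> 0 < e ->
  exists2 dl, 0 < dl & forall y w, C y -> `|y - w| < dl -> `|g y - g w| <= e.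
Proof.
move=> /compact_near_coveringP cC cg e0.
have : \forall dl \near 0^'+, C `<=` [set y | forall w, `|y - w| < dl -> `|g y - g w| <= e].
  apply: cC => y Cy.
  have e2 : 0 < e / 2 by rewrite divr_gt0.
  have /cvgrPdist_lt /(_ _ e2) := cg y.
  move=> /nbhs_ballP[r /= r0 yr].
  exists (ball y (r / 2), [set dl | dl < r / 2]) => /=.
    split; first by apply: nbhsx_ballx; rewrite divr_gt0.
    by apply: nbhs_right_lt; rewrite divr_gt0.
  case=> y' dl [/= yy' dlr] w y'w.
  have gy' : `|g y - g y'| < e / 2.
    by apply: yr; apply: le_ball yy'; rewrite ler_pdivrMr// mulrDr mulr1 lerDl ltW.
  have gw : `|g y - g w| < e / 2.
    apply: yr; move: yy'; rewrite -!ball_normE /ball_ /= => yy'.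
    by rewrite (splitr r) -(subrKA y') (le_lt_trans (ler_normD _ _))// ltrD// (lt_trans y'w).
  rewrite -(subrKA (g y)) (le_trans (ler_normD _ _))// (splitr e) lerD// ltW//.
  by rewrite distrC.
move=> H.
have [dl [dl0 /= Hdl]] : exists dl, 0 < dl /\ C `<=` [set y | forall w, `|y - w| < dl -> `|g y - g w| <= e].
  near (0 : R)^'+ => dl; exists dl; split; near: dl => //; exact: nbhs_right_gt.
by exists dl => // y w Cy; exact: Hdl.
Unshelve. all: by end_near. Qed.

Lemma half_far (R : realType) (p q dl : R) :
  `|p - q| < `|p| / 2 -> dl < `|p| / 2 -> dl <= `|q|.
Proof. by move=> pq dlp; have := ler_normD (p - q) q; rewrite subrK; lra. Qed.

(** * The cube map obtained by iterating a homotopy *)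

Section RotationFamily.
Variables (R : realType) (L : nat) (M : topologicalType).
Variables (u : 'I_L -> M -> R * R) (S : R -> M -> M) (H : R -> R -> M -> M).
Variables (i j : int) (p0 : M).
Hypothesis u1_cont : forall a, continuous (fun p => (u a p).1).
Hypothesis u2_cont : forall a, continuous (fun p => (u a p).2).
Hypothesis uS : forall a t p, u a (S t p) = rot (2 * pi * t) (u a p).
Hypothesis u_neq0 : forall p, exists a, (u a p).1 != 0 \/ (u a p).2 != 0.
Hypothesis H_cont : continuous (fun z : R * R * M => H z.1.1 z.1.2 z.2).
Local Notation I01 x := (0 <= x <= 1).
Hypothesis H0 : forall (t : R) p, I01 t -> H 0 t p = S (i%:~R * t) p.
Hypothesis H1 : forall (t : R) p, I01 t -> H 1 t p = S (j%:~R * t) p.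
Hypothesis Ht0 : forall (s : R) p, I01 s -> H s 0 p = p.
Hypothesis Ht1 : forall (s : R) p, I01 s -> H s 1 p = p.
Hypothesis HS : forall (s t r : R) p, I01 s -> I01 t -> H s t (S r p) = S r (H s t p).

Local Notation T := ('I_L * bool)%type.

Definition iterate (l : seq 'I_L) (z : T -> R) : M :=
  foldr (fun b q => H (z (b, false)) (z (b, true)) q) p0 l.

Lemma iterate_cont l :
  continuous (fun y : 'rV[R]_#|{: T}| => iterate l (fun d => y 0 (enum_rank d))).
Proof.
elim: l => [|b l IH] y; first exact: (@cst_continuous _ _ p0).
pose c d := fun y : 'rV[R]_#|{: T}| => y 0 (enum_rank d).
have cc d : c d y' @[y' --> y] --> c d y by exact: coord_continuous.
have pr : (c (b, false) y', c (b, true) y', iterate l (fun d => y' 0 (enum_rank d)))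
    @[y' --> y] -->
    (c (b, false) y, c (b, true) y, iterate l (fun d => y 0 (enum_rank d))).
  exact: (cvg_pair (cvg_pair (cc (b, false)) (cc (b, true))) (IH y)).
exact: (cvg_comp _ _ pr (@H_cont _)).
Qed.

Lemma collapse_eq (z : T -> R) b k : collapse z b (b, k) = 0.
Proof. by rewrite /collapse eqxx. Qed.

Lemma collapse_neq (z : T -> R) b c k : c != b -> collapse z b (c, k) = z (c, k).
Proof. by rewrite /collapse /= => /negbTE ->. Qed.

Lemma iterate_collapse0 l (z : T -> R) b : b \notin l -> iterate l (collapse z b) = iterate l z.
Proof.
elim: l => //= d l IH; rewrite inE negb_or eq_sym => /andP[db bl].
by rewrite IH// !collapse_neq.
Qed.

(** The factor of index b acts as [S r]. The other factors commute with it, so it moves to the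
    front; at the collapsed point that factor is the identity. *)
Lemma iterate_collapse l z b : cube z -> uniq l -> b \in l ->
  forall r, (forall q, H (z (b, false)) (z (b, true)) q = S r q) ->
  iterate l z = S r (iterate l (collapse z b)).
Proof.
have I00 : I01 (0 : R) by rewrite lexx ler01.
move=> cz + + r Hr; elim: l => //= c l IH /andP[cl ul].
have [cb|cb] := eqVneq c b.
  by move=> _; rewrite cb in cl *; rewrite Hr !collapse_eq Ht0// iterate_collapse0.
rewrite inE eq_sym (negbTE cb) /= => bl; rewrite IH// !collapse_neq// HS //; exact: cz.
Qed.

Lemma iterate_collapse1 l z b : cube z -> uniq l -> b \in l ->
  (forall q, H (z (b, false)) (z (b, true)) q = q) ->
  iterate l z = iterate l (collapse z b).
Proof.
have I00 : I01 (0 : R) by rewrite lexx ler01.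
move=> cz + + Hr; elim: l => //= c l IH /andP[cl ul].
have [cb|cb] := eqVneq c b.
  by move=> _; rewrite cb in cl *; rewrite Hr !collapse_eq Ht0// iterate_collapse0.
by rewrite inE eq_sym (negbTE cb) /= => bl; rewrite IH// !collapse_neq.
Qed.

(* If the sphere u : M -> C^L \ 0 is equivariant, the L-fold composition of H
   gives a map from a 2L-cube to C^L \ 0 that is rotated on its boundary. *)
Lemma rotation_classes_eq : i = j.
Proof.
pose N := #|{: T}|.
pose C : set 'rV[R]_N := [set y | forall k, `[0%R, 1%R]%classic (y ord0 k)].
have cC : compact C.
  by apply: (@rV_compact R N (fun=> `[0%R, 1%R]%classic)) => k; exact: segment_compact.
pose F (y : 'rV[R]_N) := iterate (enum 'I_L) (fun d => y 0 (enum_rank d)).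
have cF : continuous F by exact: iterate_cont.
pose G z a := u a (iterate (enum 'I_L) z).
pose V (z : T -> R) : 'rV[R]_N := \row_k z (enum_val k).
have GV z a : G z a = u a (F (V z)).
  rewrite /G /F; congr (u a (iterate _ _)); apply/funext => d.
  by rewrite mxE enum_rankK.
have CV z : cube z -> C (V z).
  by move=> cz k; rewrite /= mxE in_itv /=; apply: cz.
have cg1 a : continuous (fun y => (u a (F y)).1).
  by move=> y; exact: (continuous_comp (cF y) (@u1_cont a (F y))).
have cg2 a : continuous (fun y => (u a (F y)).2).
  by move=> y; exact: (continuous_comp (cF y) (@u2_cont a (F y))).
apply: (@degree_obstruction R L G i j).
- move=> e e0.
  have /choice[f1 f1P] a : exists dl, 0 < dl /\ forall y w, C y -> `|y - w| < dl ->
      `|(u a (F y)).1 - (u a (F w)).1| <= e.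
    by have [dl] := compact_unif cC (cg1 a) e0; exists dl.
  have /choice[f2 f2P] a : exists dl, 0 < dl /\ forall y w, C y -> `|y - w| < dl ->
      `|(u a (F y)).2 - (u a (F w)).2| <= e.
    by have [dl] := compact_unif cC (cg2 a) e0; exists dl.
  pose m := \big[Order.min/1]_a Order.min (f1 a) (f2 a).
  have m0 : 0 < m.
    rewrite /m; elim/big_ind: _ => // [x y x0 y0|a _]; first by rewrite lt_min x0.
    by rewrite lt_min (f1P a).1 (f2P a).1.
  exists m => // z w cz cw zw a; rewrite !GV.
  have mle : m <= Order.min (f1 a) (f2 a) by rewrite /m (bigD1 a)//= ge_min lexx.
  have : `|V z - V w| < m.
    rewrite [ltLHS]/Num.Def.normr/= mx_normrE; apply/bigmax_ltP; split => //= k _.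
    by rewrite !mxE.
  move=> /lt_le_trans /(_ mle); rewrite lt_min => /andP[zw1 zw2].
  by split; [apply: (f1P a).2|apply: (f2P a).2] => //; exact: CV.
- have : \forall dl \near 0^'+, C `<=` [set y | exists a,
     (dl <= `|(u a (F y)).1|) || (dl <= `|(u a (F y)).2|)].
    move/compact_near_coveringP: cC; apply => y Cy.
    have [a ua] := u_neq0 (F y).
    case: ua => ua.
    + have ua' : 0 < `|(u a (F y)).1| / 2 by rewrite divr_gt0 ?normr_gt0.
      have /cvgrPdist_lt /(_ _ ua') := cg1 a y => near_y.
      exists ([set y' | `|(u a (F y)).1 - (u a (F y')).1| < `|(u a (F y)).1| / 2],
              [set dl | dl < `|(u a (F y)).1| / 2]) => /=.
        by split => //; exact: nbhs_right_lt.
      case=> y' dl [/= yy' dlr]; exists a; apply/orP; left.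
      exact: half_far yy' dlr.
    + have ua' : 0 < `|(u a (F y)).2| / 2 by rewrite divr_gt0 ?normr_gt0.
      have /cvgrPdist_lt /(_ _ ua') := cg2 a y => near_y.
      exists ([set y' | `|(u a (F y)).2 - (u a (F y')).2| < `|(u a (F y)).2| / 2],
              [set dl | dl < `|(u a (F y)).2| / 2]) => /=.
        by split => //; exact: nbhs_right_lt.
      case=> y' dl [/= yy' dlr]; exists a; apply/orP; right.
      exact: half_far yy' dlr.
  move=> Hn.
  have [dl [dl0 /= Hdl]] : exists dl, 0 < dl /\ C `<=` [set y | exists a,
     (dl <= `|(u a (F y)).1|) || (dl <= `|(u a (F y)).2|)].
    near (0 : R)^'+ => dl; exists dl; split; near: dl => //; exact: nbhs_right_gt.
  exists dl => // z cz; have [a Ha] := Hdl _ (CV _ cz).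
  by exists a; rewrite GV.
- move=> z b a cz zb; rewrite /G (@iterate_collapse _ _ b _ _ _ (i%:~R * z (b, true))) ?enum_uniq ?mem_enum//.
    by rewrite uS mulrA.
  by move=> q; rewrite zb H0.
- move=> z b a cz zb; rewrite /G (@iterate_collapse _ _ b _ _ _ (j%:~R * z (b, true))) ?enum_uniq ?mem_enum//.
    by rewrite uS mulrA.
  by move=> q; rewrite zb H1.
- move=> z b a cz zb; rewrite /G (@iterate_collapse1 _ _ b) ?enum_uniq ?mem_enum//.
  by move=> q; case: zb => ->; rewrite ?Ht0 ?Ht1.
Unshelve. all: by end_near. Qed.

End RotationFamily.

(** * Smooth functions on open sets *)

Section LinearForm.
Variables (R : realType) (n : nat) (g : 'I_n -> R).

Definition lin_form (v : 'rV[R]_n) : R := \sum_i v 0 i * g i.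

Lemma lin_form_linear : linear lin_form.
Proof.
move=> a u v; rewrite /lin_form scaler_sumr -big_split /=.
by apply: eq_bigr => i _; rewrite !mxE mulrDl [in RHS]scalerAl.
Qed.

HB.instance Definition _ :=
  @GRing.isLinear.Build R 'rV[R]_n R *:%R lin_form lin_form_linear.

Lemma lin_form_continuous : continuous lin_form.
Proof.
move=> v; rewrite /lin_form.
elim: (index_enum _) => [|i r IH].
  by under eq_fun do rewrite big_nil; exact: cst_continuous.
under eq_fun do rewrite big_cons.
have ci : (fun u : 'rV[R]_n => u 0 i) @ v --> v 0 i by exact: coord_continuous.
exact: (cvgD (cvgM ci (cvg_cst (g i))) IH).
Qed.
End LinearForm.

(** * Functions with continuous partial derivatives *)

Section Differentiability.
Variable R : realType.

Lemma is_derive_line (V : normedModType R) (f : V -> R) x v (s : R) :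
  derivable f (x + s *: v) v ->
  is_derive s (1 : R) (fun s => f (x + s *: v)) ('D_v f (x + s *: v)).
Proof.
move=> df; suff E : (fun h : R => h^-1 *: (f (x + (h *: 1 + s) *: v) - f (x + s *: v))) =
    (fun h : R => h^-1 *: (f (h *: v + (x + s *: v)) - f (x + s *: v))).
  by apply: DeriveDef; rewrite /derivable /derive /= E.
apply/funext => h; congr (_ *: (f _ - _)).
by rewrite scaler1 scalerDl addrCA addrA addrC addrA addrAC.
Qed.

Lemma mvt_line (V : normedModType R) (f : V -> R) x v (h : R) :
  (forall t : R, 0 <= t <= 1 -> derivable f (x + (t * h) *: v) v) ->
  exists2 c, 0 <= c <= 1 & f (x + h *: v) - f x = h * 'D_v f (x + (c * h) *: v).
Proof.
move=> df.
pose phi (t : R) := f (x + (t * h) *: v).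
have dphi (t : R) : 0 <= t <= 1 -> is_derive t (1 : R) phi (h * 'D_v f (x + (t * h) *: v)).
  move=> t01; rewrite mulrC.
  apply: (@is_derive1_comp _ (fun s => f (x + s *: v)) (fun t => t * h)).
    exact: is_derive_line (df _ t01).
  have -> : (fun t : R => t * h) = h \*: (id : R -> R).
    by apply/funext => s; rewrite /= mulrC.
  by apply: is_derive_eq; rewrite [LHS]mulr1.
have [||c] := @MVT_segment R phi (fun t => h * 'D_v f (x + (t * h) *: v)) 0 1 ler01.
- by move=> t; rewrite in_itv /= => /andP[/ltW t0 /ltW t1]; apply: dphi; rewrite t0.
- apply: derivable_within_continuous => t; rewrite in_itv /= => t01.
  by have [] := dphi t t01.
by rewrite in_itv /= subr0 mulr1 /phi mul1r mul0r scale0r addr0 => c01 ->; exists c.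
Qed.

Variable n : nat.
Local Notation e_ i := (delta_mx 0 i : 'rV[R]_n).

(** The increment is split into moves along the coordinate axes, and each move is treated by the
    mean value theorem. In the sup norm all intermediate points stay within the norm of h from x. *)
Lemma c1_differential (f : 'rV[R]_n -> R) x :
  (\forall y \near x, forall i, derivable f y (e_ i)) ->
  (forall i, {for x, continuous ('D_(e_ i) f)}) ->
  differentiable f x /\ forall v, 'd f x v = \sum_i v 0 i * 'D_(e_ i) f x.
Proof.
move=> df cf.
pose g i := 'D_(e_ i) f x.
suff E : f \o shift x = cst (f x) + lin_form g +o_ 0 id.
  have D := diff_unique (@lin_form_continuous _ _ g) E.
  split; last by move=> v; rewrite D.
  by apply/diff_locallyP; rewrite D; split => //; exact: lin_form_continuous.
apply/eqaddoP => eps eps0.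
have n0 : 0 < n.+1%:R :> R by [].
(* Dividing by n + 1 covers n = 0. *)
have en0 : 0 < eps / n.+1%:R by rewrite divr_gt0.
have : \forall y \near x, (forall i, derivable f y (e_ i)) /\
     forall i, `|'D_(e_ i) f x - 'D_(e_ i) f y| < eps / n.+1%:R.
  have ci i : \forall y \near x, `|'D_(e_ i) f x - 'D_(e_ i) f y| < eps / n.+1%:R.
    by move/cvgrPdist_lt : (cf i); apply.
  near=> y; split; near: y; first exact: df.
  exact: filter_forall.
move=> /nbhs_ballP[r /= r0 xr].
apply/nbhs_ballP; exists r => //= h; rewrite -ball_normE /ball_ /= sub0r normrN => hr.
pose hk (k : nat) : 'rV[R]_n := \row_i (if (i < k)%N then h 0 i else 0).
have hkS (k : 'I_n) : hk k.+1 = hk k + h 0 k *: e_ k.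
  apply/rowP => i; rewrite !mxE /= ltnS leq_eqVlt.
  case: (eqVneq i k) => [->|ik]; first by rewrite !eqxx ltnn mulr1 add0r.
  by rewrite (_ : (val i == val k) = false) ?mulr0 ?addr0 //; apply/negbTE.
have hkn : hk n = h by apply/rowP => i; rewrite !mxE ltn_ord.
have hk0 : hk 0%N = 0 by apply/rowP => i; rewrite !mxE.
have hi (i : 'I_n) : `|h 0 i| <= `|h|.
  rewrite [leRHS]/Num.Def.normr/= mx_normrE.
  exact: (le_bigmax _ (fun i : 'I_1 * 'I_n => `|h i.1 i.2|) (0, i)).
have inb (k : 'I_n) (t : R) : 0 <= t <= 1 -> ball x r (x + hk k + (t * h 0 k) *: e_ k).
  move=> /andP[t0 t1]; rewrite -ball_normE /ball_ /= -addrA opprD addNKr normrN.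
  apply: le_lt_trans hr.
  rewrite [leLHS]/Num.Def.normr/= mx_normrE; apply/bigmax_leP; split => //= -[a i] _.
  rewrite !mxE /= (ord1 a) eqxx /=.
  case: (eqVneq i k) => [->|ik].
    by rewrite ltnn add0r mulr1 normrM ger0_norm// (le_trans _ (hi k))// ler_piMl.
  by rewrite mulr0 addr0; case: ifP => _ //; rewrite normr0.
have /choice[c cP] (k : 'I_n) : exists c : R, 0 <= c <= 1 /\
    f (x + hk k + h 0 k *: e_ k) - f (x + hk k) =
    h 0 k * 'D_(e_ k) f (x + hk k + (c * h 0 k) *: e_ k).
  have [t /(inb k) /xr[+ _]|c c01 E] := @mvt_line _ f (x + hk k) (e_ k) (h 0 k).
    exact.
  by exists c.
have tele : f (x + h) - f x = \sum_(k < n) (f (x + hk k.+1) - f (x + hk k)).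
  rewrite -(big_mkord xpredT (fun k => f (x + hk k.+1) - f (x + hk k))).
  by rewrite (telescope_sumr (fun k => f (x + hk k)))// hkn hk0 addr0.
rewrite /= !fctE /= [h + x]addrC opprD addrA tele /lin_form -sumrB.
apply: le_trans (ler_norm_sum _ _ _) _.
have: \sum_(k < n) (eps / n.+1%:R * `|h|) <= eps * `|h|.
  rewrite sumr_const card_ord -[leLHS]mulr_natl mulrA ler_wpM2r// mulrCA ler_piMr ?ltW//.
  by rewrite ltr_pdivrMr// mul1r ltr_nat.
apply: le_trans; apply: ler_sum => k _.
have [c01 E] := cP k; rewrite hkS addrA E -mulrBr normrM mulrC.
apply: ler_pM => //; rewrite distrC ltW//.
by have [_] := xr _ (inb k _ c01); apply.
Unshelve. all: by end_near. Qed.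

(** As [G] is only derivable in the direction v, it is restricted to the line through x in this
    direction, where derivability amounts to differentiability. *)
Lemma chain_rule (V : normedModType R) (f : 'rV[R]_n -> R) (G : V -> 'rV[R]_n) x v :
  (\forall y \near G x, forall i, derivable f y (e_ i)) ->
  (forall i, {for G x, continuous ('D_(e_ i) f)}) ->
  (forall i, derivable (fun y => G y 0 i) x v) ->
  is_derive x v (f \o G)
    (\sum_i 'D_v (fun y => G y 0 i) x * 'D_(e_ i) f (G x)).
Proof.
move=> df cf dG; have [Df dE] := c1_differential df cf.
have dGx : derivable G x v by apply/derivable_mxP => a i; rewrite (ord1 a).
pose gam (h : R) := G (h *: v + x).
have gam0 : gam 0 = G x by rewrite /gam scale0r add0r.
have dg1 : derivable gam 0 1 := (derivable1P G x v).1 dGx.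
have dgam : differentiable gam 0 := (derivable1_diffP gam 0).1 dg1.
have Df' : differentiable f (gam 0) by rewrite gam0.
have dcomp : differentiable (f \o gam) 0 := differentiable_comp dgam Df'.
apply: DeriveDef.
  exact: ((derivable1P (f \o G) x v).2 ((derivable1_diffP (f \o gam) 0).2 dcomp)).
have gamE (W : normedModType R) (g : 'rV[R]_n -> W) :
    (fun h : R => h^-1 *: ((g \o G) (h *: v + x) - (g \o G) x)) =
    (fun h : R => h^-1 *: ((g \o gam) (h *: 1 + 0) - (g \o gam) 0)).
  by apply/funext => h; rewrite /= gam0 /gam scaler1 addr0.
have -> : 'D_v (f \o G) x = 'D_1 (f \o gam) 0 by rewrite /derive gamE.
have -> : 'D_1 (f \o gam) 0 = 'd f (G x) ('d gam 0 1).
  by rewrite (deriveE (1 : R) dcomp) (diff_comp dgam Df') -gam0.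
rewrite dE -(deriveE (1 : R) dgam).
have -> : 'D_1 gam 0 = 'D_v G x by rewrite /derive (gamE _ id).
by apply: eq_bigr => i _; rewrite (derive_mx dGx) mxE.
Qed.

End Differentiability.

(** * Calculus of smooth functions *)

Section SmoothOn.
Variables (R : realType) (n : nat).
Local Notation V := 'rV[R]_n.
Local Notation e_ i := (delta_mx 0 i : V).
Implicit Types (U W : set V) (f g : V -> R) (s : seq 'I_n).

Lemma partial_cat s s' f : partial (s ++ s') f = partial s (partial s' f).
Proof. by elim: s => //= i s ->. Qed.

Lemma open_near U x : open U -> U x -> \forall y \near x, U y.
Proof. by move=> oU Ux; exact: open_nbhs_nbhs. Qed.

Lemma near_continuous (T S : topologicalType) (f g : T -> S) (x : T) :
  {near x, f =1 g} -> {for x, continuous f} -> {for x, continuous g}.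
Proof.
move=> fg cf; rewrite /prop_for /continuous_at -(nbhs_singleton fg).
exact: cvg_trans (near_eq_cvg fg) cf.
Qed.

Lemma partial_eq s U f g : open U -> (forall x, U x -> f x = g x) ->
  forall x, U x -> partial s f x = partial s g x.
Proof.
move=> oU fg; elim: s => [|i s IH] x Ux /=; first exact: fg.
apply: near_eq_derive; apply: filterS (open_near oU Ux) => y; exact: IH.
Qed.

Lemma smooth_on_eq U f g : open U -> (forall x, U x -> f x = g x) ->
  smooth_on U f -> smooth_on U g.
Proof.
move=> oU fg sf s x Ux; have [cf df] := sf s x Ux.
have nfg : {near x, partial s f =1 partial s g}.
  apply: filterS (open_near oU Ux) => y; exact: partial_eq.
split; first exact: near_continuous nfg cf.
by move=> i; exact: near_eq_derivable (df i).
Qed.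

Lemma smooth_on_sub U W f : W `<=` U -> smooth_on U f -> smooth_on W f.
Proof. by move=> WU sf s x /WU; exact: sf. Qed.

Lemma smooth_on_partial U f s : smooth_on U f -> smooth_on U (partial s f).
Proof. by move=> sf s' x Ux; rewrite -partial_cat; exact: sf. Qed.

Lemma smooth_on_D U f i : smooth_on U f -> smooth_on U ('D_(e_ i) f).
Proof. exact: (@smooth_on_partial _ _ [:: i]). Qed.

Lemma smooth_on_cont U f x : smooth_on U f -> U x -> {for x, continuous f}.
Proof. by move=> sf Ux; have [] := sf [::] x Ux. Qed.

Lemma smooth_on_derivable U f x i : smooth_on U f -> U x -> derivable f x (e_ i).
Proof. by move=> sf Ux; have [_] := sf [::] x Ux; exact. Qed.

Arguments smooth_on_derivable {U f x} i _ _.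
Arguments smooth_on_D {U f} i _.

(** Coinduction: a class that contains the partial derivatives of its members, up to equality on
    [U], consists of smooth functions. The induction removes the innermost derivative, which stays
    inside the class. *)
Lemma smooth_coind (P : (V -> R) -> Prop) U : open U ->
  (forall f, P f ->
     (forall x, U x -> {for x, continuous f} /\ forall i, derivable f x (e_ i)) /\
     forall i, exists2 g, P g & forall x, U x -> 'D_(e_ i) f x = g x) ->
  forall f, P f -> smooth_on U f.
Proof.
move=> oU HP f Pf s; elim/last_ind: s f Pf => [|s i IH] f Pf x Ux.
  exact: (HP _ Pf).1.
have [_ /(_ i)[g Pg fg]] := HP _ Pf.
have [cg dg] := IH g Pg x Ux.
have nfg : {near x, partial s g =1 partial (rcons s i) f}.
  apply: filterS (open_near oU Ux) => y Uy.
  by rewrite -cats1 partial_cat; apply: (partial_eq s oU) => // z Uz; rewrite /= fg.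
split; first exact: near_continuous nfg cg.
by move=> j; exact: near_eq_derivable (dg j).
Qed.

(** The algebra generated by [B]. Derivatives of products, inverses and composites leave [B] but not
    this algebra, so that stability under derivation is checked on generators only. *)
Inductive gen (B : (V -> R) -> Prop) : (V -> R) -> Prop :=
| gen_base f : B f -> gen B f
| gen_add f g : gen B f -> gen B g -> gen B (fun x => f x + g x)
| gen_mul f g : gen B f -> gen B g -> gen B (fun x => f x * g x)
| gen_cst c : gen B (fun=> c).

Lemma gen_sum B (I : Type) (r : seq I) (F : I -> V -> R) :
  (forall i, gen B (F i)) -> gen B (fun x => \sum_(i <- r) F i x).
Proof.
move=> gF; elim: r => [|i r IH].
  by under eq_fun do rewrite big_nil; exact: gen_cst.
by under eq_fun do rewrite big_cons; exact: gen_add.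
Qed.

Lemma gen_smooth B U : open U ->
  (forall f, B f ->
     (forall x, U x -> {for x, continuous f} /\ forall i, derivable f x (e_ i)) /\
     forall i, exists2 g, gen B g & forall x, U x -> 'D_(e_ i) f x = g x) ->
  forall f, gen B f -> smooth_on U f.
Proof.
move=> oU HB; apply: smooth_coind => //.
move=> f; elim=> {f}.
- by move=> f /HB.
- move=> f g gf [cf df] gg [cg dg]; split.
    move=> x Ux; have [cfx dfx] := cf x Ux; have [cgx dgx] := cg x Ux.
    split; first exact: cvgD cfx cgx.
    by move=> i; exact: derivableD.
  move=> i; have [f' gf' ff'] := df i; have [g' gg' gg''] := dg i.
  exists (fun x => f' x + g' x); first exact: gen_add.
  move=> x Ux; rewrite -ff'// -gg''// -deriveD//.
  - exact: (cf x Ux).2.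
  - exact: (cg x Ux).2.
- move=> f g gf [cf df] gg [cg dg]; split.
    move=> x Ux; have [cfx dfx] := cf x Ux; have [cgx dgx] := cg x Ux.
    split; first exact: cvgM cfx cgx.
    by move=> i; exact: derivableM.
  move=> i; have [f' gf' ff'] := df i; have [g' gg' gg''] := dg i.
  exists (fun x => f x * g' x + g x * f' x); first by apply: gen_add; exact: gen_mul.
  move=> x Ux; rewrite -ff'// -gg''//; apply: deriveM.
  - exact: (cf x Ux).2.
  - exact: (cg x Ux).2.
- move=> c; split=> [x Ux|i]; first by split => [|i]; [exact: cst_continuous|exact: derivable_cst].
  by exists (fun=> 0); [exact: gen_cst|move=> x _; exact: derive_cst].
Qed.

Lemma gen_smooth_id U : open U -> forall f, gen (smooth_on U) f -> smooth_on U f.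
Proof.
move=> oU; apply: gen_smooth => // f sf; split.
  by move=> x Ux; exact: (sf [::] x Ux).
move=> i; exists ('D_(e_ i) f) => //; apply: gen_base; exact: smooth_on_D.
Qed.

Section Algebra.
Variable U : set V.
Hypothesis oU : open U.

Lemma smooth_on_cst c : smooth_on U (fun=> c).
Proof. by apply: gen_smooth_id => //; exact: gen_cst. Qed.

Lemma smooth_onD f g : smooth_on U f -> smooth_on U g -> smooth_on U (fun x => f x + g x).
Proof. by move=> sf sg; apply: gen_smooth_id => //; apply: gen_add; exact: gen_base. Qed.

Lemma smooth_onM f g : smooth_on U f -> smooth_on U g -> smooth_on U (fun x => f x * g x).
Proof. by move=> sf sg; apply: gen_smooth_id => //; apply: gen_mul; exact: gen_base. Qed.

Lemma smooth_on_sum (I : Type) (r : seq I) (F : I -> V -> R) :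
  (forall i, smooth_on U (F i)) -> smooth_on U (fun x => \sum_(i <- r) F i x).
Proof. by move=> sF; apply: gen_smooth_id => //; apply: gen_sum => i; exact: gen_base. Qed.

Lemma smooth_onN f : smooth_on U f -> smooth_on U (fun x => - f x).
Proof.
move=> sf; have -> : (fun x => - f x) = (fun x => -1 * f x).
  by apply/funext => x; rewrite mulN1r.
exact: smooth_onM (smooth_on_cst _) sf.
Qed.

Lemma smooth_onB f g : smooth_on U f -> smooth_on U g -> smooth_on U (fun x => f x - g x).
Proof. by move=> sf sg; exact: smooth_onD sf (smooth_onN sg). Qed.

Lemma smooth_on_inv f : smooth_on U f -> (forall x, U x -> f x != 0) ->
  smooth_on U (fun x => (f x)^-1).
Proof.
move=> sf f0.
pose B h := smooth_on U h \/ h = (fun x => (f x)^-1).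
apply: (@gen_smooth B) => //; last by apply: gen_base; right.
move=> h [sh|->].
  split; first by move=> x Ux; exact: (sh [::] x Ux).
  move=> i; exists ('D_(e_ i) h) => //; apply: gen_base; left; exact: smooth_on_D.
split=> [x Ux|i].
  have [cf df] := sf [::] x Ux; split; first exact: cvgV (f0 _ Ux) cf.
  by move=> i; apply: derivableV; [exact: f0|exact: df].
exists (fun x => -1 * ((f x)^-1 * (f x)^-1) * 'D_(e_ i) f x).
  apply: gen_mul; last by apply: gen_base; left; exact: smooth_on_D.
  apply: gen_mul; first exact: gen_cst.
  by apply: gen_mul; apply: gen_base; right.
move=> x Ux; rewrite deriveV ?f0//; last exact: smooth_on_derivable sf Ux.
by rewrite -expr2 exprVn mulN1r.
Qed.

(** The successive derivatives of the outer function are supplied as a sequence [phi], which suits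
    the explicit families of the exponential cutoffs. *)
Lemma smooth_on_comp1 (D : set R) (phi : nat -> R -> R) f :
  (forall k y, D y -> is_derive y (1 : R) (phi k) (phi k.+1 y)) ->
  smooth_on U f -> (forall x, U x -> D (f x)) -> smooth_on U (phi 0%N \o f).
Proof.
move=> dphi sf Df.
pose B h := smooth_on U h \/ exists k, h = phi k \o f.
apply: (@gen_smooth B) => //; last by apply: gen_base; right; exists 0%N.
move=> h [sh|[k ->]].
  split; first by move=> x Ux; exact: (sh [::] x Ux).
  move=> i; exists ('D_(e_ i) h) => //; apply: gen_base; left; exact: smooth_on_D.
have D1 x i : U x -> is_derive x (e_ i) (phi k \o f) (phi k.+1 (f x) * 'D_(e_ i) f x).
  move=> Ux; have df := smooth_on_derivable i sf Ux.
  have dp := dphi k _ (Df _ Ux).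
  have L := @is_derive_line R _ f x (e_ i) 0.
  rewrite scale0r addr0 in L; have {}L := L df.
  have fx0 : f (x + 0 *: e_ i) = f x by rewrite scale0r addr0.
  have := @is_derive1_comp R (phi k) (fun t : R => f (x + t *: e_ i)) 0 _ _ _ L.
  rewrite fx0 => /(_ _ dp) [dd vv].
  have E : (fun h : R => h^-1 *: ((phi k \o (fun t : R => f (x + t *: e_ i))) (h *: 1 + 0) -
         (phi k \o (fun t : R => f (x + t *: e_ i))) 0)) =
       (fun h : R => h^-1 *: ((phi k \o f) (h *: e_ i + x) - (phi k \o f) x)).
    by apply/funext => h0; rewrite /= scaler1 !addr0 scale0r addr0 [x + _]addrC.
  by apply: DeriveDef; [move: dd|move: vv]; rewrite /derivable /derive E.
split=> [x Ux|i].
  split; last by move=> i; have [] := D1 x i Ux.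
  apply: continuous_comp; first exact: smooth_on_cont sf Ux.
  have [dk _] := dphi k _ (Df _ Ux).
  exact/differentiable_continuous/derivable1_diffP.
exists (fun x => phi k.+1 (f x) * 'D_(e_ i) f x).
  apply: gen_mul; first by apply: gen_base; right; exists k.+1.
  by apply: gen_base; left; exact: smooth_on_D.
by move=> x Ux; have [_ ->] := D1 x i Ux.
Qed.

End Algebra.

Lemma smooth_on_c1 U f x : open U -> smooth_on U f -> U x ->
  (\forall y \near x, forall i, derivable f y (e_ i)) /\
  (forall i, {for x, continuous ('D_(e_ i) f)}).
Proof.
move=> oU sf Ux; split=> [|i].
  apply: filterS (open_near oU Ux) => y Uy i; exact: smooth_on_derivable sf Uy.
exact: smooth_on_cont (smooth_on_D i sf) Ux.
Qed.

Lemma derive_coord (j i : 'I_n) x : is_derive x (e_ i) (fun y : V => y 0 j) (i == j)%:R.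
Proof.
have E : (fun h : R => h^-1 *: ((h *: e_ i + x) 0 j - x 0 j)) @ 0^' --> ((i == j)%:R : R).
  apply: (@cvg_trans _ (cst ((i == j)%:R : R) @ 0^')); last exact: cvg_cst.
  apply: near_eq_cvg; near=> h.
  rewrite !mxE eqxx addrK /= eq_sym scalerA mulVf ?scale1r//.
  by near: h; exact: nbhs_dnbhs_neq.
by apply: DeriveDef; [apply/cvg_ex; exists ((i == j)%:R : R)|exact: cvg_lim E].
Unshelve. all: by end_near. Qed.

Lemma smooth_on_coord U (j : 'I_n) : open U -> smooth_on U (fun y : V => y 0 j).
Proof.
move=> oU; pose B h := h = (fun y : V => y 0 j).
apply: (@gen_smooth B) => //; last by apply: gen_base.
move=> _ ->; split=> [x Ux|i].
  by split=> [|i]; [exact: coord_continuous|have [] := derive_coord j i x].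
exists (fun=> (i == j)%:R); first exact: gen_cst.
by move=> x _; have [_ ->] := derive_coord j i x.
Qed.

Lemma continuous_rV (T : topologicalType) m (G : T -> 'rV[R]_m) x :
  (forall j, {for x, continuous (fun y => G y 0 j)}) -> {for x, continuous G}.
Proof.
move=> cG; apply/cvg_ballP => e e0.
have ce j : \forall y \near x, ball (G x 0 j) e (G y 0 j).
  by move/cvg_ballP : (cG j); apply.
near=> y; suff : 0 < e /\ forall a j, ball (G x a j) e (G y a j) by [].
split=> // a j; rewrite (ord1 a); move: j; near: y; exact: filter_forall.
Unshelve. all: by end_near. Qed.

(* By the double mean value theorem. *)
Lemma schwarz U f x i j : open U -> smooth_on U f -> U x ->
  'D_(e_ i) ('D_(e_ j) f) x = 'D_(e_ j) ('D_(e_ i) f) x.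
Proof.
move=> oU sf Ux.
have [A eA] : {A | A = 'D_(e_ i) ('D_(e_ j) f)} := exist _ _ erefl.
have [B eB] : {B | B = 'D_(e_ j) ('D_(e_ i) f)} := exist _ _ erefl.
have cA : {for x, continuous A}.
  by rewrite eA; exact: smooth_on_cont (smooth_on_D i (smooth_on_D j sf)) Ux.
have cB : {for x, continuous B}.
  by rewrite eB; exact: smooth_on_cont (smooth_on_D j (smooth_on_D i sf)) Ux.
suff: A x = B x by rewrite eA eB.
apply/eqP; rewrite -subr_eq0 -normr_le0; apply/ler_addgt0Pl => e e0; rewrite addr0.
have e2 : 0 < e / 2 by rewrite divr_gt0.
have nA : \forall y \near x, `|A x - A y| < e / 2.
  by move/cvgrPdist_lt : cA; apply.
have nB : \forall y \near x, `|B x - B y| < e / 2.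
  by move/cvgrPdist_lt : cB; apply.
have : \forall y \near x, (U y /\ `|A x - A y| < e / 2) /\ `|B x - B y| < e / 2.
  by apply: filterI nB; apply: filterI nA; exact: open_near oU Ux.
move=> /nbhs_ballP[r /= r0 xr].
(* Points x + a e_k + b e_l with a, b in [0, h] are within 2 h < r of x. *)
pose h := r / 3%:R.
have h0 : 0 < h by rewrite divr_gt0.
have inb (a b : R) k l : 0 <= a <= h -> 0 <= b <= h ->
    ball x r (x + a *: e_ k + b *: e_ l).
  move=> /andP[a0 ah] /andP[b0 bh]; rewrite -ball_normE /ball_ /= -addrA opprD addNKr normrN.
  have ne (c : R) (m : 'I_n) : 0 <= c <= h -> `|c *: e_ m| <= h.
    move=> /andP[c0 ch]; rewrite [leLHS]/Num.Def.normr/= mx_normrE.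
    apply/bigmax_leP; split; [exact: ltW|case=> o l' _].
    rewrite !mxE /=; case: (_ && _); rewrite ?mulr1 ?mulr0 ?normr0; last exact: ltW.
    by rewrite ger0_norm.
  apply: le_lt_trans (ler_normD _ _) _.
  apply: (@le_lt_trans _ _ (h + h)); first by rewrite lerD// ne// ?a0 ?b0.
  by rewrite /h; lra.
have inU (a b : R) k l : 0 <= a <= h -> 0 <= b <= h -> U (x + a *: e_ k + b *: e_ l).
  by move=> ha hb; have [[]] := xr _ (inb a b k l ha hb).
have c01 (c : R) : 0 <= c <= 1 -> 0 <= c * h <= h.
  by move=> /andP[c0 c1]; rewrite mulr_ge0 ?(ltW h0)//= ler_piMl// ltW.
have hh : 0 <= h <= h by rewrite lexx ltW.
have h00 : (0 : R) <= 0 <= h by rewrite lexx ltW.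
have dbl k l : exists a b : R, [/\ 0 <= a <= h, 0 <= b <= h &
    f (x + h *: e_ k + h *: e_ l) - f (x + h *: e_ k) - (f (x + h *: e_ l) - f x) =
    h * (h * 'D_(e_ l) ('D_(e_ k) f) (x + a *: e_ k + b *: e_ l))].
  pose phi y := f (y + h *: e_ l) - f y.
  have dphi y : U y -> U (y + h *: e_ l) ->
      is_derive y (e_ k) phi ('D_(e_ k) f (y + h *: e_ l) - 'D_(e_ k) f y).
    move=> Uy Uyh; have dy := smooth_on_derivable k sf Uy.
    have dyh := smooth_on_derivable k sf Uyh.
    apply: is_deriveB; last exact: derivableP.
    have E : (fun t : R => t^-1 *: (f (t *: e_ k + y + h *: e_ l) - f (y + h *: e_ l))) =
        (fun t : R => t^-1 *: (f (t *: e_ k + (y + h *: e_ l)) - f (y + h *: e_ l))).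
      by apply/funext => t; rewrite addrA.
    by apply: DeriveDef; rewrite /derivable /derive /= E.
  have Uc (c b : R) : 0 <= c <= 1 -> 0 <= b <= h -> U (x + (c * h) *: e_ k + b *: e_ l).
    by move=> hc hb; apply: inU => //; exact: c01.
  have Uc0 (c : R) : 0 <= c <= 1 -> U (x + (c * h) *: e_ k).
    by move=> hc; have := Uc c 0 hc h00; rewrite scale0r addr0.
  have [t ht|c hc E1] := @mvt_line R _ phi x (e_ k) h.
    by have [] := dphi _ (Uc0 t ht) (Uc t h ht hh).
  have [_ D1] := dphi _ (Uc0 c hc) (Uc c h hc hh).
  have [t ht|c' hc' E2] := @mvt_line R _ ('D_(e_ k) f) (x + (c * h) *: e_ k) (e_ l) h.
    exact: smooth_on_derivable (smooth_on_D k sf) (Uc c _ hc (c01 _ ht)).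
  exists (c * h), (c' * h); split; [exact: c01..|].
  rewrite -E2 -D1 -E1 /phi; congr (f _ - _ - _).
have [a [b [ha hb Eij]]] := dbl i j.
have [a' [b' [ha' hb' Eji]]] := dbl j i.
have EAB : B (x + a *: e_ i + b *: e_ j) = A (x + a' *: e_ j + b' *: e_ i).
  apply: (mulfI (lt0r_neq0 h0)); apply: (mulfI (lt0r_neq0 h0)).
  rewrite eA eB; apply: etrans (esym Eij) _; apply: etrans _ Eji.
  by rewrite [x + h *: e_ j + _]addrAC !opprB !addrA; lra.
have [[_ _] HB] := xr _ (inb a b i j ha hb).
have [[_ HA] _] := xr _ (inb a' b' j i ha' hb').
rewrite (splitr e) -(subrKA (A (x + a' *: e_ j + b' *: e_ i))).
rewrite (le_trans (ler_normD _ _))// lerD ?ltW//.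
by rewrite -EAB distrC.
Unshelve. all: by end_near. Qed.

End SmoothOn.

Arguments smooth_on_derivable {R n U f x} i _ _.
Arguments smooth_on_D {R n U f} i _.

Section Composition.
Variables (R : realType) (n m : nat).

Lemma smooth_on_comp (U : set 'rV[R]_n) (W : set 'rV[R]_m) (f : 'rV[R]_m -> R)
    (G : 'rV[R]_n -> 'rV[R]_m) : open U -> open W -> smooth_on W f ->
  (forall j, smooth_on U (fun x => G x 0 j)) -> (forall x, U x -> W (G x)) ->
  smooth_on U (f \o G).
Proof.
move=> oU oW sf sG UW.
pose B h := smooth_on U h \/ exists2 P, smooth_on W P & h = P \o G.
apply: (@gen_smooth _ _ B) => //; last by apply: gen_base; right; exists f.
move=> h [sh|[P sP ->]].
  split; first by move=> x Ux; exact: (sh [::] x Ux).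
  move=> i; exists ('D_(delta_mx 0 i) h) => //; apply: gen_base; left; exact: smooth_on_D.
have D1 x i : U x -> is_derive x (delta_mx 0 i) (P \o G)
    (\sum_j 'D_(delta_mx 0 i) (fun y => G y 0 j) x * 'D_(delta_mx 0 j) P (G x)).
  move=> Ux; have [dP cP] := smooth_on_c1 oW sP (UW _ Ux).
  exact: (chain_rule dP cP (fun j => smooth_on_derivable i (sG j) Ux)).
split=> [x Ux|i].
  split; last by move=> i; have [] := D1 x i Ux.
  apply: continuous_comp; last exact: smooth_on_cont sP (UW _ Ux).
  by apply: continuous_rV => j; exact: smooth_on_cont (sG j) Ux.
exists (fun x => \sum_j 'D_(delta_mx 0 i) (fun y => G y 0 j) x * 'D_(delta_mx 0 j) P (G x)).
  apply: gen_sum => j; apply: gen_mul; apply: gen_base.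
    by left; exact: smooth_on_D.
  exact: (or_intror (ex_intro2 _ _ _ (smooth_on_D j sP) erefl)).
by move=> x Ux; have [_ ->] := D1 x i Ux.
Qed.

End Composition.

(** * Integrals over the unit interval *)

Section UnitIntegral.
Variable R : realType.
Implicit Types f g : R -> R.

Definition int01 f : R := (\int[@lebesgue_measure R]_(t in `[0%R, 1%R]) f t)%R.

Definition cont01 f := forall t : R, 0 <= t <= 1 -> {for t, continuous f}.

Lemma cont01_within f : cont01 f -> {within `[0, 1], continuous f}.
Proof.
move=> cf; apply: continuous_in_subspaceT => t.
by rewrite inE /= in_itv /=; exact: cf.
Qed.

Lemma cont01_integrable f : cont01 f ->
  (@lebesgue_measure R).-integrable `[0, 1] (EFin \o f).
Proof.
move=> cf; apply: continuous_compact_integrable; first exact: segment_compact.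
exact: cont01_within.
Qed.

Lemma int01B f g : cont01 f -> cont01 g ->
  int01 (fun t => f t - g t) = int01 f - int01 g.
Proof.
by move=> cf cg; rewrite /int01 RintegralB//; exact: cont01_integrable.
Qed.

Lemma int01Z c f : cont01 f -> int01 (fun t => c * f t) = c * int01 f.
Proof. by move=> cf; rewrite /int01 RintegralZl//; exact: cont01_integrable. Qed.

Lemma int01_cst (c : R) : int01 (fun=> c) = c.
Proof.
rewrite /int01 Rintegral_cst// [X in fine X](_ : _ = 1%:E) /= ?mulr1//.
have := @lebesgue_measure_itv R `[0%R, 1%R].
by rewrite /= lte_fin ltr01 -EFinB subr0.
Qed.

Lemma int01_eq f g : (forall t : R, 0 <= t <= 1 -> f t = g t) -> int01 f = int01 g.
Proof.
by move=> fg; apply: eq_Rintegral => t; rewrite inE /= in_itv; exact: fg.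
Qed.

Lemma int01_le f g : cont01 f -> cont01 g ->
  (forall t : R, 0 <= t <= 1 -> f t <= g t) -> int01 f <= int01 g.
Proof.
move=> cf cg fg; apply: le_Rintegral => //; try exact: cont01_integrable.
Qed.

Lemma cont01_cst (c : R) : cont01 (fun=> c).
Proof. by move=> t _; exact: cst_continuous. Qed.

Lemma cont01B f g : cont01 f -> cont01 g -> cont01 (fun t => f t - g t).
Proof. by move=> cf cg t t01; exact: (cvgB (cf t t01) (cg t t01)). Qed.

Lemma cont01M f g : cont01 f -> cont01 g -> cont01 (fun t => f t * g t).
Proof. by move=> cf cg t t01; exact: (cvgM (cf t t01) (cg t t01)). Qed.

Lemma int01_close f g (e : R) : cont01 f -> cont01 g ->
  (forall t : R, 0 <= t <= 1 -> `|f t - g t| <= e) -> `|int01 f - int01 g| <= e.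
Proof.
move=> cf cg fg; rewrite -int01B// ler_norml.
rewrite -[X in X <= _ <= _]int01_cst -[X in _ <= _ <= X]int01_cst.
apply/andP; split; (apply: int01_le; [exact: cont01_cst || exact: cont01B
  |exact: cont01_cst || exact: cont01B|]) => t /fg.
- by rewrite ler_norml => /andP[].
- by rewrite ler_norml => /andP[].
Qed.

Lemma int01_ftc F f : cont01 f ->
  (forall t : R, 0 <= t <= 1 -> is_derive t (1 : R) F (f t)) ->
  int01 f = F 1 - F 0.
Proof.
move=> cf dF.
have cF t : 0 <= t <= 1 -> {for t, continuous F}.
  by move=> /dF [dt _]; exact/differentiable_continuous/derivable1_diffP.
have {}cf := cont01_within cf.
rewrite /int01 /Rintegral (@continuous_FTC2 _ f F 0 1 ltr01 cf) //.
- split.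
  + move=> t; rewrite in_itv /= => /andP[/ltW t0 /ltW t1].
    by have [] : is_derive t (1 : R) F (f t) by apply: dF; rewrite t0.
  + by apply: cvg_at_right_filter; apply: cF; rewrite lexx ler01.
  + by apply: cvg_at_left_filter; apply: cF; rewrite lexx ler01.
- move=> t; rewrite in_itv /= => /andP[/ltW t0 /ltW t1].
  have [_ <-] : is_derive t (1 : R) F (f t) by apply: dF; rewrite t0.
  by rewrite derive1E.
Qed.

End UnitIntegral.

(** * Time as an extra coordinate, and parameter integrals *)

Section TimeSpace.
Variables (R : realType) (n : nat).
Local Notation V := 'rV[R]_n.
Local Notation V1 := 'rV[R]_(1 + n).

Definition tx (t : R) (x : V) : V1 := row_mx (const_mx t) x.

Lemma tx_l t x : lsubmx (tx t x) 0 0 = t.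
Proof. by rewrite row_mxKl mxE. Qed.

Lemma tx_r t x : rsubmx (tx t x) = x.
Proof. by rewrite row_mxKr. Qed.

Lemma tx_id (z : V1) : tx (lsubmx z 0 0) (rsubmx z) = z.
Proof.
rewrite -[RHS]hsubmxK; congr row_mx; apply/rowP => i.
by rewrite (ord1 i) [LHS]mxE.
Qed.

Lemma tx_lshift t x (i : 'I_1) : tx t x 0 (lshift n i) = t.
Proof. by rewrite row_mxEl mxE. Qed.

Lemma tx_rshift t x i : tx t x 0 (rshift 1 i) = x 0 i.
Proof. by rewrite row_mxEr. Qed.

Definition e0 : V1 := delta_mx 0 (lshift n 0).
Definition e1 i : V1 := delta_mx 0 (rshift 1 i).

Lemma txDr t x y (h : R) i : y = h *: delta_mx 0 i + x -> tx t y = h *: e1 i + tx t x.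
Proof.
move=> ->; apply/rowP => j; rewrite /tx /e1 !mxE.
case: splitP => k jk; rewrite ?mxE eqxx /=.
  rewrite (_ : (j == rshift 1 i) = false) ?mulr0 ?add0r//.
  by apply/negbTE/eqP => ji; move: jk; rewrite ji /= (ord1 k).
congr (_ * _%:R + _); congr (nat_of_bool _).
by rewrite -!val_eqE /= jk eqn_add2l.
Qed.

Lemma txDl t s x (h : R) : s = h + t -> tx s x = h *: e0 + tx t x.
Proof.
move=> ->; apply/rowP => j; rewrite /tx /e0 !mxE.
case: splitP => k jk; rewrite ?mxE eqxx /=.
  by rewrite (_ : (j == lshift n 0)) ?mulr1//; rewrite -val_eqE /= jk (ord1 k).
by rewrite (_ : (j == lshift n 0) = false) ?mulr0 ?add0r// -val_eqE /= jk.
Qed.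

Lemma tx_cvg (t : R) (x : V) : tx z.1 z.2 @[z --> (t, x)] --> tx t x.
Proof.
apply: (@continuous_rV _ _ _ (fun z : R * V => tx z.1 z.2) (t, x)) => j.
case: (splitP j) => k jk.
  have -> : j = lshift n k by apply/val_inj.
  have -> : (fun z : R * V => tx z.1 z.2 0 (lshift n k)) = fst.
    by apply/funext => z; rewrite tx_lshift.
  exact: cvg_fst.
have -> : j = rshift 1 k by apply/val_inj.
have -> : (fun z : R * V => tx z.1 z.2 0 (rshift 1 k)) = (fun y : V => y 0 k) \o snd.
  by apply/funext => z /=; rewrite tx_rshift.
apply: continuous_comp; [exact: cvg_snd|exact: coord_continuous].
Qed.

Lemma smooth_on_tx_r (U : set V1) j : open U -> smooth_on U (fun z => rsubmx z 0 j).
Proof.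
move=> oU; have -> : (fun z : V1 => rsubmx z 0 j) = fun z : V1 => z 0 (rshift 1 j).
  by apply/funext => z; rewrite mxE.
exact: smooth_on_coord.
Qed.

Lemma smooth_on_tx_l (U : set V1) : open U -> smooth_on U (fun z => lsubmx z 0 0).
Proof.
move=> oU; have -> : (fun z : V1 => lsubmx z 0 0) = fun z : V1 => z 0 (lshift n 0).
  by apply/funext => z; rewrite mxE.
exact: smooth_on_coord.
Qed.

Lemma is_derive_tx_r (P : V1 -> R) t x i : derivable P (tx t x) (e1 i) ->
  is_derive x (delta_mx 0 i : V) (fun x => P (tx t x)) ('D_(e1 i) P (tx t x)).
Proof.
move=> dP.
have E : (fun h : R => h^-1 *: (P (tx t (h *: delta_mx 0 i + x)) - P (tx t x))) =
    (fun h : R => h^-1 *: (P (h *: e1 i + tx t x) - P (tx t x))).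
  by apply/funext => h; rewrite (txDr t erefl).
by apply: DeriveDef; rewrite /derivable /derive /= E.
Qed.

Lemma is_derive_tx_l (P : V1 -> R) t x : derivable P (tx t x) e0 ->
  is_derive t (1 : R) (fun t => P (tx t x)) ('D_e0 P (tx t x)).
Proof.
move=> dP.
have E : (fun h : R => h^-1 *: (P (tx (h *: 1 + t) x) - P (tx t x))) =
    (fun h : R => h^-1 *: (P (h *: e0 + tx t x) - P (tx t x))).
  by apply/funext => h; rewrite (@txDl t _ x h)// scaler1.
by apply: DeriveDef; rewrite /derivable /derive /= E.
Qed.

Lemma tx_unif (Q : V1 -> R) x (e : R) : 0 < e ->
  (forall t : R, 0 <= t <= 1 -> {for tx t x, continuous Q}) ->
  \forall y \near x, forall t : R, 0 <= t <= 1 -> `|Q (tx t y) - Q (tx t x)| <= e.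
Proof.
move=> e0 cQ.
have := (@compact_near_coveringP R `[0, 1]).1 (@segment_compact R 0 1).
move=> /(_ V (nbhs x) (fun y t => `|Q (tx t y) - Q (tx t x)| <= e) _) H.
have : \forall y \near x, `[0, 1] `<=` [set t | `|Q (tx t y) - Q (tx t x)| <= e].
  apply: H => t; rewrite /= in_itv /= => t01.
  have e2 : 0 < e / 2 by rewrite divr_gt0.
  have cv : Q (tx z.1 z.2) @[z --> (t, x)] --> Q (tx t x).
    exact: (cvg_comp _ _ (@tx_cvg t x) (cQ t t01)).
  have [[A B] /= [tA xB] AB] : \forall z \near (t, x), `|Q (tx t x) - Q (tx z.1 z.2)| < e / 2.
    by move/cvgrPdist_lt : cv; apply.
  exists (A, B) => //= -[t' y] /= [At' By].
  rewrite -(subrKA (Q (tx t x))) (le_trans (ler_normD _ _))// (splitr e) lerD// ltW//.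
    by rewrite distrC; exact: (AB (t', y)).
  exact: (AB (t', x) (conj At' (nbhs_singleton xB))).
by apply: filterS => y Hy t t01; apply: Hy; rewrite /= in_itv.
Qed.

(** Differentiation under the integral sign: the mean value theorem turns the difference quotient
    into a value of the partial derivative at a nearby point, which is uniformly close over the
    compact time interval. The derivative is an integral of the same kind, so smoothness follows by
    iteration. *)
Lemma smooth_on_int01 (W : set V1) (U : set V) (P : V1 -> R) :
  open W -> open U -> smooth_on W P ->
  (forall t x, 0 <= t <= 1 -> U x -> W (tx t x)) ->
  smooth_on U (fun x => int01 (fun t => P (tx t x))) /\
  forall i x, U x -> 'D_(delta_mx 0 i) (fun x => int01 (fun t => P (tx t x))) x =
     int01 (fun t => 'D_(e1 i) P (tx t x)).
Proof.
move=> oW oU sP UW.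
pose J (Q : V1 -> R) x := int01 (fun t => Q (tx t x)).
have cQ (Q : V1 -> R) x (t : R) : smooth_on W Q -> U x -> 0 <= t <= 1 -> {for tx t x, continuous Q}.
  by move=> sQ Ux t01; exact: smooth_on_cont sQ (UW _ _ t01 Ux).
have cQ1 (Q : V1 -> R) x : smooth_on W Q -> U x -> cont01 (fun t => Q (tx t x)).
  move=> sQ Ux t t01.
  have ct : tx s x @[s --> t] --> tx t x.
    exact: (cvg_comp _ (fun z => tx z.1 z.2) (cvg_pair cvg_id (cvg_cst x)) (@tx_cvg t x)).
  exact: (cvg_comp _ _ ct (cQ Q x t sQ Ux t01)).
have near_int (Q : V1 -> R) x (e : R) : smooth_on W Q -> U x -> 0 < e ->
    \forall y \near x, U y /\ forall t : R, 0 <= t <= 1 -> `|Q (tx t y) - Q (tx t x)| <= e.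
  move=> sQ Ux e0; apply: filterI; first exact: open_near oU Ux.
  by apply: tx_unif => // t t01; exact: cQ.
have cJ (Q : V1 -> R) x : smooth_on W Q -> U x -> {for x, continuous (J Q)}.
  move=> sQ Ux; apply/(@cvgrPdist_le _ _ _ (nbhs x)) => e e0; have H := near_int Q x e sQ Ux e0.
  near=> y; have [Uy Hy] : U y /\ forall t : R, 0 <= t <= 1 ->
    `|Q (tx t y) - Q (tx t x)| <= e by near: y.
  rewrite distrC; apply: int01_close Hy; exact: cQ1.
have dJ (Q : V1 -> R) x i : smooth_on W Q -> U x ->
    is_derive x (delta_mx 0 i : V) (J Q) (J ('D_(e1 i) Q) x).
  move=> sQ Ux; set D := 'D_(e1 i) Q.
  have sD : smooth_on W D := smooth_on_D _ sQ.
  suff E : h^-1 *: (J Q (h *: delta_mx 0 i + x) - J Q x) @[h --> 0^'] --> J D x.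
    by apply: DeriveDef; [apply/cvg_ex; exists (J D x)|exact: cvg_lim E].
  apply/cvgrPdist_le => e e0.
  have /nbhs_ballP[r /= r0 xr] := near_int D x e sD Ux e0.
  near=> h.
  have h0 : h != 0 by near: h; exact: nbhs_dnbhs_neq.
  have hr : `|h| < r by near: h; exact: dnbhs0_lt.
  have inb (c : R) : 0 <= c <= 1 -> ball x r (x + (c * h) *: delta_mx 0 i).
    move=> /andP[c0 c1]; rewrite -ball_normE /ball_ /= opprD addNKr normrN normrZ.
    apply: le_lt_trans hr.
    have -> : `|delta_mx 0 i : V| = 1.
      apply/eqP; rewrite eq_le; apply/andP; split.
        rewrite [leLHS]/Num.Def.normr/= mx_normrE; apply/bigmax_leP; split=> // -[a b] _.
        by rewrite !mxE /=; case: (_ && _); rewrite ?normr1 ?normr0 ?ler01.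
      rewrite [leRHS]/Num.Def.normr/= mx_normrE.
      apply: le_trans (le_bigmax _ _ (0, i)); rewrite !mxE !eqxx normr1; exact: lexx.
    by rewrite mulr1 normrM ger0_norm// ler_piMl.
  have Uh (c : R) : 0 <= c <= 1 -> U (x + (c * h) *: delta_mx 0 i).
    by move=> /inb /xr[].
  have Uxh : U (h *: delta_mx 0 i + x).
    by have := Uh 1; rewrite mul1r addrC; apply; rewrite ler01 lexx.
  have ch := cQ1 Q _ sQ Uxh; have cx := cQ1 Q x sQ Ux.
  have -> : h^-1 *: (J Q (h *: delta_mx 0 i + x) - J Q x) =
      int01 (fun t => h^-1 * (Q (tx t (h *: delta_mx 0 i + x)) - Q (tx t x))).
    by rewrite int01Z; [rewrite int01B|exact: cont01B].
  apply: int01_close; first exact: cQ1.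
    by apply: cont01M; [exact: cont01_cst|exact: cont01B].
  move=> t t01.
  have [s s01|c c01 E] := @mvt_line R V (fun x => Q (tx t x)) x (delta_mx 0 i) h.
    have [] // := @is_derive_tx_r Q t (x + (s * h) *: delta_mx 0 i) i _.
    exact: smooth_on_derivable sQ (UW _ _ t01 (Uh _ s01)).
  rewrite [h *: _ + x]addrC E mulKf//.
  have [_ ->] := @is_derive_tx_r Q t (x + (c * h) *: delta_mx 0 i) i
    (smooth_on_derivable _ sQ (UW _ _ t01 (Uh _ c01))).
  rewrite distrC; exact: (xr _ (inb c c01)).2.
split; last by move=> i x Ux; have [_] := dJ P x i sP Ux.
pose B h := exists2 Q, smooth_on W Q & h = J Q.
apply: (@gen_smooth _ _ B) => //; last by apply: gen_base; exists P.
move=> _ [Q sQ ->]; split=> [x Ux|i].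
  split; first exact: cJ.
  by move=> i; have [] := dJ Q x i sQ Ux.
exists (J ('D_(e1 i) Q)).
  exact: (gen_base (ex_intro2 _ _ _ (smooth_on_D _ sQ) erefl)).
by move=> x Ux; have [_] := dJ Q x i sQ Ux.
Unshelve. all: by end_near. Qed.

End TimeSpace.

(** * Flat functions and cutoffs *)

Section Bump.
Variable R : realType.
Implicit Types (p : {poly R}) (t : R).

(** Products of exp(-1/t) with polynomials in 1/t form a family closed under derivation: p becomes
    X^2 (p - p'). *)
Definition flat p t : R := if 0 < t then p.[t^-1] * expR (- t^-1) else 0.

(** With y = 1/t, exp(y) dominates y^(size p + 2) / (size p + 2)!; the two powers to spare give t^2,
    hence the derivative 0 at 0. *)
Lemma flat_bound p : exists2 C, 0 <= C & forall t, `|t| < 1 -> `|flat p t| <= C * t ^+ 2.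
Proof.
pose A := \sum_(i < size p) `|p`_i|.
have A0 : 0 <= A by apply: sumr_ge0 => i _.
exists (A * (size p).+2`!%:R); first by rewrite mulr_ge0.
move=> t t1; rewrite /flat; case: ifPn => [t0|_]; last first.
  by rewrite normr0 mulr_ge0 ?sqr_ge0// mulr_ge0.
have y1 : 1 <= t^-1.
  by rewrite -invr1 lef_pV2 ?posrE// ltW// (le_lt_trans (ler_norm _)).
set y := t^-1 in y1 *; have y0 : 0 < y by apply: lt_le_trans y1.
have py : `|p.[y]| <= A * y ^+ size p.
  rewrite horner_coef (le_trans (ler_norm_sum _ _ _))// mulr_suml ler_sum// => i _.
  rewrite normrM ler_wpM2l// ger0_norm ?exprn_ge0 ?(ltW y0)//.
  by rewrite ler_weXn2l// ltnW.
have ey : y ^+ (size p).+2 * expR (- y) <= (size p).+2`!%:R.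
  rewrite expRN ler_pdivrMr ?expR_gt0// -ler_pdivrMl ?ltr0n ?fact_gt0//.
  have := @expR_ge1Dxn _ y (size p).+1 (ltW y0); apply: le_trans.
  by rewrite mulrC lerDr.
rewrite normrM [ `|expR _|]gtr0_norm ?expR_gt0//.
apply: (@le_trans _ _ (A * y ^+ size p * expR (- y))).
  by rewrite ler_wpM2r// expR_ge0.
rewrite -!mulrA ler_wpM2l//.
have -> : y ^+ size p * expR (- y) = y ^+ (size p).+2 * expR (- y) * t ^+ 2.
  rewrite -addn2 exprD mulrAC -[X in _ = X * _]mulrA -exprMn mulVf ?lt0r_neq0//.
  by rewrite expr1n mulr1.
by rewrite ler_wpM2r// sqr_ge0.
Qed.

Lemma flat_derive p t : is_derive t 1 (flat p) (flat ('X^2 * (p - p^`())) t).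
Proof.
case: (ltgtP t 0) => [t0|t0|->].
- rewrite [X in is_derive _ _ _ X]/flat ltNge (ltW t0) /=.
  apply: (@near_eq_is_derive _ _ _ (cst (0 : R))).
  near=> s; rewrite /flat ifF//; apply/negbTE; rewrite -leNgt ltW//.
  near: s; exact: lt_nbhsl.
- rewrite [X in is_derive _ _ _ X]/flat t0.
  apply: (@near_eq_is_derive _ _ _ (fun s : R => p.[s^-1] * expR (- s^-1))).
    near=> s; rewrite /flat ifT//.
    near: s; exact: lt_nbhsr.
  have tn0 : t != 0 by rewrite lt0r_neq0.
  have dV := @is_deriveV R id t 1 1 tn0 (is_derive_id _ _).
  have d1 : is_derive t 1 (fun s : R => p.[s^-1]) (p^`().[t^-1] * (- t ^- 2)).
    have := @is_derive1_comp R (horner p) (fun s => s^-1) t _ _ (is_derive_poly p t^-1) dV.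
    by rewrite /GRing.scale /= mulr1.
  have d2 : is_derive t 1 (fun s : R => expR (- s^-1)) (expR (- t^-1) * (t ^- 2)).
    have := @is_derive1_comp R expR (fun s => - s^-1) t _ _ (is_derive_expR _) (is_deriveN dV).
    by rewrite /GRing.scale /= mulr1 opprK.
  have := is_deriveM d1 d2; rewrite /GRing.scale /=.
  congr (is_derive _ _ _ _).
  rewrite hornerM hornerXn hornerD hornerN -exprVn; lra.
- rewrite [X in is_derive _ _ _ X]/flat ltxx.
  have [C C0 HC] := flat_bound p.
  have E : h^-1 *: (flat p (h *: 1 + 0) - flat p 0) @[h --> 0^'] --> (0 : R).
    apply/cvgr0Pnorm_le => e e0.
    near=> h.
    have h0 : h != 0 by near: h; exact: nbhs_dnbhs_neq.
    have h1 : `|h| < 1 by near: h; exact: dnbhs0_lt.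
    have hC : `|h| < e / (C + 1).
      by near: h; apply: dnbhs0_lt; rewrite divr_gt0// ltr_wpDl.
    rewrite scaler1 addr0 {2}/flat ltxx subr0 normrZ normfV.
    rewrite ler_pdivrMl ?normr_gt0//; apply: le_trans (HC _ h1) _.
    rewrite -real_normK ?num_real// expr2 mulrA [leRHS]mulrC ler_wpM2r//.
    move: hC; rewrite ltr_pdivlMr ?ltr_wpDl// => /ltW; apply: le_trans.
    by rewrite mulrC ler_wpM2l// lerDl.
  by apply: DeriveDef; [apply/cvg_ex; exists (0 : R)|exact: cvg_lim E].
Unshelve. all: by end_near. Qed.

Lemma flat1_gt0 t : 0 < t -> 0 < flat 1 t.
Proof. by move=> t0; rewrite /flat t0 hornerC mul1r expR_gt0. Qed.

Lemma flat1_ge0 t : 0 <= flat 1 t.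
Proof. by case: (ltP 0 t) => [/flat1_gt0/ltW//|t0]; rewrite /flat ltNge t0. Qed.

Lemma flat1_eq0 t : t <= 0 -> flat 1 t = 0.
Proof. by rewrite /flat ltNge => ->. Qed.

Variable n : nat.
Local Notation V := 'rV[R]_n.

Lemma flat1_smooth (f : V -> R) : smooth_on setT f -> smooth_on setT (fun x => flat 1 (f x)).
Proof.
move=> sf; pose q := fix q k : {poly R} := if k is k'.+1 then 'X^2 * (q k' - (q k')^`()) else 1.
exact: (@smooth_on_comp1 R n setT openT setT (fun k => flat (q k)) f
  (fun k y _ => flat_derive (q k) y) sf (fun _ _ => Logic.I)).
Qed.

(** A smooth step equal to 1 for |t| <= 1 and to 0 for |t| >= 2. For every t one of the two summands
    of the denominator is positive. *)
Definition plateau t : R :=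
  flat 1 (4%:R - t ^+ 2) / (flat 1 (4%:R - t ^+ 2) + flat 1 (t ^+ 2 - 1)).

Lemma plateau_den t : 0 < flat 1 (4%:R - t ^+ 2) + flat 1 (t ^+ 2 - 1).
Proof.
have := flat1_ge0 (4%:R - t ^+ 2); have := flat1_ge0 (t ^+ 2 - 1).
case: (ltP 0 (4%:R - t ^+ 2)) => [/flat1_gt0|t4]; first by lra.
have /flat1_gt0 : 0 < t ^+ 2 - 1 by lra.
by lra.
Qed.

Definition bump (x0 : V) (r : R) (x : V) : R :=
  \prod_(i < n) plateau ((x 0 i - x0 0 i) / r).

Lemma bump_smooth x0 r : smooth_on setT (bump x0 r).
Proof.
have oT := @openT V.
rewrite /bump; elim: (index_enum _) => [|i s IH].
  by under eq_fun do rewrite big_nil; exact: smooth_on_cst.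
under eq_fun do rewrite big_cons; apply: (smooth_onM oT _ IH).
have s1 : smooth_on setT (fun x : V => (x 0 i - x0 0 i) / r).
  exact: (smooth_onM oT (smooth_onB oT (smooth_on_coord i oT) (smooth_on_cst oT _)) (smooth_on_cst oT _)).
have s2 : smooth_on setT (fun x : V => ((x 0 i - x0 0 i) / r) ^+ 2).
  exact: (smooth_onM oT s1 s1).
have s3 := flat1_smooth (smooth_onB oT (smooth_on_cst oT 4%:R) s2).
have s4 := flat1_smooth (smooth_onB oT s2 (smooth_on_cst oT 1)).
apply: (smooth_onM oT s3 (smooth_on_inv oT (smooth_onD oT s3 s4) _)) => x _.
by rewrite lt0r_neq0// plateau_den.
Qed.

Lemma bump_eq1 x0 r x : 0 < r -> `|x - x0| <= r -> bump x0 r x = 1.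
Proof.
move=> r0 xr; rewrite /bump big1// => i _; rewrite /plateau.
have xi : `|(x 0 i - x0 0 i) / r| <= 1.
  rewrite normrM normfV (gtr0_norm r0) ler_pdivrMr// mul1r; apply: le_trans xr.
  rewrite [leRHS]/Num.Def.normr/= mx_normrE.
  by apply: le_trans (le_bigmax _ _ (0, i)); rewrite !mxE lexx.
set t := _ / r in xi *.
have t1 : t ^+ 2 <= 1 by rewrite -real_normK ?num_real// expr_le1.
rewrite (@flat1_eq0 (t ^+ 2 - 1)) ?subr_le0// addr0 divff// lt0r_neq0// flat1_gt0//.
by lra.
Qed.

Lemma bump_eq0 x0 r x : 0 < r -> 2 * r <= `|x - x0| -> bump x0 r x = 0.
Proof.
move=> r0 xr; have [i xi] : exists i, 2 * r <= `|x 0 i - x0 0 i|.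
  have nz : mx_norm (x - x0) != 0.
    by rewrite lt0r_neq0//; apply: lt_le_trans xr; rewrite mulr_gt0.
  have [[a i] E] := mx_norm_neq0 nz.
  by exists i; move: xr; rewrite [leRHS]E /= (ord1 a) !mxE.
rewrite /bump (bigD1 i)//= /plateau flat1_eq0 ?mul0r// subr_le0.
have t2 : 2 <= `|(x 0 i - x0 0 i) / r|.
  by rewrite normrM normfV (gtr0_norm r0) ler_pdivlMr.
rewrite -real_normK ?num_real//; nra.
Qed.

End Bump.

(** * Smooth functions and maps on manifolds *)

Lemma open_preim (T S : topologicalType) (U : set T) (f : T -> S) (O : set S) :
  open U -> (forall x, U x -> {for x, continuous f}) -> open O ->
  open (U `&` f @^-1` O).
Proof.
move=> oU cf oO; rewrite openE => x [Ux Ofx]; apply: filterI.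
  exact: open_nbhs_nbhs.
exact: (cf x Ux _ (open_nbhs_nbhs (conj oO Ofx))).
Qed.

Section Charts.
Variables (R : realType) (n : nat) (M : manifold R n).
Implicit Types (c d : chart R n M) (W O : set M) (f g : M -> R).

Lemma chart_ok c : atlas M c -> is_chart c.
Proof. by have [H _ _] := manifold_atlas M; exact: H. Qed.

Lemma chart_at (p : M) : exists2 c, atlas M c & cdom c p.
Proof. by have [_ H _] := manifold_atlas M; exact: H. Qed.

Lemma cdom_open c : atlas M c -> open (cdom c).
Proof. by case/chart_ok. Qed.

Lemma cimg_open c : atlas M c -> open (cimg c).
Proof. by case/chart_ok. Qed.

Lemma cmapK c p : atlas M c -> cdom c p -> cinv c (cmap c p) = p.
Proof. by case/chart_ok => _ _ H _ _; exact: H. Qed.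

Lemma cmap_cont c p : atlas M c -> cdom c p -> {for p, continuous (cmap c)}.
Proof. by case/chart_ok => _ _ _ H _; exact: H. Qed.

Lemma cinv_cont c x : atlas M c -> cimg c x -> {for x, continuous (cinv c)}.
Proof. by case/chart_ok => _ _ _ _ H; exact: H. Qed.

Lemma cimg_cmap c p : cdom c p -> cimg c (cmap c p).
Proof. by move=> cp; exists p. Qed.

Lemma cinvP c x : atlas M c -> cimg c x -> cdom c (cinv c x) /\ cmap c (cinv c x) = x.
Proof. by move=> Ac [p cp <-]; rewrite cmapK. Qed.

Lemma im_setI c W : atlas M c ->
  cmap c @` (cdom c `&` W) = cimg c `&` cinv c @^-1` W.
Proof.
move=> Ac; apply/seteqP; split=> x.
  by case=> p [cp Wp] <-; split; [exact: cimg_cmap|rewrite /= cmapK].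
by case=> /(cinvP Ac)[cx xE] Wx; exists (cinv c x).
Qed.

Lemma im_setI_open c W : atlas M c -> open W -> open (cmap c @` (cdom c `&` W)).
Proof.
move=> Ac oW; rewrite im_setI//; apply: open_preim => //; first exact: cimg_open.
by move=> x; exact: cinv_cont.
Qed.

Lemma chart_compat c d i : atlas M c -> atlas M d ->
  smooth_on (cimg c `&` cinv c @^-1` cdom d) (fun x => cmap d (cinv c x) 0 i).
Proof. by move=> Ac Ad; have [_ _ H] := manifold_atlas M; exact: H. Qed.

Lemma smooth_fun_on_sub W O f : O `<=` W -> smooth_fun_on W f -> smooth_fun_on O f.
Proof.
move=> OW sf c Ac; apply: smooth_on_sub (sf c Ac).
by move=> x [p [cp Op] <-]; exists p => //; split => //; exact: OW.
Qed.

Lemma smooth_fun_on_eq W f g : open W -> (forall p, W p -> f p = g p) ->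
  smooth_fun_on W f -> smooth_fun_on W g.
Proof.
move=> oW fg sf c Ac; apply: smooth_on_eq (im_setI_open Ac oW) _ (sf c Ac).
by rewrite im_setI// => x [_ Wx]; exact: fg.
Qed.

Lemma smooth_fun_cover f :
  (forall p, exists2 O, O p & smooth_fun_on O f) -> smooth_fun f.
Proof.
move=> H c Ac s x [p [cp _] xp]; case: (H p) => O Op sO.
by apply: sO => //; rewrite -xp; exists p.
Qed.

(** Compatibility transports smoothness from the one chart [c] to all others. *)
Lemma smooth_fun_on_chart c O (V : set 'rV[R]_n) (h : 'rV[R]_n -> R) f :
  atlas M c -> open O -> O `<=` cdom c -> open V -> smooth_on V h ->
  (forall p, O p -> V (cmap c p)) -> (forall p, O p -> f p = h (cmap c p)) ->
  smooth_fun_on O f.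
Proof.
move=> Ac oO Oc oV sh OV fh d Ad.
have oU := im_setI_open Ad oO.
apply: (smooth_on_eq oU (f := h \o (cmap c \o cinv d))).
  by rewrite im_setI// => x [_ Ox]; rewrite /= fh.
apply: (smooth_on_comp oU oV sh).
  move=> j; apply: smooth_on_sub (chart_compat j Ad Ac).
  by rewrite im_setI// => x [dx Ox]; split => //; exact: Oc.
by rewrite im_setI// => x [_ Ox]; exact: OV.
Qed.

Lemma smooth_fun_on_cont W f p : open W -> smooth_fun_on W f -> W p -> {for p, continuous f}.
Proof.
move=> oW sf Wp; have [c Ac cp] := chart_at p.
have nE : {near p, (f \o cinv c) \o cmap c =1 f}.
  apply: filterS (open_nbhs_nbhs (conj (cdom_open Ac) cp)) => q cq.
  by rewrite /= cmapK.
apply: near_continuous nE _.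
apply: continuous_comp; first exact: cmap_cont.
by apply: smooth_on_cont (sf c Ac) _; exists p.
Qed.

Lemma smooth_fun_cont f : smooth_fun f -> continuous f.
Proof. by move=> sf p; exact: (smooth_fun_on_cont openT sf Logic.I). Qed.

Section Algebra.
Variable W : set M.
Hypothesis oW : open W.

Lemma sfun_cst a : smooth_fun_on W (fun=> a).
Proof. by move=> c Ac; exact: (smooth_on_cst (im_setI_open Ac oW)). Qed.

Lemma sfunD f g : smooth_fun_on W f -> smooth_fun_on W g ->
  smooth_fun_on W (fun p => f p + g p).
Proof. by move=> sf sg c Ac; exact: (smooth_onD (im_setI_open Ac oW) (sf c Ac) (sg c Ac)). Qed.

Lemma sfunM f g : smooth_fun_on W f -> smooth_fun_on W g ->
  smooth_fun_on W (fun p => f p * g p).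
Proof. by move=> sf sg c Ac; exact: (smooth_onM (im_setI_open Ac oW) (sf c Ac) (sg c Ac)). Qed.

Lemma sfunN f : smooth_fun_on W f -> smooth_fun_on W (fun p => - f p).
Proof. by move=> sf c Ac; exact: (smooth_onN (im_setI_open Ac oW) (sf c Ac)). Qed.

Lemma sfunB f g : smooth_fun_on W f -> smooth_fun_on W g ->
  smooth_fun_on W (fun p => f p - g p).
Proof. by move=> sf sg; exact: sfunD sf (sfunN sg). Qed.

Lemma sfun_sum (I : Type) (r : seq I) (F : I -> M -> R) :
  (forall i, smooth_fun_on W (F i)) -> smooth_fun_on W (fun p => \sum_(i <- r) F i p).
Proof.
move=> sF c Ac.
exact: (@smooth_on_sum _ _ _ (im_setI_open Ac oW) I r (fun i => F i \o cinv c) (fun i => sF i c Ac)).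
Qed.

Lemma sfun_inv f : smooth_fun_on W f -> (forall p, W p -> f p != 0) ->
  smooth_fun_on W (fun p => (f p)^-1).
Proof.
move=> sf f0 c Ac; apply: (smooth_on_inv (im_setI_open Ac oW) (sf c Ac)).
by rewrite im_setI// => x [_ Wx]; exact: f0.
Qed.

End Algebra.

Lemma chart_bump_compact c p O : atlas M c -> cdom c p -> open O -> O p ->
  exists (chi : M -> R) (F O1 : set M),
    [/\ smooth_fun chi, compact F /\ F `<=` O `&` cdom c,
        forall q, ~ F q -> chi q = 0,
        open O1 /\ O1 p & O1 `<=` F /\ forall q, O1 q -> chi q = 1].
Proof.
move=> Ac cp oO Op; pose x0 := cmap c p.
have : nbhs x0 (cimg c `&` cinv c @^-1` O).
  apply: open_nbhs_nbhs; rewrite -im_setI//; split; first exact: im_setI_open.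
  by exists p.
move=> /nbhs_ballP[r /= r0 xr].
(* The cutoff lives on the box of half-width 2 s, which lies inside the ball of radius r = 4 s. *)
pose s := r / 4%:R; have s0 : 0 < s by rewrite divr_gt0.
pose C : set 'rV[R]_n := [set x | forall i, `[x0 ord0 i - 2 * s, x0 ord0 i + 2 * s]%classic (x ord0 i)].
have cC : compact C.
  apply: (@rV_compact R n (fun i => `[x0 ord0 i - 2 * s, x0 ord0 i + 2 * s]%classic)) => i.
  exact: segment_compact.
have Cin x : `|x - x0| <= 2 * s -> C x.
  move=> xs i; rewrite /= in_itv /= -ler_distl; apply: le_trans xs.
  rewrite [leRHS]/Num.Def.normr/= mx_normrE.
  by apply: le_trans (le_bigmax _ _ (0, i)); rewrite !mxE lexx.
have CV x : C x -> cimg c x /\ O (cinv c x).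
  move=> Cx; apply: xr; rewrite -ball_normE /ball_ /= distrC.
  rewrite [ltLHS]/Num.Def.normr/= mx_normrE; apply/bigmax_ltP; split => // -[a i] _.
  rewrite !mxE (ord1 a) /=; have := Cx i; rewrite /= in_itv /= -ler_distl => /le_lt_trans; apply.
  by rewrite /s; lra.
pose F := cinv c @` C.
have kF : compact F.
  apply: continuous_compact cC; apply: continuous_in_subspaceT => x /set_mem Cx.
  by apply: cinv_cont => //; have [] := CV x Cx.
(* The Hausdorff property enters here: outside the closed set [F] the extension by 0 is smooth. *)
have cF : closed F by apply: compact_closed => //; exact: (manifold_hausdorff (m := M)).
have FO : F `<=` O `&` cdom c.
  by move=> _ [x /CV[cx Ox] <-]; split => //; have [] := cinvP Ac cx.
pose chi q := if `[< cdom c q >] then bump x0 s (cmap c q) else 0.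
have chi0 q : ~ F q -> chi q = 0.
  move=> Fq; rewrite /chi; case: asboolP => // cq.
  apply: bump_eq0 => //; rewrite leNgt; apply/negP => /ltW/Cin Cq.
  by apply: Fq; exists (cmap c q) => //; rewrite cmapK.
pose O1 := cdom c `&` cmap c @^-1` ball x0 s.
exists chi, F, O1; split => //.
- apply: smooth_fun_cover => q; have [Fq|Fq] := pselect (F q).
    exists (cdom c); first by have [] := FO q Fq.
    apply: (@smooth_fun_on_chart c _ setT (bump x0 s)) => //.
    + exact: cdom_open.
    + exact: openT.
    + exact: bump_smooth.
    + by move=> q' cq'; rewrite /chi; case: asboolP.
  exists (~` F) => //; have oF : open (~` F) by exact: closed_openC.
  apply: (smooth_fun_on_eq oF (f := fun=> 0)); last exact: sfun_cst.
  by move=> q' /chi0 ->.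
- split; last by split => //; exact: ballxx.
  apply: open_preim; [exact: cdom_open|by move=> q; exact: cmap_cont|].
  exact: ball_open.
- split=> [q [cq]|q [cq]]; rewrite /= -ball_normE /ball_ /= distrC => qs.
    exists (cmap c q); last by rewrite cmapK.
    by apply: Cin; apply: le_trans (ltW qs) _; rewrite ler_peMl// ltW// ltr1n.
  by rewrite /chi; case: asboolP => // _; apply: bump_eq1 => //; exact: ltW.
Qed.

Lemma chart_bump c p O : atlas M c -> cdom c p -> open O -> O p ->
  exists (chi : M -> R) (F O1 : set M),
    [/\ smooth_fun chi, closed F /\ F `<=` O `&` cdom c,
        forall q, ~ F q -> chi q = 0,
        open O1 /\ O1 p & O1 `<=` F /\ forall q, O1 q -> chi q = 1].
Proof.
move=> Ac cp oO Op; have [chi [F [ O1 [schi [kF FO] chi0 nO [ O1F chi1]]]]] := chart_bump_compact Ac cp oO Op.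
exists chi, F, O1; split=> //; split=> //.
by apply: compact_closed => //; exact: (manifold_hausdorff (m := M)).
Qed.

Lemma bump_mul_smooth chi f (F O : set M) : smooth_fun chi -> closed F -> open O ->
  F `<=` O -> (forall q, ~ F q -> chi q = 0) -> smooth_fun_on O f ->
  smooth_fun (fun q => chi q * f q).
Proof.
move=> schi cF oO FO chi0 sf; apply: smooth_fun_cover => q.
have [Fq|Fq] := pselect (F q).
  exists O; first exact: FO.
  by apply: (sfunM oO _ sf); apply: smooth_fun_on_sub schi.
exists (~` F) => //; have oF : open (~` F) by exact: closed_openC.
apply: (smooth_fun_on_eq oF (f := fun=> 0)); last exact: sfun_cst.
by move=> q' /chi0 ->; rewrite mul0r.
Qed.

End Charts.

(** * Composition of smooth maps *)

Section Maps.
Variables (R : realType) (n m k : nat).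
Variables (M : manifold R n) (N : manifold R m).

Lemma smooth_from_comp (U : set 'rV[R]_k) (W : set N) (F : 'rV[R]_k -> N) (f : N -> R) :
  open U -> open W -> smooth_from_rV U F -> smooth_fun_on W f ->
  (forall x, U x -> W (F x)) -> smooth_on U (f \o F).
Proof.
move=> oU oW [cF sF] sf UW s x Ux.
have [d Ad dx] := chart_at (F x).
pose U' := U `&` F @^-1` (cdom d `&` W).
have oU' : open U' by apply: open_preim => //; apply: openI => //; exact: cdom_open.
have U'x : U' x by split => //; split => //; exact: UW.
suff : smooth_on U' (f \o F) by exact.
apply: (smooth_on_eq oU' (f := (f \o cinv d) \o (cmap d \o F))).
  by move=> y [_ [dy _]]; rewrite /= cmapK.
apply: (smooth_on_comp oU' (im_setI_open Ad oW) (sf d Ad)).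
  by move=> j; apply: smooth_on_sub (sF d Ad j) => y [Uy [dy _]].
by move=> y [_ [dy Wy]]; exists (F y).
Qed.

Lemma smooth_from_precomp l (U : set 'rV[R]_l) (U' : set 'rV[R]_k)
    (phi : 'rV[R]_l -> 'rV[R]_k) (F : 'rV[R]_k -> N) :
  open U -> open U' -> (forall j, smooth_on U (fun x => phi x 0 j)) ->
  (forall x, U x -> U' (phi x)) -> smooth_from_rV U' F -> smooth_from_rV U (F \o phi).
Proof.
move=> oU oU' sphi UU' [cF sF].
have cphi x : U x -> {for x, continuous phi}.
  by move=> Ux; apply: continuous_rV => j; exact: smooth_on_cont (sphi j) Ux.
split=> [x Ux|d Ad i].
  by apply: continuous_comp; [exact: cphi|exact/cF/UU'].
have o1 : open (U' `&` F @^-1` cdom d).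
  by apply: open_preim => //; exact: cdom_open.
have o2 : open (U `&` (F \o phi) @^-1` cdom d).
  have -> : U `&` (F \o phi) @^-1` cdom d = U `&` phi @^-1` (U' `&` F @^-1` cdom d).
    by apply/seteqP; split=> x [Ux]; [move=> dx; split => //; split => //; exact: UU'|case].
  exact: (open_preim oU cphi o1).
apply: (smooth_on_comp o2 o1 (sF d Ad i)).
  by move=> j; apply: smooth_on_sub (sphi j) => x [].
by move=> x [Ux dx]; split => //; exact: UU'.
Qed.

Lemma smooth_from_postcomp (U : set 'rV[R]_k) (W : set M) (G : 'rV[R]_k -> M) (F : M -> N) :
  open U -> open W -> smooth_from_rV U G -> smooth_map_on W F ->
  (forall x, U x -> W (G x)) -> smooth_from_rV U (F \o G).
Proof.
move=> oU oW [cG sG] sF UW.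
have nb c x : atlas M c -> U x -> cdom c (G x) ->
    exists U', [/\ open U', U' x, U' `<=` U, forall y, U' y -> cdom c (G y) &
      forall j, smooth_on U' (fun y => cmap c (G y) 0 j)].
  move=> Ac Ux cx; exists (U `&` G @^-1` cdom c); split => //.
  - by apply: open_preim => //; exact: cdom_open.
  - by move=> y [_ cy].
  - exact: sG.
split=> [x Ux|d Ad i].
  have [c Ac cx] := chart_at (G x); have [U' [oU' U'x U'U U'c sU']] := nb c x Ac Ux cx.
  have nE : {near x, (F \o cinv c) \o (cmap c \o G) =1 F \o G}.
    by apply: filterS (open_near oU' U'x) => y /U'c cy; rewrite /= cmapK.
  apply: near_continuous nE _; apply: continuous_comp.
    by apply: continuous_rV => j; exact: smooth_on_cont (sU' j) U'x.
  by have [H _] := sF c Ac; apply: H; exists (G x) => //; split => //; exact: UW.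
move=> s x [Ux dx].
have [c Ac cx] := chart_at (G x); have [U' [oU' U'x U'U U'c sU']] := nb c x Ac Ux cx.
have [cFc sFc] := sF c Ac.
have oI : open (cmap c @` (cdom c `&` W)) := im_setI_open Ac oW.
have o1 : open (cmap c @` (cdom c `&` W) `&` (F \o cinv c) @^-1` cdom d).
  by apply: open_preim => //; exact: cdom_open.
pose U2 := U' `&` (cmap c \o G) @^-1` (cmap c @` (cdom c `&` W) `&` (F \o cinv c) @^-1` cdom d).
have o2 : open U2.
  apply: (open_preim oU' _ o1) => y U'y.
  by apply: continuous_rV => j; exact: smooth_on_cont (sU' j) U'y.
have U2x : U2 x.
  by split => //; split=> /=; [exists (G x) => //; split => //; exact: UW|rewrite cmapK].
suff : smooth_on U2 (fun y => cmap d ((F \o G) y) 0 i) by exact.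
apply: (smooth_on_eq o2 (f := (fun y => cmap d ((F \o cinv c) y) 0 i) \o (cmap c \o G))).
  by move=> y [/U'c cy _]; rewrite /= cmapK.
apply: (smooth_on_comp o2 o1 (sFc d Ad i)).
  by move=> j; apply: smooth_on_sub (sU' j) => y [].
by move=> y [].
Qed.

Lemma smooth_map_comp (F : M -> N) (f : N -> R) : smooth_map F -> smooth_fun f ->
  smooth_fun (f \o F).
Proof.
move=> sF sf c Ac; rewrite setIT.
have oU := cimg_open Ac; have := sF c Ac; rewrite setIT => sFc s x Ux.
have [cF sF'] := sFc.
have [d Ad dx] := chart_at (F (cinv c x)).
pose U' := cimg c `&` (F \o cinv c) @^-1` cdom d.
have oU' : open U' by apply: open_preim => //; exact: cdom_open.
suff : smooth_on U' (f \o F \o cinv c) by apply.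
apply: (smooth_on_eq oU' (f := (f \o cinv d) \o (cmap d \o (F \o cinv c)))).
  by move=> y [_ dy]; rewrite /= cmapK.
have sfd := sf d Ad; rewrite setIT in sfd.
apply: (smooth_on_comp oU' (cimg_open Ad) sfd); first exact: sF'.
by move=> y [_ dy]; exact: cimg_cmap.
Qed.

End Maps.

Lemma smooth_fun_img (R : realType) n (M : manifold R n) (f : M -> R) c :
  smooth_fun f -> atlas M c -> smooth_on (cimg c) (f \o cinv c).
Proof. by move=> sf Ac; have := sf c Ac; rewrite setIT. Qed.

(** * Families of functions and maps depending on time *)

Section Families.
Variables (R : realType) (n : nat) (M : manifold R n).
Implicit Types (P Q g : R -> M -> R) (c : chart R n M).

Definition tset (A : set 'rV[R]_n) : set 'rV[R]_(1 + n) := [set z | A (rsubmx z)].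

Lemma tset_open A : open A -> open (tset A).
Proof.
move=> oA; have -> : tset A = setT `&` (@rsubmx R 1 1 n) @^-1` A.
  by rewrite setTI.
apply: (open_preim openT _ oA) => z _; apply: continuous_rV => j.
exact: smooth_on_cont (smooth_on_tx_r j openT) Logic.I.
Qed.

Definition lift P c : 'rV[R]_(1 + n) -> R := fun z => P (lsubmx z 0 0) (cinv c (rsubmx z)).

Lemma lift_tx P c t x : lift P c (tx t x) = P t (cinv c x).
Proof. by rewrite /lift tx_l tx_r. Qed.

(** Joint smoothness on the product of the line with [M], stated in the coordinates (t, x) given by
    a chart of [M]. *)
Definition smoothRM P := forall c, atlas M c -> smooth_on (tset (cimg c)) (lift P c).

Definition smoothRMap m (N : manifold R m) (F : R -> M -> N) :=
  forall c, atlas M c -> smooth_from_rV (tset (cimg c))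
    (fun z => F (lsubmx z 0 0) (cinv c (rsubmx z))).

Lemma toset c : atlas M c -> open (tset (cimg c)).
Proof. by move=> Ac; apply: tset_open; exact: cimg_open. Qed.

Lemma rm_comp m (N : manifold R m) (F : R -> M -> N) f :
  smoothRMap F -> smooth_fun f -> smoothRM (fun t p => f (F t p)).
Proof.
by move=> sF sf c Ac; exact: (smooth_from_comp (toset Ac) openT (sF c Ac) sf (fun _ _ => Logic.I)).
Qed.

Lemma smooth_tx_fix (U : set 'rV[R]_n) t (j : 'I_(1 + n)) : open U ->
  smooth_on U (fun x => tx t x 0 j).
Proof.
move=> oU; case: (splitP j) => i ji.
  have -> : j = lshift n i by apply/val_inj.
  by under eq_fun do rewrite tx_lshift; exact: smooth_on_cst.
have -> : j = rshift 1 i by apply/val_inj.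
by under eq_fun do rewrite tx_rshift; exact: smooth_on_coord.
Qed.

Lemma rm_fix P t : smoothRM P -> smooth_fun (P t).
Proof.
move=> sP c Ac; rewrite setIT.
apply: (smooth_on_eq (cimg_open Ac) (f := lift P c \o tx t)).
  by move=> x _; rewrite /= lift_tx.
apply: (smooth_on_comp (cimg_open Ac) (toset Ac) (sP c Ac)).
  by move=> j; exact: smooth_tx_fix (cimg_open Ac).
by move=> x cx; rewrite /tset /= tx_r.
Qed.

Lemma rmap_fix m (N : manifold R m) (F : R -> M -> N) t : smoothRMap F -> smooth_map (F t).
Proof.
move=> sF c Ac; rewrite setIT.
have H : smooth_from_rV (cimg c) ((fun z => F (lsubmx z 0 0) (cinv c (rsubmx z))) \o tx t).
  apply: (smooth_from_precomp (cimg_open Ac) (toset Ac) _ _ (sF c Ac)).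
    by move=> j; exact: smooth_tx_fix (cimg_open Ac).
  by move=> x cx; rewrite /tset /= tx_r.
have E : (fun z => F (lsubmx z 0 0) (cinv c (rsubmx z))) \o tx t = F t \o cinv c.
  by apply/funext => x; rewrite /= tx_l tx_r.
by rewrite E in H.
Qed.

Lemma rm_const f : smooth_fun f -> smoothRM (fun _ p => f p).
Proof.
move=> sf c Ac.
apply: (smooth_on_comp (toset Ac) (cimg_open Ac) (smooth_fun_img sf Ac)
  (G := (@rsubmx R 1 1 n))); last by [].
by move=> j; exact: smooth_on_tx_r (toset Ac).
Qed.

Lemma rm_time : smoothRM (fun t _ => t).
Proof. by move=> c Ac; exact: smooth_on_tx_l (toset Ac). Qed.

Lemma rmM P Q : smoothRM P -> smoothRM Q -> smoothRM (fun t p => P t p * Q t p).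
Proof. by move=> sP sQ c Ac; exact: (smooth_onM (toset Ac) (sP c Ac) (sQ c Ac)). Qed.

Lemma reparam_smooth g c (j : 'I_(1 + n)) : atlas M c ->
  smooth_on (tset (cimg c)) (lift g c) ->
  smooth_on (tset (cimg c)) (fun z => tx (lift g c z) (rsubmx z) 0 j).
Proof.
move=> Ac sg; case: (splitP j) => i ji.
  have -> : j = lshift n i by apply/val_inj.
  by under eq_fun do rewrite tx_lshift.
have -> : j = rshift 1 i by apply/val_inj.
by under eq_fun do rewrite tx_rshift; exact: smooth_on_tx_r (toset Ac).
Qed.

Lemma rm_reparam P g : smoothRM P -> smoothRM g -> smoothRM (fun t p => P (g t p) p).
Proof.
move=> sP sg c Ac.
have -> : lift (fun t p => P (g t p) p) c = lift P c \o (fun z => tx (lift g c z) (rsubmx z)).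
  by apply/funext => z; rewrite /= lift_tx.
apply: (smooth_on_comp (toset Ac) (toset Ac) (sP c Ac)).
  by move=> j; exact: reparam_smooth (sg c Ac).
by move=> z; rewrite /tset /= tx_r.
Qed.

Lemma rmap_reparam m (N : manifold R m) (F : R -> M -> N) g :
  smoothRMap F -> smoothRM g -> smoothRMap (fun t p => F (g t p) p).
Proof.
move=> sF sg c Ac.
have := smooth_from_precomp (phi := fun z => tx (lift g c z) (rsubmx z)) (toset Ac) (toset Ac)
  (fun j => reparam_smooth j Ac (sg c Ac)) _ (sF c Ac).
have -> : (fun z => F (lsubmx z 0 0) (cinv c (rsubmx z))) \o
   (fun z => tx (lift g c z) (rsubmx z)) =
   (fun z => F (g (lsubmx z 0 0) (cinv c (rsubmx z))) (cinv c (rsubmx z))).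
  by apply/funext => z; rewrite /= tx_l tx_r.
by apply => z; rewrite /tset /= tx_r.
Qed.

Definition dt P t p := 'D_1 (P^~ p) t.

Lemma rm_lift_dt P c t x : smoothRM P -> atlas M c -> cimg c x ->
  is_derive t (1 : R) (fun s => P s (cinv c x)) ('D_(e0 R n) (lift P c) (tx t x)).
Proof.
move=> sP Ac cx.
have cz : tset (cimg c) (tx t x) by rewrite /tset /= tx_r.
have := is_derive_tx_l (smooth_on_derivable (lshift n 0) (sP c Ac) cz).
have -> // : (fun s => lift P c (tx s x)) = (fun s => P s (cinv c x)).
by apply/funext => s; rewrite lift_tx.
Qed.

Lemma rm_is_derive P t p : smoothRM P -> is_derive t (1 : R) (P^~ p) (dt P t p).
Proof.
move=> sP; have [c Ac cp] := chart_at p.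
have [d v] := rm_lift_dt t sP Ac (cimg_cmap cp); rewrite (cmapK Ac cp) in d v.
exact: derivableP d.
Qed.

Lemma rm_dtE P c t x : smoothRM P -> atlas M c -> cimg c x ->
  dt P t (cinv c x) = 'D_(e0 R n) (lift P c) (tx t x).
Proof. by move=> sP Ac cx; have [_ <-] := rm_lift_dt t sP Ac cx. Qed.

Lemma rm_dt P : smoothRM P -> smoothRM (dt P).
Proof.
move=> sP c Ac; apply: (smooth_on_eq (toset Ac) (f := 'D_(e0 R n) (lift P c))).
  by move=> z cz; rewrite /lift (rm_dtE _ sP Ac cz) tx_id.
exact: smooth_on_D (sP c Ac).
Qed.

Lemma rm_cont P t p : smoothRM P -> P z.1 z.2 @[z --> (t, p)] --> P t p.
Proof.
move=> sP; have [c Ac cp] := chart_at p.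
have czx : tset (cimg c) (tx t (cmap c p)) by rewrite /tset /= tx_r; exact: cimg_cmap.
have c1 : {for tx t (cmap c p), continuous (lift P c)} := smooth_on_cont (sP c Ac) czx.
have c2 : (fun z : R * M => (z.1, cmap c z.2)) @ (t, p) --> (t, cmap c p).
  have c21 : (fun z : R * M => z.1) @ (t, p) --> t by exact: cvg_fst.
  have c20 : (fun z : R * M => z.2) @ (t, p) --> p by exact: cvg_snd.
  have c22 : (fun z : R * M => cmap c z.2) @ (t, p) --> cmap c p.
    exact: (cvg_comp _ _ c20 (cmap_cont Ac cp)).
  exact: (cvg_pair c21 c22).
have c3 := cvg_comp _ _ (cvg_comp _ _ c2 (@tx_cvg R n t (cmap c p))) c1.
rewrite lift_tx (cmapK Ac cp) in c3; apply: cvg_trans c3; apply: near_eq_cvg.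
exists (setT, cdom c) => /=.
  by split; [exact: filterT|apply: open_nbhs_nbhs; split => //; exact: cdom_open].
by move=> [s q] [_ cq] /=; rewrite lift_tx cmapK.
Qed.

Lemma rmap_cont m (N : manifold R m) (F : R -> M -> N) t p : smoothRMap F ->
  F z.1 z.2 @[z --> (t, p)] --> F t p.
Proof.
move=> sF; have [c Ac cp] := chart_at p.
have czx : tset (cimg c) (tx t (cmap c p)) by rewrite /tset /= tx_r; exact: cimg_cmap.
have [cF _] := sF c Ac; have c1 := cF _ czx.
have c2 : (fun z : R * M => (z.1, cmap c z.2)) @ (t, p) --> (t, cmap c p).
  have c21 : (fun z : R * M => z.1) @ (t, p) --> t by exact: cvg_fst.
  have c20 : (fun z : R * M => z.2) @ (t, p) --> p by exact: cvg_snd.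
  have c22 : (fun z : R * M => cmap c z.2) @ (t, p) --> cmap c p.
    exact: (cvg_comp _ _ c20 (cmap_cont Ac cp)).
  exact: (cvg_pair c21 c22).
have c3 := cvg_comp _ _ (cvg_comp _ _ c2 (@tx_cvg R n t (cmap c p))) c1.
rewrite /= tx_l tx_r (cmapK Ac cp) in c3; apply: cvg_trans c3; apply: near_eq_cvg.
exists (setT, cdom c) => /=.
  by split; [exact: filterT|apply: open_nbhs_nbhs; split => //; exact: cdom_open].
by move=> [s q] [_ cq] /=; rewrite tx_l tx_r cmapK.
Qed.

(* The primitive in time, written as an integral over the fixed interval
   [0, 1] so that the parameter dependence is smooth. *)
Definition primitive P (s : R) p := s * int01 (fun u => P (u * s) p).

Lemma rm_primitive P : smoothRM P -> smoothRM (primitive P).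
Proof.
move=> sP; apply: rmM; first exact: rm_time.
move=> c Ac.
(* The coordinates are the integration variable, the time s and the point. *)
pose W : set 'rV[R]_(1 + (1 + n)) := [set w | tset (cimg c) (rsubmx w)].
have oW : open W.
  have -> : W = setT `&` (@rsubmx R 1 1 (1 + n)) @^-1` tset (cimg c) by rewrite setTI.
  apply: (open_preim openT _ (toset Ac)) => z _; apply: continuous_rV => j.
  exact: smooth_on_cont (smooth_on_tx_r j openT) Logic.I.
pose phi (w : 'rV[R]_(1 + (1 + n))) : 'rV[R]_(1 + n) :=
  tx (lsubmx w 0 0 * lsubmx (rsubmx w) 0 0) (rsubmx (rsubmx w)).
have sphi j : smooth_on W (fun w => phi w 0 j).
  case: (splitP j) => i ji.
    have -> : j = lshift n i by apply/val_inj.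
    under eq_fun do rewrite tx_lshift.
    apply: (smooth_onM oW (smooth_on_tx_l oW)).
    have -> : (fun w : 'rV[R]_(1 + (1 + n)) => lsubmx (rsubmx w) 0 0) =
        (fun w : 'rV[R]_(1 + (1 + n)) => rsubmx w 0 (lshift n 0)).
      by apply/funext => w; rewrite mxE.
    exact: smooth_on_tx_r.
  have -> : j = rshift 1 i by apply/val_inj.
  under eq_fun do rewrite tx_rshift.
  have -> : (fun w : 'rV[R]_(1 + (1 + n)) => rsubmx (rsubmx w) 0 i) =
      (fun w : 'rV[R]_(1 + (1 + n)) => rsubmx w 0 (rshift 1 i)).
    by apply/funext => w; rewrite mxE.
  exact: smooth_on_tx_r.
have sW : smooth_on W (lift P c \o phi).
  apply: (smooth_on_comp oW (toset Ac) (sP c Ac) sphi) => w.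
  by rewrite /W /tset /phi /= tx_r.
have [H _] := smooth_on_int01 oW (toset Ac) sW (fun t x _ Ux =>
   eq_ind_r (fun y => tset (cimg c) y) Ux (tx_r t x)).
apply: (smooth_on_eq (toset Ac) _ H) => z _; apply: int01_eq => t _.
by rewrite /= /phi lift_tx tx_l !tx_r.
Qed.

(** The interval of integration is fixed, so one differentiates under the integral sign and
    recognises the result as the derivative in u of u P(u t), to which the fundamental theorem of
    calculus applies. *)
Lemma dt_primitive P t p : smoothRM P -> is_derive t (1 : R) (primitive P ^~ p) (P t p).
Proof.
move=> sP.
have sPr := rm_primitive sP.
have dPr s := rm_is_derive s p sPr.
have dP s := rm_is_derive s p sP.
have cP s : {for s, continuous (P^~ p)}.
  by have [d _] := dP s; exact/differentiable_continuous/derivable1_diffP.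
have primE s : primitive P s p = int01 (fun u => s * P (u * s) p).
  rewrite /primitive int01Z// => u _.
  have cu : {for u, continuous (fun u : R => u * s)} by exact: (cvgM cvg_id (cvg_cst s)).
  exact: (continuous_comp cu (cP (u * s))).
have prim0 : primitive P 0 p = 0 by rewrite /primitive mul0r.
(* d/du (u P(us)) integrates to P(s), and equals the derivative in s of the
   integrand s P(us). *)
have key : int01 (fun u => P (u * t) p + u * (t * dt P (u * t) p)) = P t p.
  have cdP s : {for s, continuous ((dt P) ^~ p)}.
    have [d _] := rm_is_derive s p (rm_dt sP).
    exact/differentiable_continuous/derivable1_diffP.
  have cu (Q : R -> R) (u : R) : {for u * t, continuous Q} -> {for u, continuous (fun u : R => Q (u * t))}.
    move=> cQ; have cu : {for u, continuous (fun u : R => u * t)}.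
      by exact: (cvgM cvg_id (cvg_cst t)).
    exact: (continuous_comp cu cQ).
  have dut (u : R) : is_derive u (1 : R) (fun u : R => u * t) t.
    have -> : (fun u : R => u * t) = t \*: (id : R -> R).
      by apply/funext => s; rewrite /= mulrC.
    by apply: is_derive_eq; rewrite [LHS]mulr1.
  have c1 : cont01 (fun u => P (u * t) p + u * (t * dt P (u * t) p)).
    move=> u _; apply: (cvgD (cu _ u (cP _))).
    apply: (cvgM cvg_id); apply: (cvgM (cvg_cst t)); exact: cu _ u (cdP _).
  have d1 (u : R) : 0 <= u <= 1 ->
      is_derive u (1 : R) (fun u : R => u * P (u * t) p) (P (u * t) p + u * (t * dt P (u * t) p)).
    move=> _.
    have d1 := @is_derive1_comp R (P^~ p) (fun u => u * t) u _ _ (dP (u * t)) (dut u).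
    have [d2 v2] := is_deriveM (is_derive_id u (1 : R)) d1.
    apply: DeriveDef; first exact: d2.
    rewrite v2 /GRing.scale /=; lra.
  by rewrite (int01_ftc c1 d1) !mul1r mul0r subr0.
have [c Ac cp] := chart_at p.
suff E : dt (primitive P) t p = P t p by rewrite -E.
rewrite -[RHS]key /dt.
pose Q (w : 'rV[R]_(1 + 1)) := (rsubmx w 0 0) * P (lsubmx w 0 0 * rsubmx w 0 0) p.
pose phi (w : 'rV[R]_(1 + 1)) : 'rV[R]_(1 + n) :=
  tx (lsubmx w 0 0 * rsubmx w 0 0) (cmap c p).
have oT : open [set: 'rV[R]_(1 + 1)] := openT.
have sl := @smooth_on_tx_l R 1 setT oT.
have sr := @smooth_on_tx_r R 1 setT 0 oT.
have sQ : smooth_on setT Q.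
  apply: (smooth_onM oT sr).
  apply: (smooth_on_eq oT (f := lift P c \o phi)).
    by move=> w _; rewrite /= lift_tx (cmapK Ac cp).
  apply: (smooth_on_comp oT (toset Ac) (sP c Ac)).
    move=> j; case: (splitP j) => i ji.
      have -> : j = lshift n i by apply/val_inj.
      under eq_fun do rewrite tx_lshift.
      exact: (smooth_onM oT sl sr).
    have -> : j = rshift 1 i by apply/val_inj.
    by under eq_fun do rewrite tx_rshift; exact: smooth_on_cst.
  by move=> w _; rewrite /tset /phi /= tx_r; exact: cimg_cmap.
have [sJ dJ] := smooth_on_int01 oT (@openT 'rV[R]_1) sQ (fun _ _ _ _ => Logic.I).
pose x0 : 'rV[R]_1 := 0.
have lineE s : primitive P s p = int01 (fun u => Q (tx u (x0 + s *: delta_mx 0 0))).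
  rewrite primE; apply: int01_eq => u _; rewrite /Q tx_l tx_r.
  by rewrite !mxE /= mulr1 add0r.
have -> : (fun s => primitive P s p) = (fun s => int01 (fun u => Q (tx u (x0 + s *: delta_mx 0 0)))).
  by apply/funext => s; exact: lineE.
have dl := smooth_on_derivable (0 : 'I_1) sJ (Logic.I : [set: 'rV[R]_1] (x0 + t *: delta_mx 0 0)).
have [_ ->] := is_derive_line dl.
rewrite (dJ 0 _ Logic.I); apply: int01_eq => u _.
have dq := smooth_on_derivable (rshift 1 (0 : 'I_1)) sQ (Logic.I : setT (tx u (x0 + t *: delta_mx 0 0))).
have [d1 v1] := is_derive_tx_r dq.
rewrite -v1.
have dl2 : derivable (fun x : 'rV[R]_1 => Q (tx u x)) (x0 + t *: delta_mx 0 0) (delta_mx 0 0) := d1.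
have [_ <-] := is_derive_line dl2.
have -> : (fun s => Q (tx u (x0 + s *: delta_mx 0 0))) = (fun s => s * P (u * s) p).
  by apply/funext => s; rewrite /Q tx_l tx_r !mxE /= mulr1 add0r.
have dus : is_derive t (1 : R) (fun s : R => u * s) u.
  have -> : (fun s : R => u * s) = u \*: (id : R -> R) by apply/funext => s.
  by apply: is_derive_eq; rewrite [LHS]mulr1.
have d2 := @is_derive1_comp R (P^~ p) (fun s => u * s) t _ _ (dP (u * t)) dus.
have [_ ->] := is_deriveM (is_derive_id t (1 : R)) d2.
rewrite /GRing.scale /= mulr1 addrC; congr (_ + _); rewrite /dt; lra.
Qed.

End Families.

(** * Tangent vectors and forms *)

Lemma int01_sum (R : realType) (I : Type) (r : seq I) (F : I -> R -> R) :
  (forall i, cont01 (F i)) ->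
  cont01 (fun t => \sum_(i <- r) F i t) /\
  int01 (fun t => \sum_(i <- r) F i t) = \sum_(i <- r) int01 (F i).
Proof.
move=> cF; elim: r => [|i r [cr IH]].
  under eq_fun do rewrite big_nil; split; first exact: cont01_cst.
  by rewrite big_nil int01_cst.
have E : (fun t => \sum_(j <- i :: r) F j t) =
    (fun t => F i t - (-1) * \sum_(j <- r) F j t).
  by apply/funext => t; rewrite big_cons mulN1r opprK.
have cm : cont01 (fun t => (-1) * \sum_(j <- r) F j t).
  by apply: cont01M => //; exact: cont01_cst.
rewrite E; split; first exact: cont01B (cF i) cm.
by rewrite (int01B (cF i) cm) (int01Z _ cr) mulN1r opprK IH big_cons.
Qed.

(** Integrating the derivative of f along the segment from x0 to x gives the decomposition; the
    coefficients are integrals over [0, 1] of partial derivatives, hence smooth in x. *)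
Lemma hadamard (R : realType) n (U : set 'rV[R]_n) (f : 'rV[R]_n -> R) x0 :
  open U -> smooth_on U f -> U x0 ->
  exists (V : set 'rV[R]_n) (G : 'I_n -> 'rV[R]_n -> R),
    [/\ open V /\ V x0, V `<=` U, forall i, smooth_on V (G i),
      forall x, V x -> f x = f x0 + \sum_i (x 0 i - x0 0 i) * G i x &
      forall i, G i x0 = 'D_(delta_mx 0 i) f x0].
Proof.
move=> oU sf Ux0.
have lineE (a c d : 'rV[R]_n) b j : (a + b *: (c - d)) 0 j = a 0 j + b * (c 0 j - d 0 j).
  by rewrite !mxE.
have /nbhs_ballP[r /= r0 xr] : nbhs x0 U by exact: open_near.
pose V := ball x0 r; have oV : open V by exact: ball_open.
pose phi (z : 'rV[R]_(1 + n)) : 'rV[R]_n := x0 + lsubmx z 0 0 *: (rsubmx z - x0).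
have sphi j : smooth_on setT (fun z => phi z 0 j).
  have oT := @openT 'rV[R]_(1 + n).
  have -> : (fun z => phi z 0 j) =
      (fun z : 'rV[R]_(1 + n) => x0 0 j + lsubmx z 0 0 * (rsubmx z 0 j - x0 0 j)).
    by apply/funext => z; exact: lineE.
  apply: (smooth_onD oT (smooth_on_cst oT _)); apply: (smooth_onM oT (smooth_on_tx_l oT)).
  exact: (smooth_onB oT (smooth_on_tx_r j oT) (smooth_on_cst oT _)).
pose W := setT `&` phi @^-1` U.
have oW : open W.
  apply: (open_preim openT _ oU) => z _; apply: continuous_rV => j.
  exact: smooth_on_cont (sphi j) Logic.I.
have segU (t : R) x : 0 <= t <= 1 -> V x -> U (x0 + t *: (x - x0)).
  move=> /andP[t0 t1]; rewrite /V -ball_normE /ball_ /= distrC => xV.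
  apply: xr; rewrite -ball_normE /ball_ /= opprD addNKr normrN normrZ ger0_norm//.
  by apply: le_lt_trans xV; rewrite ler_piMl.
have WV (t : R) x : 0 <= t <= 1 -> V x -> W (tx t x).
  by move=> t01 Vx; split => //; rewrite /= /phi tx_l tx_r; exact: segU.
have ct (x : 'rV[R]_n) (t : R) : {for t, continuous (fun t : R => tx t x)}.
  have c1 : (s, x) @[s --> t] --> (t, x) by exact: (cvg_pair cvg_id (cvg_cst x)).
  by exact: (cvg_comp _ _ c1 (tx_cvg (t := t) (x := x))).
pose Df i := 'D_(delta_mx 0 i) f.
have sDf i : smooth_on W (Df i \o phi).
  apply: (smooth_on_comp oW oU (smooth_on_D i sf)).
    by move=> j; apply: smooth_on_sub (sphi j).
  by move=> z [].
pose G i x := int01 (fun t => (Df i \o phi) (tx t x)).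
exists V, G; split.
- by split => //; exact: ballxx.
- exact: xr.
- by move=> i; have [] := smooth_on_int01 oW oV (sDf i) WV.
- move=> x Vx.
  have phiE t : phi (tx t x) = x0 + t *: (x - x0) by rewrite /phi tx_l tx_r.
  have cG i : cont01 (fun t => (x 0 i - x0 0 i) * (Df i \o phi) (tx t x)).
    apply: cont01M; first exact: cont01_cst.
    by move=> t t01; exact: (continuous_comp (ct x t) (smooth_on_cont (sDf i) (WV t x t01 Vx))).
  have [cS iS] := int01_sum (index_enum 'I_n) cG.
  have dS (t : R) : 0 <= t <= 1 -> is_derive t (1 : R) (fun t => f (x0 + t *: (x - x0)))
      (\sum_i (x 0 i - x0 0 i) * (Df i \o phi) (tx t x)).
    move=> t01; have [df cf] := smooth_on_c1 oU sf (segU t x t01 Vx).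
    have dl i : is_derive t (1 : R) (fun t : R => (x0 + t *: (x - x0)) 0 i) (x 0 i - x0 0 i).
      have -> : (fun t : R => (x0 + t *: (x - x0)) 0 i) =
          cst (x0 0 i) + ((x 0 i - x0 0 i) \*: (id : R -> R)).
        by apply/funext => s; rewrite lineE mulrC.
      have := is_deriveD (is_derive_cst (x0 0 i) t (1 : R)) (is_deriveZ (x 0 i - x0 0 i) (is_derive_id t (1 : R))).
      by rewrite add0r /GRing.scale /= mulr1.
    have dd i : derivable (fun t : R => (x0 + t *: (x - x0)) 0 i) t (1 : R) by have [] := dl i.
    have d1 := @chain_rule R n _ f (fun t : R => x0 + t *: (x - x0)) t 1 df cf dd.
    apply: is_derive_eq d1 _; apply: eq_bigr => i _; rewrite (@derive_val _ _ _ _ _ _ _ (dl i)).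
    by rewrite /Df /= phiE.
  have := int01_ftc cS dS; rewrite iS scale0r addr0 scale1r [x0 + _]addrC subrK => E.
  rewrite -[LHS](subrK (f x0)) -E addrC; congr (_ + _); apply: eq_bigr => i _.
  rewrite int01Z// => t t01.
  exact: (continuous_comp (ct x t) (smooth_on_cont (sDf i) (WV t x t01 Vx))).
- move=> i; rewrite /G -[RHS]int01_cst; apply: int01_eq => t _.
  by rewrite /= /phi tx_r subrr scaler0 addr0.
Qed.

(** * Derivations and coordinate frames *)

Section Tangent.
Variables (R : realType) (n : nat) (M : manifold R n).
Implicit Types (p q : M) (v w : functional M) (f g : M -> R).

Section Derivation.
Variables (p : M) (v : functional M).
Hypothesis Tv : tangent p v.

Lemma tan0 : v (fun=> 0) = 0.
Proof.
have [_ L _] := Tv; have s0 : smooth_fun (fun _ : M => 0 : R) by apply: sfun_cst openT _.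
have := L 1 _ _ s0 s0; have -> : (fun x : M => 1 * 0 + 0) = (fun=> 0 : R).
  by apply/funext => x; rewrite mulr0 addr0.
by rewrite mul1r => /eqP; rewrite -subr_eq0 opprD addrA subrr sub0r oppr_eq0 => /eqP.
Qed.

Lemma tanD f g : smooth_fun f -> smooth_fun g -> v (fun x => f x + g x) = v f + v g.
Proof.
move=> sf sg; have [_ L _] := Tv; have := L 1 _ _ sf sg; rewrite mul1r => <-.
by congr v; apply/funext => x; rewrite mul1r.
Qed.

Lemma tanZ a f : smooth_fun f -> v (fun x => a * f x) = a * v f.
Proof.
move=> sf; have [_ L _] := Tv; have s0 : smooth_fun (fun _ : M => 0 : R) by apply: sfun_cst openT _.
rewrite -[RHS]addr0 -tan0 -L//; congr v; apply/funext => x; by rewrite addr0.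
Qed.

Lemma tanM f g : smooth_fun f -> smooth_fun g ->
  v (fun x => f x * g x) = v f * g p + f p * v g.
Proof. by have [_ _ L] := Tv; exact: L. Qed.

Lemma tanB f g : smooth_fun f -> smooth_fun g -> v (fun x => f x - g x) = v f - v g.
Proof.
move=> sf sg; have -> : (fun x => f x - g x) = (fun x => f x + (-1) * g x).
  by apply/funext => x; rewrite mulN1r.
have sm : smooth_fun (fun x => (-1) * g x) by apply: (sfunM openT (sfun_cst openT _) sg).
by rewrite (tanD sf sm) (tanZ _ sg) mulN1r.
Qed.

Lemma tan_cst a : v (fun=> a) = 0.
Proof.
have s1 : smooth_fun (fun _ : M => 1 : R) by apply: sfun_cst openT _.
have v1 : v (fun=> 1) = 0.
  have := tanM s1 s1; have -> : (fun _ : M => 1 * 1) = (fun=> 1 : R) by apply/funext => x; rewrite mulr1.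
  by rewrite mulr1 mul1r => /eqP; rewrite -subr_eq0 opprD addrA subrr sub0r oppr_eq0 => /eqP.
have := tanZ a s1; rewrite v1 mulr0 => <-; congr v; apply/funext => x; by rewrite mulr1.
Qed.

Lemma tan_sum (I : Type) (r : seq I) (F : I -> M -> R) : (forall i, smooth_fun (F i)) ->
  v (fun x => \sum_(i <- r) F i x) = \sum_(i <- r) v (F i).
Proof.
move=> sF; elim: r => [|i r IH].
  by under eq_fun do rewrite big_nil; rewrite big_nil tan0.
under eq_fun do rewrite big_cons.
by rewrite (tanD (sF i) (sfun_sum openT r sF)) IH big_cons.
Qed.

(** Locality: a bump [chi] supported where f = g gives chi (f - g) = 0, and the Leibniz rule at p,
    where chi = 1 and f = g, isolates v (f - g). *)
Lemma tan_near f g : smooth_fun f -> smooth_fun g -> {near p, f =1 g} -> v f = v g.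
Proof.
move=> sf sg; rewrite /prop_near1 nbhsE; move=> [ O [ oO Op] fg].
have [c Ac cp] := chart_at p.
have [chi [F [ O1 [schi [cF FO] chi0 [ oO1 O1p] [ O1F chi1]]]]] := chart_bump Ac cp oO Op.
have sh := sfunB openT sf sg.
have := tanM schi sh; have -> : (fun x => chi x * (f x - g x)) = (fun=> 0).
  apply/funext => x; have [/FO[/fg -> _]|/chi0 ->] := pselect (F x).
    by rewrite subrr mulr0.
  by rewrite mul0r.
have -> : f p - g p = 0 by rewrite fg ?subrr.
rewrite tan0 mulr0 add0r (chi1 _ O1p) mul1r (tanB sf sg) => /esym/eqP.
by rewrite subr_eq0 => /eqP.
Qed.

Lemma tan_nonsmooth f : ~ smooth_fun f -> v f = 0.
Proof. by have [H _ _] := Tv; exact: H. Qed.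

End Derivation.

Lemma tangent_comb (I : finType) p (a : I -> R) (v : I -> functional M) :
  (forall i, tangent p (v i)) -> tangent p (fun f => \sum_i a i * v i f).
Proof.
move=> Tv; split=> [f nf|c f g sf sg|f g sf sg].
- by rewrite big1// => i _; rewrite (tan_nonsmooth (Tv i) nf) mulr0.
- rewrite mulr_sumr -big_split /=; apply: eq_bigr => i _.
  have [_ -> // _] := Tv i; by rewrite mulrDr !mulrA [c * _]mulrC.
- rewrite mulr_suml mulr_sumr -big_split /=; apply: eq_bigr => i _.
  by rewrite (tanM (Tv i) sf sg) mulrDr mulrA [f p * (_ * _)]mulrCA.
Qed.

Lemma tangent_lin p a v w : tangent p v -> tangent p w -> tangent p (fun f => a * v f + w f).
Proof.
move=> Tv Tw; split=> [f nf|c f g sf sg|f g sf sg].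
- by rewrite (tan_nonsmooth Tv nf) (tan_nonsmooth Tw nf) mulr0 addr0.
- by have [_ -> // _] := Tv; have [_ -> // _] := Tw; lra.
- by rewrite (tanM Tv sf sg) (tanM Tw sf sg); lra.
Qed.

Lemma tangent_zero p : tangent p (fun _ : M -> R => 0 : R).
Proof.
split=> [//|a f g _ _|f g _ _]; first by rewrite mulr0 addr0.
by rewrite mul0r mulr0 addr0.
Qed.

(** Coordinate functions and coordinate fields multiplied by a bump, so that they exist globally as
    [tangent] and [vector_field] demand. On [co_dom] the bump is 1 and they are the coordinates of
    the chart. *)
Record coords := Coords {
  co_chart : chart R n M;
  co_fun : 'I_n -> M -> R;
  co_field : 'I_n -> M -> functional M;
  co_dom : set M;
  co_atlas : atlas M co_chart;
  co_smooth : forall i, smooth_fun (co_fun i);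
  co_open : open co_dom;
  co_sub : co_dom `<=` cdom co_chart;
  co_funE : forall i q, co_dom q -> co_fun i q = cmap co_chart q 0 i;
  co_vf : forall i, vector_field (co_field i);
  co_fieldE : forall i q f, co_dom q -> smooth_fun f ->
    co_field i q f = 'D_(delta_mx 0 i) (f \o cinv co_chart) (cmap co_chart q)
}.

Lemma coords_at p : exists K : coords, co_dom K p.
Proof.
have [c Ac cp] := chart_at p.
have [chi [F [ O1 [schi [cF FO] chi0 [ oO1 O1p] [ O1F chi1]]]]] := chart_bump Ac cp openT Logic.I.
have Fc : F `<=` cdom c by move=> q /FO[].
have oc := cdom_open Ac; have oi := cimg_open Ac.
have bsm f : smooth_fun_on (cdom c) f -> smooth_fun (fun q => chi q * f q).
  exact: (bump_mul_smooth schi cF oc Fc chi0).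
pose X i q := chi q * cmap c q 0 i.
have sX i : smooth_fun (X i).
  apply: bsm; apply: (@smooth_fun_on_chart _ _ _ c _ setT (fun x => x 0 i)) => //.
  - exact: openT.
  - exact: smooth_on_coord openT.
pose E i q f := if `[< smooth_fun f >] then
  chi q * 'D_(delta_mx 0 i) (f \o cinv c) (cmap c q) else 0.
have EE i q f : smooth_fun f -> E i q f = chi q * 'D_(delta_mx 0 i) (f \o cinv c) (cmap c q).
  by rewrite /E; case: asboolP => // nf /nf.
have dE i q f : smooth_fun f -> cdom c q -> derivable (f \o cinv c) (cmap c q) (delta_mx 0 i).
  by move=> sf cq; exact: smooth_on_derivable (smooth_fun_img sf Ac) (cimg_cmap cq).
have TE i q : tangent q (E i q).
  split=> [f nf|a f g sf sg|f g sf sg].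
  - by rewrite /E; case: asboolP.
  - have sfg : smooth_fun (fun x => a * f x + g x).
      exact: (sfunD openT (sfunM openT (sfun_cst openT a) sf) sg).
    rewrite (EE i q _ sfg) (EE i q _ sf) (EE i q _ sg).
    have [Fq|/chi0 ->] := pselect (F q); last by rewrite !mul0r mulr0 addr0.
    have df := dE i q f sf (Fc _ Fq); have dg := dE i q g sg (Fc _ Fq).
    have -> : (fun x => a * f x + g x) \o cinv c = a \*: (f \o cinv c) + (g \o cinv c).
      by apply/funext.
    rewrite (deriveD (derivableZ (k := a) df) dg) (deriveZ a df) /GRing.scale /=.
    by rewrite mulrDr mulrCA.
  - have sfg : smooth_fun (fun x => f x * g x) by exact: (sfunM openT sf sg).
    rewrite (EE i q _ sfg) (EE i q _ sf) (EE i q _ sg).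
    have [Fq|/chi0 ->] := pselect (F q); last by rewrite !mul0r mulr0 addr0.
    have df := dE i q f sf (Fc _ Fq); have dg := dE i q g sg (Fc _ Fq).
    have -> : (fun x => f x * g x) \o cinv c = (f \o cinv c) * (g \o cinv c).
      by apply/funext.
    rewrite (deriveM df dg) /= (cmapK Ac (Fc _ Fq)) /GRing.scale /=.
    by rewrite mulrDr addrC; congr (_ + _); [rewrite mulrCA mulrC|rewrite mulrCA].
have sE i : vector_field (E i).
  split; first exact: TE.
  move=> f sf; have -> : (fun q => E i q f) =
    (fun q => chi q * 'D_(delta_mx 0 i) (f \o cinv c) (cmap c q)) by apply/funext => q; exact: EE.
  apply: bsm.
  apply: (@smooth_fun_on_chart _ _ _ c _ (cimg c) ('D_(delta_mx 0 i) (f \o cinv c))) => //.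
  - exact: smooth_on_D (smooth_fun_img sf Ac).
  - by move=> q; exact: cimg_cmap.
have X1 i q : O1 q -> X i q = cmap c q 0 i by move=> /chi1 Hq; rewrite /X Hq mul1r.
have E1 i q f : O1 q -> smooth_fun f -> E i q f = 'D_(delta_mx 0 i) (f \o cinv c) (cmap c q).
  by move=> /chi1 Hq sf; rewrite (EE i q f sf) Hq mul1r.
by exists (Coords Ac sX oO1 (subset_trans O1F Fc) X1 sE E1).
Qed.

Section InCoords.
Variable K : coords.
Local Notation c := (co_chart K).
Local Notation X := (co_fun K).
Local Notation E := (co_field K).

(** By Hadamard's lemma f is, near q, a constant plus products whose first factors vanish at q; on
    such a product a derivation only sees the first factor. *)
Lemma tan_formula q v f : co_dom K q -> tangent q v -> smooth_fun f ->
  v f = \sum_i v (X i) * 'D_(delta_mx 0 i) (f \o cinv c) (cmap c q).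
Proof.
move=> Oq Tv sf.
have Ac := co_atlas K; have cq := co_sub Oq.
have [V [G [[ oV Vq] VU sG fG G0]]] := hadamard (cimg_open Ac) (smooth_fun_img sf Ac) (cimg_cmap cq).
pose O2 := cdom c `&` cmap c @^-1` V.
have oO2 : open O2.
  by apply: (open_preim (cdom_open Ac) _ oV) => x; exact: cmap_cont Ac.
have [chi [F [ O1 [schi [cF FO] chi0 [ oO1 O1q] [ O1F chi1]]]]] := chart_bump Ac cq oO2 (conj cq Vq).
have FO2 : F `<=` O2 by move=> x /FO[].
pose Gm i x := chi x * G i (cmap c x).
have sGm i : smooth_fun (Gm i).
  apply: (bump_mul_smooth schi cF oO2 FO2 chi0 (f := fun x => G i (cmap c x))).
  apply: (@smooth_fun_on_chart _ _ _ c _ V (G i)) => //.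
  - by move=> x [].
  - by move=> x [].
have sXc i : smooth_fun (fun x => X i x - cmap c q 0 i).
  exact: (sfunB openT (@co_smooth K i) (sfun_cst openT _)).
have sXG i : smooth_fun (fun x => (X i x - cmap c q 0 i) * Gm i x).
  exact: (sfunM openT (sXc i) (sGm i)).
have sS := sfun_sum openT (index_enum _) sXG.
rewrite (tan_near Tv sf (g := fun x => f q + \sum_i (X i x - cmap c q 0 i) * Gm i x)).
- rewrite (tanD Tv (sfun_cst openT _) sS) (tan_cst Tv) add0r (tan_sum Tv _ sXG).
  apply: eq_bigr => i _.
  rewrite (tanM Tv (sXc i) (sGm i)) (tanB Tv (@co_smooth K i) (sfun_cst openT _)) (tan_cst Tv) subr0.
  rewrite (co_funE _ Oq) subrr mul0r addr0 /Gm (chi1 _ O1q) mul1r G0.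
  reflexivity.
- exact: (sfunD openT (sfun_cst openT _) sS).
- apply: filterS (open_nbhs_nbhs (conj (openI oO1 (co_open K)) (conj O1q Oq))) => x [ O1x Ox].
  have [cx Vx] := FO2 _ (O1F _ O1x).
  have := fG _ Vx; rewrite /= (cmapK Ac cx) (cmapK Ac cq) => ->; congr (_ + _).
  by apply: eq_bigr => i _; rewrite (co_funE _ Ox) /Gm (chi1 _ O1x) mul1r.
Qed.

Lemma tan_frame q v : co_dom K q -> tangent q v ->
  v = (fun f => \sum_i v (X i) * E i q f).
Proof.
move=> Oq Tv; apply/funext => f; have [sf|nf] := pselect (smooth_fun f).
  by rewrite (tan_formula Oq Tv sf); apply: eq_bigr => i _; rewrite (co_fieldE _ Oq sf).
rewrite (tan_nonsmooth Tv nf) big1// => i _.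
by have [TE _] := @co_vf K i; rewrite (tan_nonsmooth (TE q) nf) mulr0.
Qed.

Lemma tan_eq q v w : co_dom K q -> tangent q v -> tangent q w ->
  (forall i, v (X i) = w (X i)) -> v = w.
Proof.
move=> Oq Tv Tw vw; rewrite (tan_frame Oq Tv) (tan_frame Oq Tw).
by apply/funext => f; apply: eq_bigr => i _; rewrite vw.
Qed.

Lemma frame_dual q i j : co_dom K q -> E i q (X j) = (i == j)%:R.
Proof.
move=> Oq; rewrite (co_fieldE _ Oq (@co_smooth K j)).
have Ac := co_atlas K; have cq := co_sub Oq.
have [_ <-] := @derive_coord R n j i (cmap c q).
apply: near_eq_derive.
have o1 : open (cimg c `&` cinv c @^-1` co_dom K).
  by apply: (open_preim (cimg_open Ac) _ (co_open K)) => x; exact: cinv_cont Ac.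
have o1q : (cimg c `&` cinv c @^-1` co_dom K) (cmap c q).
  by split; [exact: cimg_cmap|rewrite /= (cmapK Ac cq)].
apply: filterS (open_near o1 o1q) => x [cx Ox].
by rewrite /= (co_funE _ Ox); have [_ ->] := cinvP Ac cx.
Qed.

End InCoords.

Lemma tan_lift_D (P : R -> M -> R) K p (s : R) i : co_dom K p -> smoothRM P ->
  'D_(delta_mx 0 i) (P s \o cinv (co_chart K)) (cmap (co_chart K) p) =
  'D_(e1 R i) (lift P (co_chart K)) (tx s (cmap (co_chart K) p)).
Proof.
move=> Op sP; have Ac := co_atlas K; have cp := co_sub Op.
have cz : tset (cimg (co_chart K)) (tx s (cmap (co_chart K) p)).
  by rewrite /tset /= tx_r; exact: cimg_cmap.
have [_ <-] := is_derive_tx_r (smooth_on_derivable (rshift 1 i) (sP _ Ac) cz).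
by congr ('D__ _ _); apply/funext => x; rewrite lift_tx.
Qed.

(** A tangent vector of [M] commutes with the time derivative, by the symmetry of second derivatives
    in the coordinates (t, x). *)
Lemma tan_dt (P : R -> M -> R) p w (s : R) : smoothRM P -> tangent p w ->
  is_derive s (1 : R) (fun s => w (P s)) (w (dt P s)).
Proof.
move=> sP Tw; have [K Kp] := coords_at p.
have Ac := co_atlas K; have cp := co_sub Kp.
pose L := lift P (co_chart K); pose x0 := cmap (co_chart K) p.
have cz : tset (cimg (co_chart K)) (tx s x0) by rewrite /tset /= tx_r; exact: cimg_cmap.
have E1 : (fun s => w (P s)) = (fun s => \sum_i w (co_fun K i) * 'D_(e1 R i) L (tx s x0)).
  apply/funext => t; rewrite (tan_formula Kp Tw (rm_fix t sP)).
  by apply: eq_bigr => i _; rewrite (tan_lift_D _ _ Kp sP).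
have E2 : w (dt P s) = \sum_i w (co_fun K i) * 'D_(e0 R n) ('D_(e1 R i) L) (tx s x0).
  rewrite (tan_formula Kp Tw (rm_fix s (rm_dt sP))); apply: eq_bigr => i _; congr (_ * _).
  rewrite (tan_lift_D _ _ Kp (rm_dt sP)).
  rewrite (schwarz (lshift n 0) (rshift 1 i) (toset Ac) (sP _ Ac) cz).
  apply: near_eq_derive; apply: filterS (open_near (toset Ac) cz) => z cz'.
  by rewrite /lift (rm_dtE _ sP Ac cz') tx_id.
rewrite E1 E2.
have dS i : is_derive s (1 : R) (fun s => w (co_fun K i) * 'D_(e1 R i) L (tx s x0))
    (w (co_fun K i) * 'D_(e0 R n) ('D_(e1 R i) L) (tx s x0)).
  have d1 := is_derive_tx_l (smooth_on_derivable (lshift n 0) (smooth_on_D (rshift 1 i) (sP _ Ac)) cz).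
  exact: (is_deriveZ (w (co_fun K i)) d1).
have := is_derive_sum dS; congr (is_derive _ _ _ _).
by apply/funext => t; rewrite fct_sumE.
Qed.

Lemma tan_reparam (P : R -> M -> R) g p w : smoothRM P -> smooth_fun g -> tangent p w ->
  w (fun q => P (g q) q) = w (P (g p)) + dt P (g p) p * w g.
Proof.
move=> sP sg Tw; have [K Kp] := coords_at p.
have Ac := co_atlas K; have cp := co_sub Kp.
set c := co_chart K in Ac cp *; pose x0 := cmap c p; pose L := lift P c.
have cz : tset (cimg c) (tx (g p) x0) by rewrite /tset /= tx_r; exact: cimg_cmap.
have sPg : smooth_fun (fun q => P (g q) q).
  exact: (rm_fix 0 (rm_reparam sP (rm_const sg))).
rewrite (tan_formula Kp Tw sPg) (tan_formula Kp Tw sg) (tan_formula Kp Tw (rm_fix (g p) sP)).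
rewrite mulr_sumr -big_split /=; apply: eq_bigr => i _.
rewrite mulrCA -mulrDr; congr (_ * _).
pose Gm (x : 'rV[R]_n) := tx (g (cinv c x)) x.
have Gm0 : Gm x0 = tx (g p) x0 by rewrite /Gm (cmapK Ac cp).
have dg : derivable (g \o cinv c) x0 (delta_mx 0 i).
  exact: smooth_on_derivable (smooth_fun_img sg Ac) (cimg_cmap cp).
have dG0 (k : 'I_1) : (fun y => Gm y 0 (lshift n k)) = g \o cinv c.
  by apply/funext => y; rewrite tx_lshift.
have dG1 k : (fun y => Gm y 0 (rshift 1 k)) = (fun y => y 0 k).
  by apply/funext => y; rewrite tx_rshift.
have dG j : derivable (fun y => Gm y 0 j) x0 (delta_mx 0 i).
  case: (splitP j) => k jk.
    by have -> : j = lshift n k by [apply/val_inj]; rewrite dG0.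
  have -> : j = rshift 1 k by apply/val_inj.
  by rewrite dG1; have [] := derive_coord k i x0.
have [dL cL] := smooth_on_c1 (toset Ac) (sP _ Ac) cz.
rewrite -Gm0 in dL cL.
have [_ E] := chain_rule dL cL dG.
have -> : (fun q => P (g q) q) \o cinv c = L \o Gm.
  by apply/funext => x; rewrite /= /L lift_tx.
rewrite E big_split_ord /= big_ord1 dG0 Gm0 addrC; congr (_ + _); last first.
  rewrite mulrC; congr (_ * _).
  by have := rm_dtE (g p) sP Ac (cimg_cmap cp); rewrite (cmapK Ac cp) => ->.
rewrite (tan_lift_D _ _ Kp sP) (bigD1 i)//= dG1.
have [_ ->] := derive_coord i i x0; rewrite eqxx mul1r big1 ?addr0// => j ji.
rewrite dG1; have [_ ->] := derive_coord j i x0.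
by rewrite eq_sym (negbTE ji) mul0r.
Qed.

End Tangent.

(** * One-forms and the exterior derivative in coordinates *)

Section Forms.
Variables (R : realType) (n : nat) (M : manifold R n).
Implicit Types (p q : M) (v w : functional M) (f : M -> R) (X Y : M -> functional M).

Lemma bracket_tangent X Y p : vector_field X -> vector_field Y -> tangent p (bracket X Y p).
Proof.
move=> [TX sX] [TY sY]; rewrite /bracket; split=> [f nf|a f g sf sg|f g sf sg].
- have -> : (fun q => Y q f) = (fun=> 0) by apply/funext => q; rewrite (tan_nonsmooth (TY q) nf).
  have -> : (fun q => X q f) = (fun=> 0) by apply/funext => q; rewrite (tan_nonsmooth (TX q) nf).
  by rewrite (tan0 (TX p)) (tan0 (TY p)) subrr.
- have L Z q : tangent q (Z q) -> Z q (fun x => a * f x + g x) = a * Z q f + Z q g.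
    by move=> [_ H _]; exact: H.
  have -> : (fun q => Y q (fun x => a * f x + g x)) = (fun q => a * Y q f + Y q g).
    by apply/funext => q; exact: L.
  have -> : (fun q => X q (fun x => a * f x + g x)) = (fun q => a * X q f + X q g).
    by apply/funext => q; exact: L.
  have [_ LX _] := TX p; have [_ LY _] := TY p.
  rewrite (LX a _ _ (sY f sf) (sY g sg)) (LY a _ _ (sX f sf) (sX g sg)); lra.
- have -> : (fun q => Y q (fun x => f x * g x)) = (fun q => Y q f * g q + f q * Y q g).
    by apply/funext => q; rewrite (tanM (TY q) sf sg).
  have -> : (fun q => X q (fun x => f x * g x)) = (fun q => X q f * g q + f q * X q g).
    by apply/funext => q; rewrite (tanM (TX q) sf sg).
  rewrite (tanD (TX p) (sfunM openT (sY f sf) sg) (sfunM openT sf (sY g sg))).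
  rewrite (tanD (TY p) (sfunM openT (sX f sf) sg) (sfunM openT sf (sX g sg))).
  rewrite (tanM (TX p) (sY f sf) sg) (tanM (TX p) sf (sY g sg)).
  rewrite (tanM (TY p) (sX f sf) sg) (tanM (TY p) sf (sX g sg)); lra.
Qed.

Lemma comb_vf (I : finType) (a : I -> R) (X : I -> M -> functional M) :
  (forall i, vector_field (X i)) -> vector_field (fun q f => \sum_i a i * X i q f).
Proof.
move=> vX; split=> [p|f sf]; first by apply: tangent_comb => i; have [T _] := vX i.
apply: (sfun_sum openT) => i; apply: (sfunM openT (sfun_cst openT _)).
by have [_ S] := vX i; exact: S.
Qed.

Lemma extensionP p v : tangent p v ->
  vector_field (extension p v) /\ extension p v p = v.
Proof.
move=> Tv; have [K Kp] := coords_at p.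
have vE := @co_vf _ _ _ K.
apply: (@xgetPex _ (fun _ _ => 0) [set X | vector_field X /\ X p = v]).
exists (fun q f => \sum_i v (co_fun K i) * co_field K i q f).
by split; [exact: comb_vf|rewrite [RHS](tan_frame Kp Tv)].
Qed.

Variable eta : M -> functional M -> R.
Hypothesis eta1 : one_form eta.

Lemma form0 p : eta p (fun=> 0) = 0.
Proof.
have [L _] := eta1; have := L p 1 _ _ (tangent_zero p) (tangent_zero p).
have -> : (fun _ : M -> R => 1 * 0 + 0) = (fun=> 0 : R) by apply/funext => f; rewrite mulr0 addr0.
by rewrite mul1r => /eqP; rewrite -subr_eq0 opprD addrA subrr sub0r oppr_eq0 => /eqP.
Qed.

Lemma formZ p a v : tangent p v -> eta p (fun f => a * v f) = a * eta p v.
Proof.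
move=> Tv; have [L _] := eta1; have := L p a _ _ Tv (tangent_zero p).
have -> : (fun f => a * v f + 0) = (fun f => a * v f) by apply/funext => f; rewrite addr0.
by rewrite form0 addr0.
Qed.

Lemma form_comb (I : finType) p (a : I -> R) (v : I -> functional M) :
  (forall i, tangent p (v i)) ->
  eta p (fun f => \sum_i a i * v i f) = \sum_i a i * eta p (v i).
Proof.
move=> Tv; have [L _] := eta1.
suff H (r : seq I) : tangent p (fun f => \sum_(i <- r) a i * v i f) /\
   eta p (fun f => \sum_(i <- r) a i * v i f) = \sum_(i <- r) a i * eta p (v i).
  by have [_ ->] := H (index_enum I).
elim: r => [|i r [Tr IH]].
  have -> : (fun f => \sum_(i <- [::]) a i * v i f) = (fun=> 0) by apply/funext => f; rewrite big_nil.
  by rewrite big_nil form0; split => //; exact: tangent_zero.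
have -> : (fun f => \sum_(j <- i :: r) a j * v j f) =
    (fun f => a i * v i f + \sum_(j <- r) a j * v j f) by apply/funext => f; rewrite big_cons.
by split; [exact: tangent_lin|rewrite (L p _ _ _ (Tv i) Tr) IH big_cons].
Qed.

Definition form_coef (K : coords M) j q := eta q (co_field K j q).

Lemma form_coef_smooth K j : smooth_fun (form_coef K j).
Proof. by have [_ H] := eta1; exact: H (@co_vf _ _ _ K j). Qed.

Lemma form_coord (K : coords M) p v : co_dom K p -> tangent p v ->
  eta p v = \sum_j v (co_fun K j) * form_coef K j p.
Proof.
move=> Kp Tv; rewrite {1}(tan_frame Kp Tv) form_comb// => i.
by have [T _] := @co_vf _ _ _ K i; exact: T.
Qed.

Lemma form_deriv (K : coords M) p v Y : co_dom K p -> tangent p v -> vector_field Y ->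
  v (fun q => eta q (Y q)) =
  \sum_j (v (fun q => Y q (co_fun K j)) * form_coef K j p
          + Y p (co_fun K j) * v (form_coef K j)).
Proof.
move=> Kp Tv vY; have [TY sY] := vY; have [_ sm] := eta1.
have sj j : smooth_fun (fun q => Y q (co_fun K j)) by exact: sY (@co_smooth _ _ _ K j).
have sf j : smooth_fun (fun q => Y q (co_fun K j) * form_coef K j q).
  exact: (sfunM openT (sj j) (form_coef_smooth K j)).
rewrite (tan_near Tv (sm Y vY) (sfun_sum openT (index_enum _) sf)).
  rewrite (tan_sum Tv _ sf); apply: eq_bigr => j _.
  by rewrite (tanM Tv (sj j) (form_coef_smooth K j)).
apply: filterS (open_nbhs_nbhs (conj (co_open K) Kp)) => q Kq.
exact: (form_coord Kq (TY q)).
Qed.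

Definition dcoef (K : coords M) p i j :=
  co_field K i p (form_coef K j) - co_field K j p (form_coef K i).

(** Tensoriality: the derivatives of the components of X and Y cancel against the bracket. This
    makes [dform] independent of the extensions chosen in its definition. *)
Lemma cartan_coords (K : coords M) p X Y : co_dom K p -> vector_field X -> vector_field Y ->
  X p (fun q => eta q (Y q)) - Y p (fun q => eta q (X q)) - eta p (bracket X Y p) =
  \sum_i \sum_j X p (co_fun K i) * Y p (co_fun K j) * dcoef K p i j.
Proof.
move=> Kp vX vY; have [TX sX] := vX; have [TY sY] := vY.
rewrite (form_deriv Kp (TX p) vY) (form_deriv Kp (TY p) vX).
rewrite (form_coord Kp (bracket_tangent p vX vY)) !big_split /=.
have -> : \sum_j bracket X Y p (co_fun K j) * form_coef K j p =
    \sum_j X p (fun q => Y q (co_fun K j)) * form_coef K j p -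
    \sum_j Y p (fun q => X q (co_fun K j)) * form_coef K j p.
  by rewrite -sumrB; apply: eq_bigr => j _; rewrite /bracket mulrBl.
have exp v w : tangent p v -> \sum_j w (co_fun K j) * v (form_coef K j) =
    \sum_i \sum_j v (co_fun K i) * w (co_fun K j) * co_field K i p (form_coef K j).
  move=> Tv; rewrite exchange_big /=; apply: eq_bigr => j _.
  rewrite [v (form_coef K j)](congr1 (fun u => u (form_coef K j)) (tan_frame Kp Tv)) mulr_sumr.
  by apply: eq_bigr => i _; rewrite mulrA [w _ * _]mulrC.
rewrite (exp _ _ (TX p)) (exp _ _ (TY p)).
rewrite [X in _ - (_ + X) - _]exchange_big /=.
have -> : \sum_i \sum_j X p (co_fun K i) * Y p (co_fun K j) * dcoef K p i j =
   \sum_i \sum_j X p (co_fun K i) * Y p (co_fun K j) * co_field K i p (form_coef K j) -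
   \sum_i \sum_j Y p (co_fun K j) * X p (co_fun K i) * co_field K j p (form_coef K i).
  rewrite -sumrB; apply: eq_bigr => i _; rewrite -sumrB; apply: eq_bigr => j _.
  by rewrite /dcoef mulrBr [Y p _ * _]mulrC.
by lra.
Qed.

Lemma dform_coord (K : coords M) p v w : co_dom K p -> tangent p v -> tangent p w ->
  dform eta p v w = \sum_i \sum_j v (co_fun K i) * w (co_fun K j) * dcoef K p i j.
Proof.
move=> Kp Tv Tw; have [vX Xp] := extensionP Tv; have [vY Yp] := extensionP Tw.
by rewrite /dform (cartan_coords Kp vX vY) Xp Yp.
Qed.

Lemma dformE p X Y : vector_field X -> vector_field Y ->
  dform eta p (X p) (Y p) =
  X p (fun q => eta q (Y q)) - Y p (fun q => eta q (X q)) - eta p (bracket X Y p).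
Proof.
move=> vX vY; have [K Kp] := coords_at p.
have [TX _] := vX; have [TY _] := vY.
by rewrite (dform_coord Kp (TX p) (TY p)) (cartan_coords Kp vX vY).
Qed.

Lemma dcoefC K p i j : dcoef K p i j = - dcoef K p j i.
Proof. by rewrite /dcoef opprB. Qed.

End Forms.

(** * Invariance of d eta under strict diffeomorphisms *)

Section Naturality.
Variables (R : realType) (n : nat) (M : manifold R n).
Variable eta : M -> functional M -> R.
Hypothesis eta1 : one_form eta.
Variables (phi psi : M -> M).
Hypotheses (sphi : smooth_map phi) (spsi : smooth_map psi).
Hypotheses (phiK : cancel phi psi) (psiK : cancel psi phi).
Hypothesis strict : forall p v, tangent p v -> eta (phi p) (dmap phi v) = eta p v.

Lemma dmap_smooth m (N : manifold R m) (F : M -> N) v f : smooth_fun f -> dmap F v f = v (f \o F).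
Proof. by rewrite /dmap; case: asboolP. Qed.

Lemma dmap_nonsmooth m (N : manifold R m) (F : M -> N) v f : ~ smooth_fun f -> dmap F v f = 0.
Proof. by rewrite /dmap; case: asboolP. Qed.

Lemma dmap_tangent m (N : manifold R m) (F : M -> N) p v : smooth_map F -> tangent p v -> tangent (F p) (dmap F v).
Proof.
move=> sF Tv; split=> [f nf|a f g sf sg|f g sf sg].
- by rewrite /dmap; case: asboolP.
- have sfg := sfunD openT (sfunM openT (sfun_cst openT a) sf) sg.
  rewrite (dmap_smooth F v sfg) (dmap_smooth F v sf) (dmap_smooth F v sg).
  by have [_ L _] := Tv; have E := L a _ _ (smooth_map_comp sF sf) (smooth_map_comp sF sg); exact: E.
- have sfg := sfunM openT sf sg.
  rewrite (dmap_smooth F v sfg) (dmap_smooth F v sf) (dmap_smooth F v sg).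
  by have E := tanM Tv (smooth_map_comp sF sf) (smooth_map_comp sF sg); exact: E.
Qed.

Let push (X : M -> functional M) : M -> functional M := fun q => dmap phi (X (psi q)).

Lemma push_vf X : vector_field X -> vector_field (push X).
Proof.
move=> [TX sX]; split=> [q|f sf].
  by have := dmap_tangent sphi (TX (psi q)); rewrite psiK.
have -> : (fun q => push X q f) = (fun q => X q (f \o phi)) \o psi.
  by apply/funext => q; rewrite /push (dmap_smooth _ _ sf).
exact: smooth_map_comp spsi (sX _ (smooth_map_comp sphi sf)).
Qed.

(** The extensions are pushed forward by phi. Brackets of related fields are related, and eta is
    preserved, so the three terms of the invariant formula agree one by one. *)
Lemma dform_natural p v w : tangent p v -> tangent p w ->
  dform eta (phi p) (dmap phi v) (dmap phi w) = dform eta p v w.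
Proof.
move=> Tv Tw; have [vX Xp] := extensionP Tv; have [vY Yp] := extensionP Tw.
have [L sm] := eta1.
rewrite -{2}Xp -{2}Yp (dformE eta1 p vX vY).
set X := extension p v in vX Xp *; set Y := extension p w in vY Yp *.
have pE Z : push Z (phi p) = dmap phi (Z p) by rewrite /push phiK.
rewrite -{1}Xp -{1}Yp -(pE X) -(pE Y) (dformE eta1 _ (push_vf vX) (push_vf vY)) !pE.
have pe Z : vector_field Z -> (fun q => eta q (push Z q)) \o phi = (fun q => eta q (Z q)).
  move=> [TZ _]; apply/funext => q; rewrite /= /push phiK; exact: strict (TZ q).
rewrite (dmap_smooth _ _ (sm _ (push_vf vY))) (dmap_smooth _ _ (sm _ (push_vf vX))) (pe _ vX) (pe _ vY).
have -> : bracket (push X) (push Y) (phi p) = dmap phi (bracket X Y p).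
  apply/funext => f; have [sf|nf] := pselect (smooth_fun f); last first.
    have T := bracket_tangent (phi p) (push_vf vX) (push_vf vY).
    by rewrite (tan_nonsmooth T nf) (dmap_nonsmooth _ _ nf).
  rewrite (dmap_smooth _ _ sf) /bracket !pE.
  have [_ sY'] := push_vf vY; have [_ sX'] := push_vf vX.
  rewrite (dmap_smooth _ _ (sY' f sf)) (dmap_smooth _ _ (sX' f sf)).
  have E Z : (fun q => push Z q f) \o phi = (fun q => Z q (f \o phi)).
    by apply/funext => q; rewrite /= /push phiK (dmap_smooth _ _ sf).
  by rewrite !E.
by rewrite (strict (bracket_tangent p vX vY)).
Qed.

End Naturality.

(** * Alternating multilinear functions *)

Section Alternating.
Variables (R : realType) (m : nat).
Local Notation V := 'rV[R]_m.

Definition slot (v : 'I_m -> V) c x : 'I_m -> V := fun i => if i == c then x else v i.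

Definition multilinear (F : ('I_m -> V) -> R) := forall v c a x y,
  F (slot v c (a *: x + y)) = a * F (slot v c x) + F (slot v c y).

Lemma multilinear0 F v c : multilinear F -> F (slot v c 0) = 0.
Proof.
move=> L; have := L v c 1 0 0; rewrite scaler0 addr0 mul1r => /eqP.
by rewrite -subr_eq0 opprD addrA subrr sub0r oppr_eq0 => /eqP.
Qed.

Lemma multilinear_sum F v c (d : 'I_m -> R) (x : 'I_m -> V) : multilinear F ->
  F (slot v c (\sum_i d i *: x i)) = \sum_i d i * F (slot v c (x i)).
Proof.
move=> L; elim: (index_enum _) => [|i r IH]; first by rewrite !big_nil multilinear0.
by rewrite !big_cons L IH.
Qed.

Lemma alternating_dependent F v (d : 'rV[R]_m) : multilinear F ->
  (forall v i j, i != j -> v i = v j -> F v = 0) ->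
  d != 0 -> \sum_i d 0 i *: v i = 0 -> F v = 0.
Proof.
move=> L A /rV0Pn[c dc] dep.
have := multilinear_sum v c (fun i => d 0 i) v L; rewrite dep multilinear0//.
rewrite (bigD1 c)//= big1 ?addr0.
  have -> : slot v c (v c) = v by apply/funext => i; rewrite /slot; case: eqP => [->|].
  by move=> /esym/eqP; rewrite mulf_eq0 (negbTE dc) => /eqP.
move=> i ic; rewrite (A _ c i) ?mulr0//; first by rewrite eq_sym.
by rewrite /slot eqxx (negbTE ic).
Qed.

Definition antisym (f : ('I_m -> V) -> R) v := \sum_(s : 'S_m) (-1) ^+ s * f (v \o s).

Lemma antisym_alt f v i j : i != j -> v i = v j -> antisym f v = 0.
Proof.
move=> ij vij; have E : antisym f v = - antisym f v.
  rewrite {1}/antisym (reindex_inj (mulIg (tperm i j))) /= /antisym -sumrN.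
  apply: eq_bigr => s _; rewrite odd_permM odd_tperm ij addbT signrN mulNr.
  congr (- (_ * f _)); apply/funext => l; rewrite /= permM.
  by case: tpermP => [->|->|].
by lra.
Qed.

Lemma antisym_multilinear f : multilinear f -> multilinear (antisym f).
Proof.
move=> L v c a x y; rewrite /antisym mulr_sumr -big_split /=; apply: eq_bigr => s _.
have E z : slot v c z \o s = slot (v \o s) (s^-1%g c) z.
  by apply/funext => l; rewrite /slot /= (canF_eq (permK s)).
by rewrite !E L mulrDr mulrCA.
Qed.

End Alternating.

(** * The common kernel of a contact form and its derivative *)

Section ContactKernel.
Variables (R : realType) (k : nat).
Local Notation m := (2 * k).+1.
Local Notation V := 'rV[R]_m.
Variables (et : V -> R) (om : V -> V -> R).
Hypothesis et_lin : forall a x y, et (a *: x + y) = a * et x + et y.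
Hypothesis om_linl : forall a x y z, om (a *: x + y) z = a * om x z + om y z.
Hypothesis om_linr : forall a x y z, om z (a *: x + y) = a * om z x + om z y.

Definition contact_prod (u : 'I_m -> V) : R :=
  et (u ord0) * \prod_(i < k) om (u (inord (2 * i).+1)) (u (inord (2 * i).+2)).

Lemma contact_prod_multilinear : multilinear contact_prod.
Proof.
move=> v c a x y; rewrite /contact_prod.
have v1 (i : 'I_k) : (inord (2 * i).+1 : 'I_m) = (2 * i).+1 :> nat.
  by rewrite inordK//; have := ltn_ord i; lia.
have v2 (i : 'I_k) : (inord (2 * i).+2 : 'I_m) = (2 * i).+2 :> nat.
  by rewrite inordK//; have := ltn_ord i; lia.
have ne z (d e : 'I_m) : (d : nat) <> e -> slot v e z d = v d.
  by move=> de; rewrite /slot; case: eqP => // E; case: de; rewrite E.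
have eqq z (d e : 'I_m) : (d : nat) = e -> slot v e z d = z.
  by move=> de; rewrite /slot; case: eqP => // E; case: E; apply/val_inj.
have [c0|c0] := eqVneq (c : nat) 0%N.
  rewrite !(eqq _ ord0 c (esym c0)).
  have E z : \prod_(i < k) om (slot v c z (inord (2 * i).+1)) (slot v c z (inord (2 * i).+2)) =
     \prod_(i < k) om (v (inord (2 * i).+1)) (v (inord (2 * i).+2)).
    by apply: eq_bigr => i _; rewrite !ne// ?v1 ?v2 c0.
  by rewrite !E et_lin; lra.
(* A slot c > 0 belongs to the factor of index (c - 1) / 2, as its first argument for c odd and as
   its second for c even. *)
have i0P : (c.-1./2 < k)%N by have := ltn_ord c; lia.
pose i0 := Ordinal i0P.
have c0' : (ord0 : 'I_m) <> c :> nat by move=> /esym/eqP; rewrite (negbTE c0).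
rewrite !(ne _ ord0 c c0').
rewrite (bigD1 i0)//= [in X in _ = _ * X + _](bigD1 i0)//= [in X in _ = _ + X](bigD1 i0)//=.
pose P := \prod_(i < k | i != i0) om (v (inord (2 * i).+1)) (v (inord (2 * i).+2)).
have E z : \prod_(i < k | i != i0) om (slot v c z (inord (2 * i).+1)) (slot v c z (inord (2 * i).+2)) = P.
  apply: eq_bigr => i ii0; have ne2 : (i : nat) <> c.-1./2 by move=> E; move/eqP: ii0; case; exact/val_inj.
  by rewrite !ne// ?v1 ?v2; lia.
rewrite !E.
have [co|ce] : (c = (2 * i0).+1 :> nat) \/ (c = (2 * i0).+2 :> nat) by rewrite /=; lia.
  rewrite !(eqq _ (inord (2 * i0).+1) c) ?v1//.
  rewrite !(ne _ (inord (2 * i0).+2) c) ?v2; try by rewrite co; lia.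
  by rewrite om_linl; lra.
rewrite !(eqq _ (inord (2 * i0).+2) c) ?v2//.
rewrite !(ne _ (inord (2 * i0).+1) c) ?v1; try by rewrite ce; lia.
by rewrite om_linr; lra.
Qed.

(* Modulo a kernel vector z the 2k+1 arguments lie in a space of dimension 2k,
   so that they are linearly dependent. *)
Lemma contact_prod_kernel (A : 'I_m -> V) (z : V) : antisym contact_prod A != 0 ->
  et z = 0 -> (forall y, om z y = 0) -> (forall y, om y z = 0) -> z = 0.
Proof.
move=> FA ez oz1 oz2; apply: contrapT => /eqP /rV0Pn[i0 zi0].
(* Subtracting multiples of z clears the coordinate [i0] of every argument and leaves the value
   unchanged. The matrix of the arguments then has a zero column, which yields a linear relation
   between its rows. *)
pose A' i := (- (A i 0 i0 / z 0 i0)) *: z + A i.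
have F' : antisym contact_prod A' = antisym contact_prod A.
  apply: eq_bigr => s _; congr (_ * _); rewrite /contact_prod /A' /= et_lin ez mulr0 add0r.
  congr (_ * _); apply: eq_bigr => i _.
  by rewrite om_linl oz1 mulr0 add0r om_linr oz2 mulr0 add0r.
pose B : 'M[R]_m := \matrix_i A' i.
have : \det B = 0.
  apply/eqP; rewrite -det_tr; apply/det0P; exists (delta_mx 0 i0).
    by apply/rV0Pn; exists i0; rewrite mxE !eqxx oner_neq0.
  by rewrite -rowE; apply/rowP => j; rewrite !mxE mulNr divfK// addNr.
move=> /eqP/det0P[d d0 dB]; move/eqP: FA; apply; rewrite -F'.
apply: (alternating_dependent (antisym_multilinear contact_prod_multilinear) _ d0).
  by move=> v i j ij vij; exact: antisym_alt ij vij.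
rewrite -[RHS]dB mulmx_sum_row; apply: eq_bigr => i _; congr (_ *: _).
by apply/rowP => j; rewrite !mxE.
Qed.

End ContactKernel.

Section ContactForm.
Variables (R : realType) (k : nat) (M : manifold R (2 * k).+1).
Variable eta : M -> functional M -> R.
Hypothesis ceta : contact_form eta.

(** In coordinates the sum of [contact_form] is the antisymmetrised [contact_prod], and it could not
    be nonzero in the presence of a nonzero kernel vector. *)
Lemma contact_kernel p Z : tangent p Z -> eta p Z = 0 ->
  (forall w, tangent p w -> dform eta p Z w = 0) -> Z = (fun=> 0).
Proof.
move=> TZ eZ dZ; have [eta1 H] := ceta; have [v [Tv Fv]] := H p.
have [K Kp] := coords_at p.
pose row (u : functional M) : 'rV[R]_(2 * k).+1 := \row_j u (co_fun K j).
pose et (x : 'rV[R]_(2 * k).+1) : R := \sum_j x 0 j * form_coef eta K j p.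
pose om (x y : 'rV[R]_(2 * k).+1) : R := \sum_i \sum_j x 0 i * y 0 j * dcoef eta K p i j.
have etE u : tangent p u -> eta p u = et (row u).
  move=> Tu; rewrite (form_coord eta1 Kp Tu); apply: eq_bigr => j _.
  by rewrite mxE.
have omE u w : tangent p u -> tangent p w -> dform eta p u w = om (row u) (row w).
  move=> Tu Tw; rewrite (dform_coord eta1 Kp Tu Tw); apply: eq_bigr => i _; apply: eq_bigr => j _.
  by rewrite !mxE.
have et_lin a x y : et (a *: x + y) = a * et x + et y.
  rewrite /et mulr_sumr -big_split /=; apply: eq_bigr => j _; rewrite !mxE; lra.
have om_linl a x y z : om (a *: x + y) z = a * om x z + om y z.
  rewrite /om mulr_sumr -big_split /=; apply: eq_bigr => i _.
  rewrite mulr_sumr -big_split /=; apply: eq_bigr => j _; rewrite !mxE; lra.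
have om_linr a x y z : om z (a *: x + y) = a * om z x + om z y.
  rewrite /om mulr_sumr -big_split /=; apply: eq_bigr => i _.
  rewrite mulr_sumr -big_split /=; apply: eq_bigr => j _; rewrite !mxE; lra.
have omC x y : om x y = - om y x.
  rewrite /om exchange_big /= -sumrN; apply: eq_bigr => i _; rewrite -sumrN; apply: eq_bigr => j _.
  by rewrite dcoefC; lra.
have rowE (x : 'rV[R]_(2 * k).+1) : exists2 u, tangent p u & row u = x.
  exists (fun f => \sum_i x 0 i * co_field K i p f).
    by apply: tangent_comb => i; have [T _] := @co_vf _ _ _ K i; exact: T.
  apply/rowP => j; rewrite mxE (bigD1 j)//= (frame_dual _ _ Kp) eqxx mulr1 big1 ?addr0// => i ij.
  by rewrite (frame_dual _ _ Kp) (negbTE ij) mulr0.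
have oz y : om (row Z) y = 0 by have [u Tu <-] := rowE y; rewrite -omE// dZ.
have rz : row Z = 0.
  apply: (contact_prod_kernel et_lin om_linl om_linr (A := row \o v)) => //.
  - apply: contra_neq Fv => E; rewrite -[RHS]E; apply: eq_bigr => s _; congr (_ * _).
    rewrite /contact_prod /= etE//; congr (_ * _); apply: eq_bigr => i _; exact: omE.
  - by rewrite -etE.
  - by move=> y; rewrite omC oz oppr0.
apply: (tan_eq Kp TZ (tangent_zero p)) => i.
by have := congr1 (fun x : 'rV[R]_(2 * k).+1 => x 0 i) rz; rewrite !mxE.
Qed.

End ContactForm.

(** * The Reeb flow *)

Lemma smooth_separates (R : realType) n (M : manifold R n) (p q : M) : p <> q ->
  exists f : M -> R, [/\ smooth_fun f, f p = 1 & f q = 0].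
Proof.
move=> pq; have [c Ac cp] := chart_at p.
have oq : open (~` [set q]).
  by apply: closed_openC; apply: (accessible_closed_set1 (hausdorff_accessible (@manifold_hausdorff _ _ M))).
have [chi [F [ O1 [schi [cF FO] chi0 [ oO1 O1p] [ O1F chi1]]]]] := chart_bump Ac cp oq pq.
by exists chi; split => //; [exact: chi1|apply: chi0 => /FO[/(_ erefl)]].
Qed.

(** * Circle actions whose field contracts d eta to zero *)

Section Action.
Variables (R : realType) (n : nat) (M : manifold R n) (rho : R -> M -> M).
Hypothesis act : free_circle_action rho.

Definition act_field (p : M) : functional M := velocity (rho^~ p) 0.

Lemma act0 p : rho 0 p = p. Proof. by have [H _ _ _] := act. Qed.

Lemma actD s t p : rho (s + t) p = rho s (rho t p). Proof. by have [_ H _ _] := act. Qed.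

Lemma act1 p : rho 1 p = p.
Proof. by have [_ _ H _] := act; apply/H; exists 1; rewrite rmorph1. Qed.

Lemma act_smooth : smoothRMap rho. Proof. by have [_ _ _ H] := act. Qed.

Lemma act_fun_smooth f : smooth_fun f -> smoothRM (fun s p => f (rho s p)).
Proof. exact: rm_comp act_smooth. Qed.

Lemma act_fieldE f p : smooth_fun f -> act_field p f = dt (fun s q => f (rho s q)) 0 p.
Proof. by move=> sf; rewrite /act_field /velocity asboolT// derive1E. Qed.

Lemma act_vf : vector_field act_field.
Proof.
split=> [p|f sf]; last first.
  have -> : (fun p => act_field p f) = dt (fun s q => f (rho s q)) 0.
    by apply/funext => p; exact: act_fieldE.
  exact: rm_fix 0 (rm_dt (act_fun_smooth sf)).
have D f (sf : smooth_fun f) := rm_is_derive 0 p (act_fun_smooth sf).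
split=> [f nf|a f g sf sg|f g sf sg].
- by rewrite /act_field /velocity; case: asboolP.
- have sfg := sfunD openT (sfunM openT (sfun_cst openT a) sf) sg.
  rewrite (act_fieldE p sfg) (act_fieldE p sf) (act_fieldE p sg).
  have [_ E] := is_deriveD (is_deriveZ a (D f sf)) (D g sg); exact: E.
- have sfg := sfunM openT sf sg.
  rewrite (act_fieldE p sfg) (act_fieldE p sf) (act_fieldE p sg).
  have [_ E] := is_deriveM (D f sf) (D g sg).
  rewrite act0 /GRing.scale /= in E; rewrite [LHS]E; lra.
Qed.

Lemma act_tangent p : tangent p (act_field p). Proof. by have [H _] := act_vf. Qed.

Lemma act_orbit f (s : R) p : smooth_fun f ->
  is_derive s (1 : R) (fun s => f (rho s p)) (act_field (rho s p) f).
Proof.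
move=> sf; have sP := act_fun_smooth sf.
have d1 := rm_is_derive s p sP.
suff -> : act_field (rho s p) f = dt (fun s q => f (rho s q)) s p by exact: d1.
rewrite (act_fieldE _ sf).
have d0 := rm_is_derive 0 (rho s p) sP.
have sh : is_derive (0 : R) (1 : R) (fun h : R => h + s) 1.
  have := is_deriveD (is_derive_id (0 : R) (1 : R)) (is_derive_cst s (0 : R) (1 : R)).
  by rewrite addr0.
have d1' : is_derive (0 + s) (1 : R) (fun s => f (rho s p)) (dt (fun s q => f (rho s q)) s p).
  by rewrite add0r.
have d2 := @is_derive1_comp R (fun s => f (rho s p)) (fun h => h + s) 0 _ _ d1' sh.
have E : (fun h => f (rho h (rho s p))) = (fun s => f (rho s p)) \o (fun h => h + s).
  by apply/funext => h; rewrite /= actD.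
have [_ <-] := d0; rewrite E; have [_ ->] := d2; exact: mulr1.
Qed.

Lemma act_invariant f (s : R) p : smooth_fun f -> (forall q, act_field q f = 0) ->
  f (rho s p) = f p.
Proof.
move=> sf V0; rewrite -[in RHS](act0 p).
apply: (is_derive_0_is_cst (f := fun s => f (rho s p))) => t.
by have := act_orbit t p sf; rewrite V0.
Qed.

Lemma act_field_push s p f : smooth_fun f -> act_field (rho s p) f = act_field p (f \o rho s).
Proof.
move=> sf; have sm := rmap_fix s act_smooth.
rewrite (act_fieldE _ sf) (act_fieldE _ (smooth_map_comp sm sf)) /dt.
by congr ('D__ _ _); apply/funext => h; rewrite /= -!actD addrC.
Qed.

(** A zero of the field propagates along its orbit, so every smooth function is constant there and
    the point is fixed. Freeness is contradicted at the non-integral time 1/2. *)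
Lemma act_field_neq0 p : act_field p <> (fun=> 0).
Proof.
move=> V0; have [_ _ per _] := act.
have half : rho (1/2) p = p.
  apply: contrapT => ne; have [f [sf f1 f0]] := smooth_separates ne.
  have : f (rho (1/2) p) = f (rho 0 p).
    apply: (is_derive_0_is_cst (f := fun s => f (rho s p))) => t.
    by have := act_orbit t p sf; rewrite (act_field_push _ _ sf) V0.
  by rewrite act0 f1 f0 => /eqP; rewrite oner_eq0.
have /per[j jE] := half.
have : (2 * j)%:~R = 1%:~R :> R by rewrite intrM -jE; lra.
by move/intr_inj; lia.
Qed.

Variable eta : M -> functional M -> R.
Hypothesis eta1 : one_form eta.
Hypothesis flat : forall p w, tangent p w -> dform eta p (act_field p) w = 0.

Definition act_form p := eta p (act_field p).

Lemma act_form_smooth : smooth_fun act_form.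
Proof. by have [_ H] := eta1; exact: H act_vf. Qed.

(* Cartan's formula: the Lie derivative of eta along V is d (eta V), because
   the contraction of V with d eta vanishes. *)
Lemma cartan0 p w : tangent p w ->
  is_derive (0 : R) (1 : R) (fun s => eta (rho s p) (dmap (rho s) w)) (w act_form).
Proof.
move=> Tw; have [K Kp] := coords_at p.
have sX j := @co_smooth _ _ _ K j.
have sPj j := act_fun_smooth (sX j).
have sa j := form_coef_smooth eta1 K j.
have d1 j := tan_dt 0 (sPj j) Tw.
have d2 j := act_orbit 0 p (sa j).
pose G s := \sum_j w (fun q => co_fun K j (rho s q)) * form_coef eta K j (rho s p).
have dG : is_derive (0 : R) (1 : R) G (w act_form).
  have D j := is_deriveM (d1 j) (d2 j).
  have := is_derive_sum D.
  have -> : (\sum_(i < n) ((fun s => w (fun q => co_fun K i (rho s q))) * (fun s => form_coef eta K i (rho s p)))%R) = G.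
    by apply/funext => s; rewrite fct_sumE.
  congr (is_derive _ _ _ _).
  rewrite (form_deriv eta1 Kp Tw act_vf).
  have E : \sum_i \sum_j act_field p (co_fun K i) * w (co_fun K j) * dcoef eta K p i j = 0.
    by rewrite -(dform_coord eta1 Kp (act_tangent p) Tw) flat.
  (* Adding d eta(V, w) = 0 turns d (eta V) into the Lie derivative of eta, compared term by
     term. *)
  rewrite -[RHS]addr0 -[X in _ = _ + X]E.
  have E1 j : w (dt (fun s q => co_fun K j (rho s q)) 0) = w (fun q => act_field q (co_fun K j)).
    by congr w; apply/funext => q; rewrite (act_fieldE _ (sX j)).
  have E2 : \sum_i \sum_j act_field p (co_fun K i) * w (co_fun K j) * dcoef eta K p i j =
     \sum_j w (co_fun K j) * act_field p (form_coef eta K j) -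
     \sum_j act_field p (co_fun K j) * w (form_coef eta K j).
    have ex v u : tangent p v -> \sum_j u (co_fun K j) * v (form_coef eta K j) =
        \sum_i \sum_j v (co_fun K i) * u (co_fun K j) * co_field K i p (form_coef eta K j).
      move=> Tv; rewrite exchange_big /=; apply: eq_bigr => j _.
      rewrite [v (form_coef _ K j)](congr1 (fun u => u (form_coef eta K j)) (tan_frame Kp Tv)) mulr_sumr.
      by apply: eq_bigr => i _; rewrite mulrA [u _ * _]mulrC.
    rewrite (ex _ _ (act_tangent p)) (ex _ _ Tw) [X in _ = _ - X]exchange_big /= -sumrB.
    apply: eq_bigr => i _; rewrite -sumrB; apply: eq_bigr => j _.
    by rewrite /dcoef mulrBr [w _ * _]mulrC.
  rewrite E2 -sumrB -big_split /=; apply: eq_bigr => j _.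
  by rewrite E1 !act0 /GRing.scale /=; have -> : (fun q => co_fun K j (rho 0 q)) = co_fun K j;
    [apply/funext => q; rewrite act0|lra].
apply: near_eq_is_derive dG.
have c0 : {for (0 : R), continuous (fun s => rho s p)}.
  have c1 : (s, p) @[s --> (0 : R)] --> ((0 : R), p) by exact: (cvg_pair cvg_id (cvg_cst p)).
  exact: (cvg_comp _ _ c1 (rmap_cont (t := 0) (p := p) act_smooth)).
have nK : nbhs (rho 0 p) (co_dom K).
  by rewrite act0; apply: open_nbhs_nbhs; split => //; exact: co_open.
near=> s.
have Ks : co_dom K (rho s p) by near: s; exact: (c0 _ nK).
have sm := rmap_fix s act_smooth.
rewrite (form_coord eta1 Ks (dmap_tangent sm Tw)); apply: eq_bigr => j _.
by rewrite (dmap_smooth _ _ (sX j)).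
Unshelve. all: by end_near.
Qed.

Lemma cartan p w (s : R) : tangent p w ->
  is_derive s (1 : R) (fun s => eta (rho s p) (dmap (rho s) w)) (w (fun q => act_form (rho s q))).
Proof.
move=> Tw; have sm t := rmap_fix t act_smooth.
have d0 := cartan0 (dmap_tangent (sm s) Tw).
rewrite (dmap_smooth _ _ act_form_smooth) in d0.
have sh : is_derive s (1 : R) (fun h : R => h - s) 1.
  have := is_deriveD (is_derive_id (s : R) (1 : R)) (is_derive_cst (- s) s (1 : R)).
  by rewrite addr0.
rewrite -(subrr s) in d0.
have := @is_derive1_comp R _ (fun h => h - s) s _ _ d0 sh.
rewrite mulr1; congr (is_derive _ _ _ _); apply/funext => h /=.
rewrite -actD subrK; congr eta; apply/funext => f.
have [sf|nf] := pselect (smooth_fun f); last by rewrite !(dmap_nonsmooth _ _ nf).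
rewrite (dmap_smooth _ _ sf) (dmap_smooth _ _ (smooth_map_comp (sm (h - s)) sf)) (dmap_smooth _ _ sf).
by congr w; apply/funext => q; rewrite /= -actD subrK.
Qed.

(* Locked: conversion must not unfold it down to an integral. *)
Definition orbit_length : R -> M -> R := locked (primitive (fun s q => act_form (rho s q))).

Lemma orbit_lengthE : orbit_length = primitive (fun s q => act_form (rho s q)).
Proof. by rewrite /orbit_length -lock. Qed.

Lemma orbit_length_smooth : smoothRM orbit_length.
Proof. rewrite orbit_lengthE; exact: rm_primitive (act_fun_smooth act_form_smooth). Qed.

Lemma orbit_length_deriv (s : R) p : is_derive s (1 : R) (orbit_length^~ p) (act_form (rho s p)).
Proof. rewrite orbit_lengthE; exact: dt_primitive (act_fun_smooth act_form_smooth). Qed.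

Lemma orbit_length_dt s p : dt orbit_length s p = act_form (rho s p).
Proof. by have [_ E] := orbit_length_deriv s p. Qed.

Lemma orbit_length0 p : orbit_length 0 p = 0.
Proof. by rewrite orbit_lengthE /primitive mul0r. Qed.

(** The pullback of eta by rho_s exceeds eta by the differential of [orbit_length s]: both sides
    have the same derivative in s, by [cartan], and agree at s = 0. *)
Lemma eta_act p w s : tangent p w ->
  eta (rho s p) (dmap (rho s) w) = eta p w + w (orbit_length s).
Proof.
move=> Tw.
have d1 (t : R) := cartan t Tw.
have d2 (t : R) := tan_dt t orbit_length_smooth Tw.
have E : forall x y : R, (fun t => eta (rho t p) (dmap (rho t) w) - w (orbit_length t)) x =
   (fun t => eta (rho t p) (dmap (rho t) w) - w (orbit_length t)) y.
  move=> x y; apply: (is_derive_0_is_cst (f := fun t => eta (rho t p) (dmap (rho t) w) - w (orbit_length t))) => t.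
  have := is_deriveB (d1 t) (d2 t).
  have -> : dt orbit_length t = (fun q => act_form (rho t q)) by apply/funext => q; exact: orbit_length_dt.
  by rewrite subrr.
have := E s 0 => /=.
have -> : orbit_length 0 = (fun=> 0) by apply/funext => q; exact: orbit_length0.
rewrite (tan0 Tw) subr0 act0.
have -> : dmap (rho 0) w = w.
  apply/funext => f; have [sf|nf] := pselect (smooth_fun f); last first.
    by rewrite (dmap_nonsmooth _ _ nf) (tan_nonsmooth Tw nf).
  by rewrite (dmap_smooth _ _ sf); congr w; apply/funext => q; rewrite /= act0.
by move=> <-; lra.
Qed.

Definition period := orbit_length 1.

Lemma period_smooth : smooth_fun period. Proof. exact: rm_fix orbit_length_smooth. Qed.

(** At time 1 the action is the identity, so the correction term of [eta_act] must vanish. *)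
Lemma period_flat p w : tangent p w -> w period = 0.
Proof.
move=> Tw; have := eta_act 1 Tw; rewrite act1.
have -> : dmap (rho 1) w = w.
  apply/funext => f; have [sf|nf] := pselect (smooth_fun f); last first.
    by rewrite (dmap_nonsmooth _ _ nf) (tan_nonsmooth Tw nf).
  by rewrite (dmap_smooth _ _ sf); congr w; apply/funext => q; rewrite /= act1.
rewrite /period; lra.
Qed.

Lemma period_act s p : period (rho s p) = period p.
Proof. by apply: (act_invariant _ _ period_smooth) => q; exact: period_flat (act_tangent q). Qed.

End Action.

(** * Inverting a strictly increasing family of functions *)

Section Implicit.
Variables (R : realType) (n : nat) (M : manifold R n) (S g : R -> M -> R).
Hypothesis sS : smoothRM S.
Hypothesis dS_gt0 : forall s p, 0 < dt S s p.
Hypothesis SgK : forall t p, S (g t p) p = t.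

Lemma family_mvt (a b : R) p :
  exists2 c, `|c - a| <= `|b - a| & S b p - S a p = dt S c p * (b - a).
Proof.
have D (t : R) : 0 <= t <= 1 -> derivable (S^~ p : R -> R) (a + (t * (b - a)) *: (1 : R)) (1 : R).
  by move=> _; have [d _] := rm_is_derive (a + (t * (b - a)) *: (1 : R)) p sS.
have [c /andP[c0 c1] E] := mvt_line D.
exists (a + (c * (b - a)) *: (1 : R)).
  by rewrite addrC addKr /GRing.scale /= mulr1 normrM ger0_norm// ler_piMl.
have ab : a + (b - a) *: (1 : R) = b by rewrite /GRing.scale /=; lra.
by rewrite ab in E; rewrite E mulrC.
Qed.

Lemma family_lt (a b : R) p : a < b -> S a p < S b p.
Proof.
move=> ab; have [c _ E] := family_mvt a b p.
by rewrite -subr_gt0 E mulr_gt0// subr_gt0.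
Qed.

Lemma family_inj (a b : R) p : S a p = S b p -> a = b.
Proof.
move=> E; have [ab|ba|//] := ltgtP a b.
  by have := family_lt p ab; rewrite E ltxx.
by have := family_lt p ba; rewrite E ltxx.
Qed.

Lemma family_le (a b : R) p : S a p < S b p -> a < b.
Proof.
by move=> E; rewrite ltNge; apply/negP; rewrite le_eqVlt => /orP[/eqP ba|/(family_lt p)];
  [rewrite ba ltxx in E|move=> /(lt_trans E); rewrite ltxx].
Qed.

(** Monotonicity in time traps g between s0 - e and s0 + e as soon as S at these two fixed times
    stays on the right sides of t. *)
Lemma inverse_cont (t0 : R) (p0 : M) : g z.1 z.2 @[z --> (t0, p0)] --> g t0 p0.
Proof.
apply/(@cvgrPdist_lt _ _ _ (nbhs (t0, p0))) => e e0; set s0 := g t0 p0.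
have cS (s : R) : (z.1 - S s z.2) @[z --> (t0, p0)] --> (t0 - S s p0).
  apply: cvgB; first exact: cvg_fst.
  have c1 : (fun z : R * M => z.2) z @[z --> (t0, p0)] --> p0 by exact: cvg_snd.
  have c2 : {for p0, continuous (S s)} by apply: smooth_fun_cont; exact: rm_fix.
  exact: (cvg_comp _ _ c1 c2).
have lo : 0 < t0 - S (s0 - e) p0.
  rewrite subr_gt0 -[X in _ < X](SgK t0 p0); apply: family_lt; rewrite -/s0; lra.
have hi : t0 - S (s0 + e) p0 < 0.
  rewrite subr_lt0 -[X in X < _](SgK t0 p0); apply: family_lt; rewrite -/s0; lra.
near=> z.
have lo' : 0 < z.1 - S (s0 - e) z.2.
  by near: z; exact: (cvgr_gt _ (cS (s0 - e)) _ lo).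
have hi' : z.1 - S (s0 + e) z.2 < 0.
  by near: z; exact: (cvgr_lt _ (cS (s0 + e)) _ hi).
have l : s0 - e < g z.1 z.2.
  by apply: (@family_le _ _ z.2); rewrite SgK -subr_gt0.
have h : g z.1 z.2 < s0 + e.
  by apply: (@family_le _ _ z.2); rewrite SgK -subr_lt0.
rewrite ltr_norml; lra.
Unshelve. all: by end_near.
Qed.

(** The increment of S along the curve, affine with slope d, splits into a change of time and a
    change of point. The mean value theorem in time allows division by the slope of S, so continuity
    of [phi] is enough to obtain its derivative at 0. *)
Lemma implicit_quotient (phi : R -> R) (sig : R -> M) (t d E : R) :
  {for (0 : R), continuous phi} -> {for (0 : R), continuous sig} ->
  (forall h, S (phi h) (sig h) = t + d * h) ->
  is_derive (0 : R) (1 : R) (fun h => S (phi 0) (sig h)) E ->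
  (h^-1 *: (phi h - phi 0)) @[h --> (0 : R)^'] --> (d - E) / dt S (phi 0) (sig 0).
Proof.
move=> cphi csig HS dE.
have ex h : exists c, `|c - phi 0| <= `|phi h - phi 0| /\
    S (phi h) (sig h) - S (phi 0) (sig h) = dt S c (sig h) * (phi h - phi 0).
  by have [c c1 c2] := family_mvt (phi 0) (phi h) (sig h); exists c.
have [xi xiP] := choice ex.
have cxi : xi h @[h --> (0 : R)] --> phi 0.
  apply/(@cvgrPdist_lt _ _ _ (nbhs (0 : R))) => e e0.
  have H := @cvgr_dist_lt _ _ _ (nbhs (0 : R)) _ phi (phi 0) cphi e e0.
  near=> h; have [x1 _] := xiP h; rewrite distrC; apply: le_lt_trans x1 _; rewrite distrC.
  by near: h; exact: H.
have cD : (fun h => dt S (xi h) (sig h)) h @[h --> (0 : R)] --> dt S (phi 0) (sig 0).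
  have c1 : (xi h, sig h) @[h --> (0 : R)] --> (phi 0, sig 0) by exact: (cvg_pair cxi csig).
  exact: (cvg_comp _ _ c1 (rm_cont (t := phi 0) (p := sig 0) (rm_dt sS))).
have cD' := cvg_trans (@cvg_app _ _ _ _ (fun h => dt S (xi h) (sig h)) (@nbhs_dnbhs R (0:R))) cD.
have cV : (fun h => (dt S (xi h) (sig h))^-1) h @[h --> (0 : R)^'] --> (dt S (phi 0) (sig 0))^-1.
  by apply: cvgV; [rewrite gt_eqF|exact: cD'].
have [dp vp] := dE.
have cq : (fun h : R => h^-1 *: (S (phi 0) (sig h) - S (phi 0) (sig 0))) h @[h --> (0 : R)^'] --> E.
  rewrite -vp; have := dp; rewrite /derivable /derive => /cvg_ex[l cl].
  have -> : (fun h : R => h^-1 *: (S (phi 0) (sig h) - S (phi 0) (sig 0))) =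
    (fun h : R => h^-1 *: (((fun h => S (phi 0) (sig h)) \o shift 0) (h *: (1 : R)) - S (phi 0) (sig 0))).
    by apply/funext => h; rewrite /= addr0 [h *: _]mulr1.
  exact: dp.
have cF : (fun h : R => (d - h^-1 *: (S (phi 0) (sig h) - S (phi 0) (sig 0))) * (dt S (xi h) (sig h))^-1) h
    @[h --> (0 : R)^'] --> (d - E) / dt S (phi 0) (sig 0).
  by apply: cvgM cV; apply: cvgB cq; exact: cvg_cst.
apply: cvg_trans cF; apply: near_eq_cvg; near=> h.
have h0 : h != 0 by near: h; exact: nbhs_dnbhs_neq.
have [_ x2] := xiP h; have D0 := dS_gt0 (xi h) (sig h).
have e1 : S (phi 0) (sig 0) = t by rewrite HS mulr0 addr0.
rewrite HS in x2; rewrite e1 /GRing.scale /=.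
apply: (mulIf (lt0r_neq0 D0)); rewrite divfK ?gt_eqF//.
apply: (mulfI h0); rewrite mulrBr mulVKf// -mulrA mulVKf//.
rewrite [RHS]mulrC -x2.
by lra.
Unshelve. all: by end_near.
Qed.

Section InChart.
Variable c : chart R n M.
Hypothesis Ac : atlas M c.
Local Notation U := (tset (cimg c)).
Local Notation gh := (lift g c).
Local Notation Sh := (lift S c).
Let oU : open U := toset Ac.
Let G (z : 'rV[R]_(1 + n)) := tx (gh z) (rsubmx z).

Let GU z : U z -> U (G z). Proof. by rewrite /tset /G /= tx_r. Qed.

(** The implicit function formula for the j-th partial derivative of the inverse, to be evaluated at
    (g, x); the index [lshift n 0] is time. *)
Let slope (j : 'I_(1 + n)) (z : 'rV[R]_(1 + n)) : R :=
  ((j == lshift n 0)%:R - (if fintype.split j is inr i then 'D_(e1 R i) Sh z else 0)) / 'D_(e0 R n) Sh z.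

Let D0_neq0 z : U z -> 'D_(e0 R n) Sh z != 0.
Proof.
move=> Uz; have := rm_dtE (lsubmx z 0 0) sS Ac (Uz : cimg c (rsubmx z)).
by rewrite tx_id => <-; rewrite gt_eqF.
Qed.

Let gh_cont z : U z -> {for z, continuous gh}.
Proof.
move=> Uz; have cl : {for z, continuous (fun z : 'rV[R]_(1 + n) => lsubmx z 0 0)}.
  exact: smooth_on_cont (smooth_on_tx_l oU) Uz.
have cr : {for z, continuous (fun z : 'rV[R]_(1 + n) => rsubmx z)}.
  by apply: continuous_rV => i; exact: smooth_on_cont (smooth_on_tx_r i oU) Uz.
have cc : {for z, continuous (fun z : 'rV[R]_(1 + n) => cinv c (rsubmx z))}.
  exact: (continuous_comp cr (cinv_cont Ac Uz)).
have c1 : (lsubmx y 0 0, cinv c (rsubmx y)) @[y --> z] --> (lsubmx z 0 0, cinv c (rsubmx z)).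
  exact: (cvg_pair cl cc).
exact: (cvg_comp _ _ c1 (inverse_cont (t0 := _) (p0 := _))).
Qed.

Let gh_deriv z j : U z -> is_derive z (delta_mx 0 j) gh (slope j (G z)).
Proof.
move=> Uz; set v := delta_mx 0 j.
pose phi (h : R) := gh (h *: v + z); pose sig (h : R) := cinv c (rsubmx (h *: v + z)).
have cline : {for (0 : R), continuous (fun h : R => h *: v + z)}.
  have c0 : {for (0 : R), continuous (fun h : R => h *: v)} by exact: scalel_continuous.
  by exact: (cvgD c0 (cvg_cst z)).
have l0 : 0 *: v + z = z by rewrite scale0r add0r.
have cphi : {for (0 : R), continuous phi}.
  have cg : {for 0 *: v + z, continuous gh} by rewrite l0; exact: gh_cont.
  exact: (continuous_comp cline cg).
have cr : {for z, continuous (fun z : 'rV[R]_(1 + n) => cinv c (rsubmx z))}.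
  have cr : {for z, continuous (fun z : 'rV[R]_(1 + n) => rsubmx z)}.
    by apply: continuous_rV => i; exact: smooth_on_cont (smooth_on_tx_r i oU) Uz.
  exact: (continuous_comp cr (cinv_cont Ac Uz)).
have csig : {for (0 : R), continuous sig}.
  have cg : {for 0 *: v + z, continuous (fun z : 'rV[R]_(1 + n) => cinv c (rsubmx z))}.
    by rewrite l0; exact: cr.
  exact: (continuous_comp cline cg).
have HS h : S (phi h) (sig h) = lsubmx z 0 0 + (j == lshift n 0)%:R * h.
  by rewrite /phi /lift SgK !mxE eqxx /= addrC mulrC eq_sym.
pose E : R := if fintype.split j is inr i then 'D_(e1 R i) Sh (G z) else 0.
have dE : is_derive (0 : R) (1 : R) (fun h => S (phi 0) (sig h)) E.
  rewrite /E /phi l0 /sig /v; case: splitP => i ji.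
    have -> : (fun h => S (gh z) (cinv c (rsubmx (h *: delta_mx 0 j + z)))) =
       cst (S (gh z) (cinv c (rsubmx z))).
      apply/funext => h /=; congr (S _ (cinv c _)); apply/rowP => l; rewrite !mxE.
      have -> : (rshift 1 l == j) = false by apply/eqP => /(congr1 val) /=; rewrite ji; case: i {ji} => [[]].
      by rewrite andbF mulr0 add0r.
    exact: is_derive_cst.
  have jE : j = rshift 1 i by apply/val_inj.
  have dd : derivable Sh (tx (gh z) (rsubmx z)) (e1 R i).
    exact: smooth_on_derivable (sS Ac) (GU Uz).
  have d1 := is_derive_tx_r dd.
  have dl : derivable (fun x => Sh (tx (gh z) x)) (rsubmx z + 0 *: delta_mx 0 i) (delta_mx 0 i).
    by rewrite scale0r addr0; have [] := d1.
  have := is_derive_line dl; rewrite scale0r addr0; have [_ ->] := d1.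
  congr (is_derive _ _ _ _); apply/funext => h; rewrite lift_tx; congr (S _ (cinv c _)).
  apply/rowP => l; rewrite !mxE jE addrC; congr (_ * _ + _); congr (_%:R).
have Q := implicit_quotient cphi csig HS dE.
have phi0 : phi 0 = gh z by rewrite /phi l0.
have sig0 : sig 0 = cinv c (rsubmx z) by rewrite /sig l0.
have sl : ((j == lshift n 0)%:R - E) / dt S (phi 0) (sig 0) = slope j (G z).
  by rewrite /slope phi0 sig0 (rm_dtE _ sS Ac Uz).
rewrite sl phi0 in Q.
have D : derivable gh z v by apply/cvg_ex; exists (slope j (G z)); exact: Q.
by apply: DeriveDef => //; apply: cvg_lim.
Qed.

(** Coinduction on the composites of smooth functions with [G], that is, with (t, x) |-> (g, x). By
    the implicit formula the partial derivatives of [G] are functions of [G], so the class is closed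
    under derivation. *)
Lemma inverse_lift_smooth : smooth_on U gh.
Proof.
pose P (f : 'rV[R]_(1 + n) -> R) := exists2 Q, smooth_on U Q & f = Q \o G.
have [Q0 sQ0 E0] : P gh.
  exists (fun z => lsubmx z 0 0); first exact: smooth_on_tx_l.
  by apply/funext => z; rewrite /= tx_l.
have Gl (k : 'I_1) : (fun z => G z 0 (lshift n k)) = gh by apply/funext => z; rewrite tx_lshift.
have Gr i : (fun z => G z 0 (rshift 1 i)) = (fun z => z 0 (rshift 1 i)).
  by apply/funext => z; rewrite tx_rshift mxE.
have dG i j z : U z -> is_derive z (delta_mx 0 j) (fun z => G z 0 i)
    (if fintype.split i is inl _ then slope j (G z) else (j == i)%:R).
  move=> Uz; case: splitP => k ik.
    by have -> : i = lshift n k; [apply/val_inj|rewrite Gl; exact: gh_deriv].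
  have -> : i = rshift 1 k by apply/val_inj.
  by rewrite Gr; exact: derive_coord.
have cG z : U z -> {for z, continuous G}.
  move=> Uz; apply: continuous_rV => i; case: (splitP i) => k ik.
    by have -> : i = lshift n k; [apply/val_inj|rewrite Gl; exact: gh_cont].
  have -> : i = rshift 1 k by apply/val_inj.
  by rewrite Gr; exact: smooth_on_cont (smooth_on_coord (rshift 1 k) oU) Uz.
apply: (smooth_coind (P := P) oU); last by exists Q0.
move=> _ [Q sQ ->].
have dQ z j : U z -> is_derive z (delta_mx 0 j) (Q \o G)
    (\sum_i 'D_(delta_mx 0 j) (fun z => G z 0 i) z * 'D_(delta_mx 0 i) Q (G z)).
  move=> Uz; have [nd cd] := smooth_on_c1 oU sQ (GU Uz).
  by apply: (chain_rule nd cd) => i; have [] := dG i j z Uz.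
split=> [z Uz|j].
  split; first exact: (continuous_comp (cG z Uz) (smooth_on_cont sQ (GU Uz))).
  by move=> j; have [] := dQ z j Uz.
pose Q' z := \sum_i (if fintype.split i is inl _ then slope j z else (j == i)%:R) * 'D_(delta_mx 0 i) Q z.
exists (Q' \o G); last first.
  move=> z Uz; have [_ ->] := dQ z j Uz; apply: eq_bigr => i _.
  by have [_ ->] := dG i j z Uz.
exists Q'; last exact: erefl.
apply: (smooth_on_sum oU) => i.
apply: (smooth_onM oU); last exact: smooth_on_D.
case: (fintype.split i) => _; last exact: smooth_on_cst.
apply: (smooth_onM oU); last first.
  apply: (smooth_on_inv oU); last exact: D0_neq0.
  exact: smooth_on_D (sS Ac).
apply: (smooth_onB oU); first exact: smooth_on_cst.
case: (fintype.split j) => [_|l]; first exact: smooth_on_cst.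
exact: smooth_on_D (sS Ac).
Qed.

End InChart.

Lemma inverse_smooth : smoothRM g.
Proof. by move=> c Ac; exact: inverse_lift_smooth. Qed.

End Implicit.

Lemma same_derivative (R : realType) (f g d : R -> R) :
  (forall t, is_derive t (1 : R) f (d t)) -> (forall t, is_derive t (1 : R) g (d t)) ->
  forall x y, f x - g x = f y - g y.
Proof.
move=> df dg x y; have D (t : R) : is_derive t (1 : R) (f - g) 0.
  by have := is_deriveB (df t) (dg t); rewrite subrr.
exact: (is_derive_0_is_cst x y D).
Qed.

Lemma dform_scale (R : realType) n (M : manifold R n) eta p a (v w : functional M) :
  one_form eta -> tangent p v -> tangent p w ->
  dform eta p (fun f => a * v f) w = a * dform eta p v w.
Proof.
move=> eta1 Tv Tw; have [K Kp] := coords_at p.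
have Tav : tangent p (fun f => a * v f).
  have := tangent_lin a Tv (tangent_zero p).
  by have -> : (fun f => a * v f + 0) = (fun f => a * v f) by apply/funext => f; rewrite addr0.
rewrite (dform_coord eta1 Kp Tav Tw) (dform_coord eta1 Kp Tv Tw) mulr_sumr.
by apply: eq_bigr => i _; rewrite mulr_sumr; apply: eq_bigr => j _; rewrite !mulrA.
Qed.

Lemma curve_derive (R : realType) n (M : manifold R n) (P : R -> M -> R) (gamma : R -> M)
    (t0 : R) (v : functional M) : smoothRM P -> {for t0, continuous gamma} ->
  tangent (gamma t0) v ->
  (forall f, smooth_fun f -> is_derive t0 (1 : R) (fun t => f (gamma t)) (v f)) ->
  is_derive t0 (1 : R) (fun t => P t (gamma t)) (dt P t0 (gamma t0) + v (P t0)).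
Proof.
move=> sP cg Tv dg; have [K Kp] := coords_at (gamma t0).
have Ac := co_atlas K; have cp := co_sub Kp.
set c := co_chart K in Ac cp.
pose G (t : R) := tx t (cmap c (gamma t)).
have nK : \forall t \near t0, co_dom K (gamma t).
  by apply: cg; apply: open_nbhs_nbhs; split => //; exact: co_open.
have G0 k : (fun t => G t 0 (lshift n k)) = id by apply/funext => t; rewrite tx_lshift.
have dG0 k : is_derive t0 (1 : R) (fun t => G t 0 (lshift n k)) 1.
  by rewrite G0; exact: is_derive_id.
have dG1 i : is_derive t0 (1 : R) (fun t => G t 0 (rshift 1 i)) (v (co_fun K i)).
  apply: (near_eq_is_derive _ (dg _ (@co_smooth _ _ _ K i))).
  by near=> t; rewrite tx_rshift (co_funE i (q := gamma t))//; near: t; exact: nK.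
have dG j : derivable (fun t => G t 0 j) t0 (1 : R).
  case: (splitP j) => k jk.
    by have -> : j = lshift n k; [apply/val_inj|have [] := dG0 k].
  have -> : j = rshift 1 k by apply/val_inj.
  by have [] := dG1 k.
have cz : tset (cimg c) (G t0) by rewrite /tset /= tx_r; exact: cimg_cmap.
have [dL cL] := smooth_on_c1 (toset Ac) (sP _ Ac) cz.
have D := chain_rule dL cL dG.
have -> : dt P t0 (gamma t0) + v (P t0) =
    \sum_i 'D_1 (fun y => G y 0 i) t0 * 'D_(delta_mx 0 i) (lift P c) (G t0).
  rewrite big_split_ord /= big_ord1; have [_ ->] := dG0 0; rewrite mul1r.
  have := rm_dtE t0 sP Ac (cimg_cmap cp); rewrite (cmapK Ac cp) => ->; congr (_ + _).
  rewrite (tan_formula Kp Tv (rm_fix t0 sP)); apply: eq_bigr => i _.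
  by rewrite (tan_lift_D _ _ Kp sP); have [_ ->] := dG1 i.
apply: (near_eq_is_derive _ D).
near=> t; rewrite /= lift_tx (cmapK Ac)//; apply: (co_sub (c := K)).
by near: t; exact: nK.
Unshelve. all: by end_near.
Qed.

Lemma flat_locally_constant (R : realType) n (M : manifold R n) (f : M -> R) p :
  smooth_fun f -> (forall q v, tangent q v -> v f = 0) ->
  \forall q \near p, f q = f p.
Proof.
move=> sf flat; have [K Kp] := coords_at p.
have Ac := co_atlas K; have cp := co_sub Kp; set c := co_chart K in Ac cp.
pose U := cimg c `&` cinv c @^-1` co_dom K.
have oU : open U.
  by apply: (open_preim (cimg_open Ac) _ (co_open K)) => x; exact: cinv_cont Ac.
have Up : U (cmap c p) by split; [exact: cimg_cmap|rewrite /= (cmapK Ac cp)].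
have sfc : smooth_on U (f \o cinv c).
  by apply: smooth_on_sub (smooth_fun_img sf Ac) => x [].
have D0 i x : U x -> 'D_(delta_mx 0 i) (f \o cinv c) x = 0.
  move=> [cx Kx]; have [_ cxK] := cinvP Ac cx; rewrite -cxK -(co_fieldE i Kx sf).
  by apply: flat; have [T _] := @co_vf _ _ _ K i; exact: T.
have /nbhs_ballP[r /= r0 xr] : nbhs (cmap c p) U by exact: open_near.
have nb : \forall q \near p, ball (cmap c p) r (cmap c q).
  by apply: (cmap_cont Ac cp); exact: nbhsx_ballx.
near=> q; have bq : ball (cmap c p) r (cmap c q) by near: q; exact: nb.
have Kq : co_dom K q.
  by near: q; apply: open_nbhs_nbhs; split => //; exact: co_open.
set x0 := cmap c p in bq xr Up *; set x := cmap c q in bq *.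
pose F (t : R) := (f \o cinv c) (x0 + t *: (x - x0)).
have dF (t : R) : 0 <= t <= 1 -> is_derive t (1 : R) F 0.
  move=> /andP[t0 t1].
  have Ut : U (x0 + t *: (x - x0)).
    apply: xr; move: bq; rewrite -!ball_normE /ball_ /= distrC => bq.
    rewrite opprD addNKr normrN normrZ ger0_norm//.
    by apply: le_lt_trans bq; rewrite ler_piMl.
  have [df cf] := smooth_on_c1 oU sfc Ut.
  have dl i : is_derive t (1 : R) (fun t : R => (x0 + t *: (x - x0)) 0 i) (x 0 i - x0 0 i).
    have -> : (fun t : R => (x0 + t *: (x - x0)) 0 i) =
        cst (x0 0 i) + ((x 0 i - x0 0 i) \*: (id : R -> R)).
      by apply/funext => s; rewrite !mxE mulrC.
    have := is_deriveD (is_derive_cst (x0 0 i) t (1 : R)) (is_deriveZ (x 0 i - x0 0 i) (is_derive_id t (1 : R))).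
    by rewrite add0r /GRing.scale /= mulr1.
  have dd i : derivable (fun t : R => (x0 + t *: (x - x0)) 0 i) t (1 : R) by have [] := dl i.
  have d1 := @chain_rule R n _ (f \o cinv c) (fun t : R => x0 + t *: (x - x0)) t 1 df cf dd.
  apply: is_derive_eq d1 _; apply: big1 => i _; by rewrite D0 ?mulr0.
have := int01_ftc (@cont01_cst R 0) dF; rewrite int01_cst /F scale1r scale0r addr0 [x0 + _]addrC subrK /=.
by rewrite /x /x0 (cmapK Ac cp) (cmapK Ac (co_sub Kq)) => /esym/eqP; rewrite subr_eq0 => /eqP.
Unshelve. all: by end_near.
Qed.

(** * The Reeb flow as a reparametrised action *)

Section Reeb.
Variables (R : realType) (n : nat) (M : manifold R n) (rho : R -> M -> M).
Hypothesis act : free_circle_action rho.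
Variable eta : M -> functional M -> R.
Hypothesis eta1 : one_form eta.
Hypothesis flat : forall p w, tangent p w -> dform eta p (act_field rho p) w = 0.
Hypothesis b_neq0 : forall p, act_form rho eta p != 0.
Hypothesis kernel : forall p Z, tangent p Z -> eta p Z = 0 ->
  (forall w, tangent p w -> dform eta p Z w = 0) -> Z = (fun=> 0).

Local Notation V := (act_field rho).
Local Notation b := (act_form rho eta).
Local Notation T := (period rho eta).
Local Notation len := (orbit_length rho eta).

Let sb := act_form_smooth act eta1.
Let sT := period_smooth act eta1.
Let slen := orbit_length_smooth act eta1.

Lemma period_mvt p : exists s, T p = b (rho s p).
Proof.
have D (t : R) : 0 <= t <= 1 -> derivable (len^~ p : R -> R) (0 + (t * 1) *: (1 : R)) (1 : R).
  by move=> _; have [d _] := orbit_length_deriv act eta1 (0 + (t * 1) *: (1 : R)) p.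
have [c _ E] := mvt_line D; exists (0 + (c * 1) *: (1 : R)).
have [_ <-] := orbit_length_deriv act eta1 (0 + (c * 1) *: (1 : R)) p.
rewrite mul1r in E; rewrite -E orbit_length0 subr0 add0r /period.
by rewrite /GRing.scale /= mulr1.
Qed.

Lemma period_neq0 p : T p != 0.
Proof. by have [s ->] := period_mvt p; exact: b_neq0. Qed.

(** The quotient never vanishes along the orbit and is 1 at the time given by the mean value
    theorem; a nonpositive value would produce a zero. *)
Lemma orbit_speed_gt0 s p : 0 < b (rho s p) / T p.
Proof.
have [c cE] := period_mvt p; pose h (t : R) := b (rho t p) / T p.
have ch : continuous h.
  move=> t; apply: cvgM; last exact: cvg_cst.
  have c1 : (t, p) @[t --> t] --> (t, p) by exact: (cvg_pair cvg_id (cvg_cst p)).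
  exact: (cvg_comp _ _ c1 (rm_cont (t := t) (p := p) (act_fun_smooth act sb))).
have hc : h c = 1 by rewrite /h -cE divff// period_neq0.
have h0 t : h t != 0 by rewrite mulf_neq0 ?invr_eq0 ?period_neq0 ?b_neq0.
have [//|neg] := ltP 0 (h s).
have w (x y : R) : {within `[x, y], continuous h} by apply: continuous_subspaceT => t; exact: ch.
have [cs|sc] := leP c s.
  have [|x _ hx] := IVT (v := 0) cs (w _ _).
    by rewrite hc ge_min neg orbT le_max ler01.
  by have := h0 x; rewrite hx eqxx.
have [|x _ hx] := IVT (v := 0) (ltW sc) (w _ _).
  by rewrite hc ge_min neg le_max ler01 orbT.
by have := h0 x; rewrite hx eqxx.
Qed.

(** The Reeb time elapsed after time s of the action, in units in which a full turn takes time 1. *)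
Definition rtime : R -> M -> R := locked (fun s p => len s p / T p).

Lemma rtimeE : rtime = (fun s p => len s p / T p). Proof. by rewrite /rtime -lock. Qed.

Lemma rtime_smooth : smoothRM rtime.
Proof.
rewrite rtimeE; apply: (rmM slen); apply: rm_const; apply: (sfun_inv openT sT) => p _; exact: period_neq0.
Qed.

Lemma rtime_deriv (s : R) p : is_derive s (1 : R) (rtime^~ p) (b (rho s p) / T p).
Proof.
have -> : rtime^~ p = (T p)^-1 \*: (len^~ p) by apply/funext => t; rewrite rtimeE mulrC.
rewrite mulrC; exact: (is_deriveZ (T p)^-1 (orbit_length_deriv act eta1 s p)).
Qed.

Lemma rtime_dt s p : dt rtime s p = b (rho s p) / T p.
Proof. by have [_ E] := rtime_deriv s p. Qed.

Lemma rtime_dt_gt0 s p : 0 < dt rtime s p.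
Proof. by rewrite rtime_dt orbit_speed_gt0. Qed.

Lemma rtime0 p : rtime 0 p = 0. Proof. by rewrite rtimeE orbit_length0 mul0r. Qed.

Lemma rtime1 p : rtime 1 p = 1. Proof. by rewrite rtimeE divff// period_neq0. Qed.

Lemma rtime_period s p : rtime s p * T p = len s p.
Proof. by rewrite rtimeE divfK// period_neq0. Qed.

Lemma rtimeD s t p : rtime (s + t) p = rtime s p + rtime t (rho s p).
Proof.
have sh u : is_derive u (1 : R) (fun h : R => h + s) 1.
  have := is_deriveD (is_derive_id u (1 : R)) (is_derive_cst s u (1 : R)).
  by rewrite addr0.
have d1 u : is_derive u (1 : R) ((rtime^~ p) \o (fun h => h + s)) (b (rho u (rho s p)) / T (rho s p)).
  have := @is_derive1_comp R (rtime^~ p) (fun h => h + s) u _ _ (rtime_deriv (u + s) p) (sh u).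
  by rewrite (period_act act eta1 flat) (actD act) mulr1.
have E : rtime (t + s) p - rtime t (rho s p) = rtime (0 + s) p - rtime 0 (rho s p).
  exact: (same_derivative d1 (fun u => rtime_deriv u (rho s p)) t 0).
have e0 : rtime (0 + s) p - rtime 0 (rho s p) = rtime s p.
  by rewrite (add0r s) (rtime0 (rho s p)) (subr0 (rtime s p)).
have e : rtime (s + t) p = rtime (t + s) p by congr rtime; exact: addrC.
move: E e0 e; generalize (rtime (0 + s) p - rtime 0 (rho s p)) (rtime (t + s) p)
  (rtime (s + t) p) (rtime s p) (rtime t (rho s p)) => x1 x2 x3 x4 x5; lra.
Qed.

Lemma rtime_int (j : int) p : rtime j%:~R p = j%:~R.
Proof.
have step s : rtime (s + 1) p = rtime s p + 1 by rewrite rtimeD rtime1.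
case: j => i; last rewrite NegzE.
  elim: i => [|i IH]; first exact: rtime0.
  by rewrite -addn1 PoszD intrD step IH.
elim: i => [|i IH].
  by have := step (-1); rewrite addNr rtime0 => /eqP; rewrite eq_sym addr_eq0 => /eqP.
have E1 : (- (i.+2%:Z))%:~R + 1 = (- i.+1%:Z)%:~R :> R.
  by rewrite -[X in _ + X](rmorph1 intr) -intrD; congr (_%:~R); lia.
have := step (- (i.+2%:Z))%:~R; rewrite E1 IH => E2.
by apply: (addIr 1); rewrite E1 -E2.
Qed.

Lemma rtime_surj t p : exists s, rtime s p = t.
Proof.
pose m := Num.floor t.
have mt : m%:~R <= t by exact: floor_le_tmp.
have tm : t <= (m + 1)%:~R by apply: ltW; exact: floorD1_gt.
have cr : {within `[m%:~R, (m + 1)%:~R], continuous (rtime^~ p)}.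
  apply: continuous_subspaceT => s.
  by have [d _] := rtime_deriv s p; exact/differentiable_continuous/derivable1_diffP.
have [|s _ E] := IVT (v := t) (le_trans mt tm) cr; last by exists s.
by rewrite (rtime_int m p) (rtime_int (m + 1) p) ge_min le_max mt tm orbT.
Qed.

Definition rinv : R -> M -> R := locked (fun t p => xget 0 [set s | rtime s p = t]).

Lemma rinvK t p : rtime (rinv t p) p = t.
Proof. by rewrite /rinv -lock; have [s E] := rtime_surj t p; exact: (@xgetI _ 0 [set s | rtime s p = t] s E). Qed.

Lemma rtime_inj s t p : rtime s p = rtime t p -> s = t.
Proof. exact: family_inj rtime_smooth rtime_dt_gt0 _ _ _. Qed.

Lemma rinv_smooth : smoothRM rinv.
Proof. exact: inverse_smooth rtime_smooth rtime_dt_gt0 rinvK. Qed.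

Definition reeb_flow : R -> M -> M := locked (fun t p => rho (rinv t p) p).

Lemma reeb_flowE t p : reeb_flow t p = rho (rinv t p) p.
Proof. by rewrite /reeb_flow -lock. Qed.

Lemma reeb_flow0 p : reeb_flow 0 p = p.
Proof.
have E : rinv 0 p = 0 by apply: (@rtime_inj _ _ p); rewrite rinvK rtime0.
by rewrite reeb_flowE E (act0 act).
Qed.

Lemma reeb_flowD s t p : reeb_flow (s + t) p = reeb_flow s (reeb_flow t p).
Proof.
have e : rinv (s + t) p = rinv t p + rinv s (rho (rinv t p) p).
  by apply: (@rtime_inj _ _ p); rewrite rinvK rtimeD !rinvK addrC.
by rewrite !reeb_flowE e addrC (actD act).
Qed.

Lemma reeb_flow_int (j : int) p : reeb_flow j%:~R p = p.
Proof.
have E : rinv j%:~R p = j%:~R by apply: (@rtime_inj _ _ p); rewrite rinvK rtime_int.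
by rewrite reeb_flowE E; have [_ _ H _] := act; apply/H; exists j.
Qed.

Lemma reeb_flow_smooth : smoothRMap reeb_flow.
Proof. rewrite /reeb_flow -lock; exact: rmap_reparam (act_smooth act) rinv_smooth. Qed.

Lemma reeb_flow_map t : smooth_map (reeb_flow t).
Proof. exact: rmap_fix reeb_flow_smooth. Qed.

(** With g = [rinv t], the differential of the flow sends w to d rho_g (w) + w(g) V. Its value under
    eta exceeds eta(w) by the derivative along w of q |-> [orbit_length] (g q) q. This function is t
    T, which every tangent vector kills. *)
Lemma reeb_flow_strict t p w : tangent p w ->
  eta (reeb_flow t p) (dmap (reeb_flow t) w) = eta p w.
Proof.
move=> Tw; have sg : smooth_fun (rinv t) := rm_fix t rinv_smooth.
have sm s := rmap_fix s (act_smooth act).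
rewrite reeb_flowE; set s0 := rinv t p.
have -> : dmap (reeb_flow t) w = (fun f => w (rinv t) * V (rho s0 p) f + dmap (rho s0) w f).
  apply/funext => f; have [sf|nf] := pselect (smooth_fun f); last first.
    have e1 := dmap_nonsmooth (reeb_flow t) w nf.
    have e2 := dmap_nonsmooth (rho s0) w nf.
    have e3 := tan_nonsmooth (act_tangent act (rho s0 p)) nf.
    by rewrite e1 e2 e3 addr0 mulr0.
  rewrite (dmap_smooth _ _ sf) (dmap_smooth _ _ sf).
  have -> : f \o reeb_flow t = (fun q => (fun s q => f (rho s q)) (rinv t q) q).
    by apply/funext => q; rewrite /= reeb_flowE.
  rewrite (tan_reparam (act_fun_smooth act sf) sg Tw) addrC; congr (_ + _).
  rewrite mulrC; congr (_ * _).
  by have [_ E] := act_orbit act s0 p sf; exact: E.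
have [L _] := eta1.
rewrite (L _ _ _ _ (act_tangent act (rho s0 p)) (dmap_tangent (sm s0) Tw)).
rewrite (eta_act act eta1 flat _ Tw).
have E : w (fun q => len (rinv t q) q) = 0.
  have -> : (fun q => len (rinv t q) q) = (fun q => t * T q).
    by apply/funext => q; rewrite -[in RHS](rinvK t q) rtime_period.
  by rewrite (tanZ Tw _ sT) (period_flat act eta1 flat Tw) mulr0.
rewrite (tan_reparam slen sg Tw) (orbit_length_dt act eta1) in E.
rewrite -/(b (rho s0 p)) -/s0 in E *; lra.
Qed.

(** The Reeb field multiplied by T: eta takes the value T on it, and its orbits close up at time
    1. *)
Definition reeb p : functional M := fun f => T p / b p * V p f.

Lemma reeb_vf : vector_field reeb.
Proof.
split=> [p|f sf].
  have := tangent_lin (T p / b p) (act_tangent act p) (tangent_zero p).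
  rewrite /reeb; have -> // : (fun f => T p / b p * V p f + 0) = (fun f => T p / b p * V p f).
  by apply/funext => f; rewrite addr0.
have [_ sV] := act_vf act.
apply: (sfunM openT _ (sV f sf)); apply: (sfunM openT sT).
by apply: (sfun_inv openT sb) => p _; exact: b_neq0.
Qed.

Lemma eta_reeb p : eta p (reeb p) = T p.
Proof. by rewrite /reeb (formZ eta1 _ (act_tangent act p)) divfK// b_neq0. Qed.

Lemma dform_reeb p w : tangent p w -> dform eta p (reeb p) w = 0.
Proof. by move=> Tw; rewrite (dform_scale _ eta1 (act_tangent act p) Tw) flat// mulr0. Qed.

Lemma reeb_flow_deriv f (t : R) p : smooth_fun f ->
  is_derive t (1 : R) (fun t => f (reeb_flow t p)) (reeb (reeb_flow t p) f).
Proof.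
move=> sf; have dg := rm_is_derive t p rinv_smooth.
have dr := rtime_deriv (rinv t p) p.
have E1 : dt rinv t p * (b (reeb_flow t p) / T p) = 1.
  have := @is_derive1_comp R (rtime^~ p) (rinv^~ p) t _ _ dr dg.
  have -> : (rtime^~ p) \o (rinv^~ p) = id by apply/funext => s; rewrite /= rinvK.
  by move=> [_ E]; have [_ E'] := is_derive_id t (1 : R); rewrite mulrC reeb_flowE -E E'.
have df := act_orbit act (rinv t p) p sf.
have := @is_derive1_comp R (fun s => f (rho s p)) (rinv^~ p) t _ _ df dg.
congr (is_derive _ _ _ _); first by apply/funext => s; rewrite /= reeb_flowE.
rewrite /reeb mulrC; congr (_ * _); last by rewrite reeb_flowE.
rewrite reeb_flowE (period_act act eta1 flat).
have b0 := b_neq0 (rho (rinv t p) p); have T0 := period_neq0 p.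
rewrite reeb_flowE in E1; apply: (mulIf (mulf_neq0 b0 (invr_neq0 T0))); rewrite E1.
by rewrite mulrA divfK// divff.
Qed.

(** Uniqueness of integral curves: flowing [gamma t] back by time t gives a curve along which every
    smooth function has derivative zero, and smooth functions separate points. *)
Lemma reeb_curve (gamma : R -> M) : continuous gamma ->
  (forall f t, smooth_fun f -> is_derive t (1 : R) (fun t => f (gamma t)) (reeb (gamma t) f)) ->
  forall t, gamma t = reeb_flow t (gamma 0).
Proof.
move=> cg dg t; have [TR _] := reeb_vf.
suff <- : reeb_flow (- t) (gamma t) = gamma 0 by rewrite -reeb_flowD subrr reeb_flow0.
apply: contrapT => ne; have [f [sf f1 f0]] := smooth_separates ne.
have sN : smoothRM (fun s (_ : M) => - s).
  have -> : (fun (s : R) (_ : M) => - s) = (fun s _ => (-1) * s).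
    by apply: funext => s; apply: funext => q; rewrite mulN1r.
  apply: (rmM _ (@rm_time R n M)).
  by apply: (@rm_const _ _ _ (fun=> -1)); apply: (sfun_cst openT).
have sP : smoothRM (fun s q => f (reeb_flow (- s) q)).
  exact: (rm_reparam (P := fun s q => f (reeb_flow s q)) (rm_comp reeb_flow_smooth sf) sN).
have E : f (reeb_flow (- t) (gamma t)) = f (reeb_flow (- 0) (gamma 0)).
  apply: (is_derive_0_is_cst (f := fun t => f (reeb_flow (- t) (gamma t)))) => s.
  have := @curve_derive R n M _ gamma s (reeb (gamma s)) sP (cg s) (TR _) (fun f => dg f s).
  congr (is_derive _ _ _ _).
  set q := gamma s.
  have d1 : dt (fun s q => f (reeb_flow (- s) q)) s q = - reeb (reeb_flow (- s) q) f.
    have dN : is_derive s (1 : R) (fun s : R => - s) (-1).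
      exact: (is_deriveN (is_derive_id s (1 : R))).
    have [_ E0] := @is_derive1_comp R (fun s => f (reeb_flow s q)) (fun s => - s) s _ _
      (reeb_flow_deriv (- s) q sf) dN.
    by apply: (etrans E0); rewrite mulrN1.
  have d2 : reeb q (fun q => f (reeb_flow (- s) q)) = reeb (reeb_flow (- s) q) f.
    have sfs : smooth_fun (fun q => f (reeb_flow (- s) q)) := rm_fix s sP.
    have [_ E1] := reeb_flow_deriv 0 q sfs; rewrite reeb_flow0 in E1.
    have [_ E2] := reeb_flow_deriv 0 (reeb_flow (- s) q) sf; rewrite reeb_flow0 in E2.
    rewrite -E1 -E2; congr ('D__ _ _); apply/funext => h.
    by rewrite -!reeb_flowD addrC.
  by rewrite d1 d2 addNr.
by move: E; rewrite f1 oppr0 reeb_flow0 f0 => /eqP; rewrite oner_eq0.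
Qed.

(** Both vectors take the value T under eta and are in the kernel of d eta, the image by naturality;
    their difference lies in the common kernel of eta and d eta. *)
Lemma strict_reeb (phi psi : M -> M) p : smooth_map phi -> smooth_map psi ->
  cancel phi psi -> cancel psi phi ->
  (forall p v, tangent p v -> eta (phi p) (dmap phi v) = eta p v) ->
  T (phi p) = T p -> dmap phi (reeb p) = reeb (phi p).
Proof.
move=> s1 s2 k1 k2 st TT; have [TR _] := reeb_vf.
have Td := dmap_tangent s1 (TR p).
pose Z f := (-1) * reeb (phi p) f + dmap phi (reeb p) f.
have TZ : tangent (phi p) Z by exact: tangent_lin (TR _) Td.
have Z0 : Z = (fun=> 0).
  apply: (kernel TZ).
    by have [L _] := eta1; rewrite (L _ _ _ _ (TR _) Td) (st _ _ (TR p)) !eta_reeb TT; lra.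
  move=> w Tw; have [K Kp] := coords_at (phi p).
  have Tw' : tangent p (dmap psi w) by have := dmap_tangent s2 Tw; rewrite k1.
  have wE : w = dmap phi (dmap psi w).
    apply/funext => f; have [sf|nf] := pselect (smooth_fun f); last first.
      by rewrite (tan_nonsmooth Tw nf) (dmap_nonsmooth _ _ nf).
    rewrite (dmap_smooth _ _ sf) (dmap_smooth _ _ (smooth_map_comp s1 sf)).
    by congr w; apply/funext => q; rewrite /= k2.
  have e1 : dform eta (phi p) (dmap phi (reeb p)) w = 0.
    by rewrite wE (dform_natural eta1 s1 s2 k1 k2 st (TR p) Tw') dform_reeb.
  have e2 := dform_reeb (p := phi p) Tw.
  rewrite (dform_coord eta1 Kp TZ Tw); rewrite (dform_coord eta1 Kp Td Tw) in e1.
  rewrite (dform_coord eta1 Kp (TR _) Tw) in e2.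
  have E : \sum_i \sum_j Z (co_fun K i) * w (co_fun K j) * dcoef eta K (phi p) i j =
    (-1) * \sum_i \sum_j reeb (phi p) (co_fun K i) * w (co_fun K j) * dcoef eta K (phi p) i j +
    \sum_i \sum_j dmap phi (reeb p) (co_fun K i) * w (co_fun K j) * dcoef eta K (phi p) i j.
    rewrite mulr_sumr -big_split /=; apply: eq_bigr => i _.
    rewrite mulr_sumr -big_split /=; apply: eq_bigr => j _.
    by rewrite /Z; lra.
  by rewrite E e1 e2 mulr0 addr0.
apply/funext => f; have := congr1 (fun u => u f) Z0; rewrite /Z; lra.
Qed.

Lemma strict_commute (phi psi : M -> M) t p : smooth_map phi -> smooth_map psi ->
  cancel phi psi -> cancel psi phi ->
  (forall p v, tangent p v -> eta (phi p) (dmap phi v) = eta p v) ->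
  (forall p, T (phi p) = T p) -> phi (reeb_flow t p) = reeb_flow t (phi p).
Proof.
move=> s1 s2 k1 k2 st TT.
have cg : continuous (fun t => phi (reeb_flow t p)).
  have c1 : smoothRMap (fun t p => phi (reeb_flow t p)).
    move=> c Ac; have := reeb_flow_smooth Ac => H.
    exact: (smooth_from_postcomp (toset Ac) openT H s1).
  move=> u; have cu : (u, p) @[u --> u] --> (u, p) by exact: (cvg_pair cvg_id (cvg_cst p)).
  exact: (cvg_comp _ _ cu (rmap_cont (t := u) (p := p) c1)).
have dg f (u : R) : smooth_fun f ->
    is_derive u (1 : R) (fun t => f (phi (reeb_flow t p))) (reeb (phi (reeb_flow u p)) f).
  move=> sf; have := reeb_flow_deriv u p (smooth_map_comp s1 sf).
  by rewrite -(strict_reeb s1 s2 k1 k2 st (TT _)) (dmap_smooth _ _ sf).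
by have := reeb_curve cg dg t; rewrite reeb_flow0.
Qed.

Lemma period_locally_constant p : \forall q \near p, T q = T p.
Proof. by apply: (flat_locally_constant p sT) => q v Tv; exact: (period_flat act eta1 flat Tv). Qed.

End Reeb.

(** * The C^oo topology *)

Lemma open_nbhs_at (T : topologicalType) (U : set T) x : open U -> U x -> nbhs x U.
Proof. by move=> oU Ux; exact: open_nbhs_nbhs. Qed.

Section CinfTopology.
Variables (R : realType) (n m : nat) (M : manifold R n) (N : manifold R m).

Lemma Cinf_subbase_open (U : set (Cinf M N)) : Cinf_subbase U -> open U.
Proof.
move=> sU; exists [set U]; last by rewrite bigcup_set1.
by move=> _ ->; exact: (@finI_from1 _ _ (@Cinf_subbase R n m M N) id U sU).
Qed.

Lemma Cinf_cvg (T : topologicalType) (F : T -> Cinf M N) x :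
  (forall U, Cinf_subbase U -> U (F x) -> \forall y \near x, U (F y)) ->
  {for x, continuous F}.
Proof.
move=> HF A; rewrite /= nbhsE; move=> [ O [ oO Ox] OA].
have [D DI DO] := oO.
move: Ox; rewrite -DO; move=> [B DB Bx].
have [E ED EB] := DI B DB.
have : \forall y \near x, (\bigcap_(i in [set` E]) (fun U => F @^-1` U) i) y.
  apply: filter_bigI => U UE; apply: HF; first by apply: set_mem; exact: ED U UE.
  by move: Bx; rewrite -EB; apply.
apply: filterS => y Hy; apply: OA; rewrite -DO; exists B => //.
by rewrite /= -EB => U UE; exact: Hy.
Qed.

(** A compact neighbourhood of p0 whose image under phi0 stays near phi0 p0 in one chart gives a
    subbasic neighbourhood of order 0; this makes evaluation jointly continuous. *)
Lemma Cinf_eval_cvg (phi0 : Cinf M N) (p0 : M) :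
  (fun z : Cinf M N * M => cinf_fun z.1 z.2) z @[z --> (phi0, p0)] --> phi0 p0.
Proof.
move=> A; rewrite /= nbhsE; move=> [ O [ oO Op] OA].
have [d Ad dp] := chart_at (phi0 p0); have [c Ac cp] := chart_at p0.
pose y0 := cmap d (phi0 p0).
have oV : open (cimg d `&` cinv d @^-1` O).
  by apply: (open_preim (cimg_open Ad) _ oO) => x; exact: cinv_cont Ad.
have Vy : (cimg d `&` cinv d @^-1` O) y0.
  by split; [exact: cimg_cmap|rewrite /= (cmapK Ad dp)].
have /nbhs_ballP[e /= e0 yV] := open_nbhs_at oV Vy.
have cphi : continuous phi0.
  move=> p; have [c1 Ac1 c1p] := chart_at p; have [cf _] := cinf_smooth phi0 Ac1.
  have cx := cf (cmap c1 p) (ex_intro2 _ _ p (conj c1p Logic.I) erefl).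
  have cc := continuous_comp (cmap_cont Ac1 c1p) cx.
  apply: (near_continuous _ cc).
  apply: filterS (open_nbhs_at (cdom_open Ac1) c1p) => q c1q.
  by rewrite /= (cmapK Ac1 c1q).
pose W := setT `&` phi0 @^-1` cdom d.
have oW : open W by apply: (open_preim openT _ (cdom_open Ad)) => x _; exact: cphi.
pose W2 := W `&` (cmap d \o phi0) @^-1` ball y0 (e / 2).
have e2 : 0 < e / 2 by rewrite divr_gt0.
have oW2 : open W2.
  have ob : open (ball y0 (e / 2)) by exact: ball_open.
  apply: (open_preim oW _ ob).
  by move=> x [_ dx]; apply: (continuous_comp (cphi x)); exact: cmap_cont Ad dx.
have W2p : W2 p0 by split => //; apply: ballxx; rewrite divr_gt0.
have [chi [K [ O1 [_ [kK KO] _ [ oO1 O1p] [ O1K _]]]]] := chart_bump_compact Ac cp oW2 W2p.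
pose U := Cinf_nbhd phi0 c d K 0 (e / 2).
have sU : Cinf_subbase U.
  exists phi0, c, d, K, 0%N, (e / 2); split; last by [].
  split => //; first by move=> q /KO[].
  by move=> _ [q /KO[[[_ ?] _] _] <-].
have nU : nbhs phi0 U.
  apply: open_nbhs_nbhs; split; first exact: Cinf_subbase_open.
  move=> q Kq; split; first by have [[[_ ?] _] _] := KO q Kq.
  by move=> s i _; rewrite subrr normr0.
have nO1 : nbhs p0 O1 by exact: open_nbhs_at.
exists (U, O1); first by split.
move=> [phi p] [/= Uphi O1p']; apply: OA.
have Kp := O1K _ O1p'; have [dphi H] := Uphi p Kp.
have [[_ bp] cpp] := KO p Kp.
rewrite -(cmapK Ad dphi); suff : ball y0 e (cmap d (phi p)) by move=> /yV[].
move: bp; rewrite /= -!ball_normE /ball_ /= => bp.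
rewrite -(subrK (cmap d (phi0 p)) y0) -addrA; apply: le_lt_trans (ler_normD _ _) _.
have : `|cmap d (phi0 p) - cmap d (phi p)| < e / 2.
  rewrite [ltLHS]/Num.Def.normr/= mx_normrE; apply/bigmax_ltP; split => // -[a i] _.
  rewrite !mxE (ord1 a); have := H [::] i isT.
  by rewrite /= (cmapK Ac cpp).
by lra.
Qed.

End CinfTopology.

(** * Smooth families as continuous curves of maps *)

Section CurveInCinf.
Variables (R : realType) (n m : nat) (M : manifold R n) (N : manifold R m).

Lemma partial_tx k (Q : 'rV[R]_(1 + k) -> R) (W : set 'rV[R]_(1 + k)) s t x :
  open W -> smooth_on W Q -> W (tx t x) ->
  partial s (fun x => Q (tx t x)) x = partial (map (@rshift 1 _) s) Q (tx t x).
Proof.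
move=> oW sQ; have ct (y : 'rV[R]_k) : {for y, continuous (tx t)}.
  have ci : (fun z : 'rV[R]_k => z) z @[z --> y] --> y by exact: cvg_id.
  have cc : (fun _ : 'rV[R]_k => t) z @[z --> y] --> t by exact: cst_continuous.
  have c1 : (t, z) @[z --> y] --> (t, y) by exact: (cvg_pair cc ci).
  exact: (cvg_comp _ _ c1 (tx_cvg (t := t) (x := y))).
elim: s x => [//|i s IH] x Wx /=.
have nW : \forall y \near x, W (tx t y) by apply: ct; exact: open_nbhs_at.
have [_ <-] := is_derive_tx_r (smooth_on_derivable (rshift 1 i) (smooth_on_partial (map (@rshift 1 _) s) sQ) Wx).
by apply: near_eq_derive; apply: filterS nW => y; exact: IH.
Qed.

(** The derivatives in x are continuous in (t, x). Finitely many strict inequalities hold at t0 over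
    a compact set, and compactness makes them persist for all nearby times. *)
Lemma rmap_Cinf_continuous (F : R -> M -> N) (sF : forall t, smooth_map (F t)) :
  smoothRMap F -> continuous (fun t => MkCinf (sF t)).
Proof.
move=> smF t0; apply: Cinf_cvg => U [f [c [d [K [r [e [[Ac Ad kK Kc fK] [e0 ->]]]]]]]] HU.
have nc := (compact_near_coveringP K).1 kK.
(* Sequences of length at most r form a finite type, so the conditions on all derivatives can be
   gathered in one neighbourhood. *)
pose good t p := cdom d (F t p) /\
  forall (s : {bseq r of 'I_n}) i,
   `|partial s (fun x => cmap d (f (cinv c x)) 0 i) (cmap c p)
         - partial s (fun x => cmap d (F t (cinv c x)) 0 i) (cmap c p)| < e.
suff H : \forall t \near t0, K `<=` good t.
  apply: filterS H => t Ht p Kp; have [dp H] := Ht p Kp; split => // s i sr.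
  exact: (H (Bseq sr)).
apply: (nc R (nbhs t0) good) => p Kp; have cp := Kc p Kp; have Ac' := Ac.
have [dp0 H0] := HU p Kp.
pose Fh (z : 'rV[R]_(1 + n)) := F (lsubmx z 0 0) (cinv c (rsubmx z)).
have [cFh sFh] := smF c Ac.
pose W := tset (cimg c) `&` Fh @^-1` cdom d.
have oW : open W by apply: (open_preim (toset Ac) cFh (cdom_open Ad)).
have Wz : W (tx t0 (cmap c p)).
  split; first by rewrite /tset /= tx_r; exact: cimg_cmap.
  by rewrite /= /Fh tx_l tx_r (cmapK Ac cp).
pose Q i z := cmap d (Fh z) 0 i.
have sQ i : smooth_on W (Q i) := sFh d Ad i.
have [cf sf] := cinf_smooth f Ac.
pose W2 := cmap c @` (cdom c `&` setT) `&` (f \o cinv c) @^-1` cdom d.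
have s2 i : smooth_on W2 (fun x => cmap d (f (cinv c x)) 0 i) := sf d Ad i.
have W2p : W2 (cmap c p).
  split; first by exists p.
  by rewrite /= (cmapK Ac cp); apply: fK; exists p.
have cz : (fun w : M * R => tx w.2 (cmap c w.1)) w @[w --> (p, t0)] --> tx t0 (cmap c p).
  have c1 : (fun w : M * R => cmap c w.1) w @[w --> (p, t0)] --> cmap c p.
    have cf1 : (fun w : M * R => w.1) w @[w --> (p, t0)] --> p by exact: cvg_fst.
    exact: (cvg_comp _ _ cf1 (cmap_cont Ac cp)).
  have c2 : (fun w : M * R => w.2) w @[w --> (p, t0)] --> t0 by exact: cvg_snd.
  have c3 : (w.2, cmap c w.1) @[w --> (p, t0)] --> (t0, cmap c p) by exact: (cvg_pair c2 c1).
  exact: (cvg_comp _ _ c3 (tx_cvg (t := t0) (x := cmap c p))).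
have nW : \forall w \near (p, t0), W (tx w.2 (cmap c w.1)).
  by apply: cz; exact: open_nbhs_at.
have ncd : \forall w \near (p, t0), cdom c w.1.
  have cf1 : (fun w : M * R => w.1) w @[w --> (p, t0)] --> p by exact: cvg_fst.
  by apply: cf1; exact: open_nbhs_at (cdom_open Ac) cp.
have E t (s : seq 'I_n) i x : W (tx t x) ->
    partial s (fun x => cmap d (F t (cinv c x)) 0 i) x = partial (map (@rshift 1 _) s) (Q i) (tx t x).
  move=> Wx; rewrite -(partial_tx s oW (sQ i) Wx); congr (partial _ _ _).
  by apply/funext => y; rewrite /Q /Fh tx_l tx_r.
have nH (s : {bseq r of 'I_n}) (i : 'I_m) : \forall w \near (p, t0),
   `|partial s (fun x => cmap d (f (cinv c x)) 0 i) (cmap c w.1)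
      - partial (map (@rshift 1 _) s) (Q i) (tx w.2 (cmap c w.1))| < e.
  have cq := cvg_comp _ _ cz (smooth_on_cont (smooth_on_partial (map (@rshift 1 _) s) (sQ i)) Wz).
  have cf1 : (fun w : M * R => w.1) w @[w --> (p, t0)] --> p by exact: cvg_fst.
  have c1 := cvg_comp _ _ cf1 (cmap_cont Ac cp).
  have c2 := cvg_comp _ _ c1 (smooth_on_cont (smooth_on_partial s (s2 i)) W2p).
  have c3 := cvg_norm (cvgB c2 cq).
  have lt : `|partial s (fun x => cmap d (f (cinv c x)) 0 i) (cmap c p) -
       partial (map (@rshift 1 _) s) (Q i) (tx t0 (cmap c p))| < e.
    by rewrite -(E t0 s i _ Wz); apply: H0; exact: size_bseq.
  have c4 : (fun w : M * R => `|partial s (fun x => cmap d (f (cinv c x)) 0 i) (cmap c w.1)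
      - partial (map (@rshift 1 _) s) (Q i) (tx w.2 (cmap c w.1))|) w @[w --> (p, t0)] -->
     `|partial s (fun x => cmap d (f (cinv c x)) 0 i) (cmap c p) -
       partial (map (@rshift 1 _) s) (Q i) (tx t0 (cmap c p))| by exact: c3.
  exact: (cvgr_lt _ c4 _ lt).
have nHH : \forall w \near (p, t0), forall (s : {bseq r of 'I_n}) (i : 'I_m),
   `|partial s (fun x => cmap d (f (cinv c x)) 0 i) (cmap c w.1)
      - partial (map (@rshift 1 _) s) (Q i) (tx w.2 (cmap c w.1))| < e.
  have nHs s := filter_forall (nbhs_filter (p, t0)) (nH s).
  exact: (filter_forall (nbhs_filter (p, t0)) nHs).
near=> w; have Ww : W (tx w.2 (cmap c w.1)) by near: w; exact: nW.
have cw : cdom c w.1 by near: w; exact: ncd.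
have Hw : forall (s : {bseq r of 'I_n}) (i : 'I_m),
   `|partial s (fun x => cmap d (f (cinv c x)) 0 i) (cmap c w.1)
      - partial (map (@rshift 1 _) s) (Q i) (tx w.2 (cmap c w.1))| < e.
  by near: w; exact: nHH.
split; first by have [_] := Ww; rewrite /= /Fh tx_l tx_r (cmapK Ac cw).
by move=> s i; rewrite (E _ _ _ _ Ww); exact: Hw.
Unshelve. all: by end_near.
Qed.

End CurveInCinf.

(** * Equivariant maps and loops *)

Lemma rot_int (R : realType) (j : int) (z : R * R) : rot (2 * pi * j%:~R) z = z.
Proof.
have r1 w : rot (2 * pi) w = w :> R * R.
  have -> : 2 * pi = pi + pi :> R by lra.
  by rewrite rotD /rot !cospi !sinpi; case: w => x y /=; congr (_, _); lra.
case: j => i; last rewrite NegzE.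
  elim: i => [|i IH]; first by rewrite mulr0 rot0.
  by rewrite -[i.+1]addn1 PoszD intrD mulrDr rotD mulr1 r1 IH.
elim: i.+1 => [|l IH]; first by rewrite oppr0 mulr0 rot0.
rewrite -[RHS]IH -[LHS]r1 -rotD; congr rot.
by rewrite -[l.+1]addn1 PoszD opprD intrD; lra.
Qed.

Lemma cos_gt0_half (R : realType) (y : R) : `|y| <= pi -> 0 < cos y -> - (pi / 2) < y < pi / 2.
Proof.
wlog y0 : y / 0 <= y.
  move=> W ypi cy; have [/W|yneg] := leP 0 y; first by apply.
  have /andP[] : - (pi / 2) < - y < pi / 2 by apply: W; rewrite ?normrN ?cosN ?oppr_ge0// ltW.
  by move=> h1 h2; apply/andP; split; lra.
rewrite ger0_norm// => ypi cy.
have pi0 := pi_gt0 R.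
apply/andP; split; first by lra.
rewrite ltNge; apply/negP => y2; have : 0 <= sin (y - pi / 2).
  by apply: sin_ge0_pi; apply/andP; split; lra.
have -> : sin (y - pi / 2) = - cos y by rewrite sinB cos_pihalf sin_pihalf mulr0 mulr1 sub0r.
by lra.
Qed.

Lemma smooth_map_on_cont (R : realType) n m (M : manifold R n) (N : manifold R m)
    (W : set M) (F : M -> N) p : open W -> smooth_map_on W F -> W p -> {for p, continuous F}.
Proof.
move=> oW sF Wp; have [c Ac cp] := chart_at p; have [cf _] := sF c Ac.
have cx := cf (cmap c p) (ex_intro2 _ _ p (conj cp Wp) erefl).
have cc := continuous_comp (cmap_cont Ac cp) cx.
apply: (near_continuous _ cc).
apply: filterS (open_nbhs_at (cdom_open Ac) cp) => q cq.
by rewrite /= (cmapK Ac cq).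
Qed.

(** * Equivariant maps to C^L *)

Section Phase.
Variables (R : realType) (n m : nat) (M : manifold R n) (N : manifold R m).
Variables (rho : R -> M -> M) (proj : M -> N) (eta : M -> functional M -> R).
Hypothesis bundle : circle_bundle rho proj.
Let act : free_circle_action rho. Proof. by have [H _ _ _] := bundle. Qed.
Hypothesis eta1 : one_form eta.
Hypothesis flat : forall p w, tangent p w -> dform eta p (act_field rho p) w = 0.
Hypothesis b_neq0 : forall p, act_form rho eta p != 0.

Local Notation rtime := (rtime rho eta).
Local Notation flow := (reeb_flow rho eta).

Let proj_cont : continuous proj.
Proof. by have [_ sp _ _] := bundle; move=> p; exact: (smooth_map_on_cont openT sp). Qed.

Lemma proj_act t p : proj (rho t p) = proj p.
Proof. by have [_ _ H _] := bundle; apply/H; exists (- t); rewrite -(actD act) addNr (act0 act). Qed.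

Section Local.
Variables (U : set N) (sec : N -> M) (a b : M -> R).
Hypothesis oU : open U.
Hypothesis triv : local_trivialization rho proj U sec a b.

Let theta p := xget 0 [set t | p = rho t (sec (proj p))].

(** The trivialising functions a, b are equivariant for rho only; they are replaced by the Reeb time
    from the section to p, seen on the circle. The parameter [theta] is unique up to an integer,
    which amounts to full rotations. *)
Definition phase p : R * R := rot (2 * pi * rtime (theta p) (sec (proj p))) (1, 0).

Lemma theta_ex p : U (proj p) -> exists t, p = rho t (sec (proj p)).
Proof.
move=> Up; have [_ _ H _] := bundle; have [[_ hsec] _ _ _ _] := triv.
by apply/H; have [-> _ _] := hsec _ Up.
Qed.

Lemma phaseE p t : p = rho t (sec (proj p)) ->
  phase p = rot (2 * pi * rtime t (sec (proj p))) (1, 0).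
Proof.
move=> pt; have th : p = rho (theta p) (sec (proj p)).
  exact: (@xgetI _ 0 [set t | p = rho t (sec (proj p))] t pt).
rewrite /phase; set q := sec (proj p) in pt th *; set s := theta p in th *.
have [_ _ per _] := act.
have E : rho (s - t) q = q.
  by rewrite addrC (actD act) -th pt -(actD act) addNr (act0 act).
have /per[j jE] := E.
have -> : s = j%:~R + t by rewrite -jE subrK.
rewrite (rtimeD act eta1 flat) (rtime_int act eta1 flat b_neq0).
have [_ _ H _] := act; have -> : rho j%:~R q = q by apply/H; exists j.
by rewrite mulrDr addrC rotD rot_int.
Qed.

Lemma phase_flow t p : U (proj p) -> phase (flow t p) = rot (2 * pi * t) (phase p).
Proof.
move=> Up; have [s sE] := theta_ex Up.
have pf : proj (flow t p) = proj p by rewrite reeb_flowE proj_act.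
have E : flow t p = rho (s + rinv rho eta t p) (sec (proj (flow t p))).
  by rewrite pf reeb_flowE addrC (actD act) -sE.
rewrite (phaseE E) (phaseE sE) pf (rtimeD act eta1 flat) -sE.
rewrite (rinvK act eta1 flat b_neq0) -rotD; congr rot; lra.
Qed.

(** The chosen parameter [theta] may jump. Near p0 it can be replaced by t0 plus the angle, in
    turns, between the values of (a, b) at p0 and at p, which is continuous. *)
Lemma phase_cont p0 : U (proj p0) ->
  {for p0, continuous (fun p => (phase p).1)} /\ {for p0, continuous (fun p => (phase p).2)}.
Proof.
move=> Up0; have [[ssec hsec] sa sb ab1 hab] := triv.
have [t0 t0E] := theta_ex Up0.
have oP : open (proj @^-1` U) by rewrite -(setTI (_ @^-1` _)); apply: open_preim openT _ oU => p _; exact: proj_cont.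
have ca := smooth_fun_on_cont oP sa (Up0 : (proj @^-1` U) p0).
have cb := smooth_fun_on_cont oP sb (Up0 : (proj @^-1` U) p0).
have cs : {for p0, continuous (sec \o proj)}.
  exact: (continuous_comp (@proj_cont p0) (smooth_map_on_cont oU ssec Up0)).
pose z0 := (a p0, b p0).
have abE p t : U (proj p) -> p = rho t (sec (proj p)) -> (a p, b p) = rot (2 * pi * t) (1, 0).
  move=> Up pE; have [h1 h2 h3] := hsec _ Up.
  have [] := hab (sec (proj p)) t (_ : U (proj (sec (proj p)))); first by rewrite h1.
  by rewrite -pE h2 h3 /rot /= => -> ->.
pose A p := angle z0 (a p, b p).
have cdot0 : cdot z0 z0 = 1 by rewrite /cdot /=; have := ab1 p0 Up0; rewrite !expr2.
have ccdot : {for p0, continuous (fun p => cdot z0 (a p, b p))}.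
  exact: (cvgD (cvgM ca (cvg_cst (a p0))) (cvgM cb (cvg_cst (b p0)))).
have ccdet : {for p0, continuous (fun p => cdet z0 (a p, b p))}.
  exact: (cvgB (cvgM cb (cvg_cst (a p0))) (cvgM ca (cvg_cst (b p0)))).
have cA : {for p0, continuous A}.
  have cq : {for p0, continuous (fun p => cdet z0 (a p, b p) / cdot z0 (a p, b p))}.
    apply: (cvgM ccdet); apply: cvgV ccdot; rewrite -/z0 cdot0; exact: oner_neq0.
  exact: (continuous_comp cq (@continuous_atan R _)).
have A0 : A p0 = 0.
  have d0 : cdet z0 z0 = 0 by rewrite /cdet mulrC subrr.
  by rewrite /A /angle -/z0 d0 mul0r atan0.
pose g p := 2 * pi * rtime (t0 + A p / (2 * pi)) (sec (proj p)).
have cg : {for p0, continuous g}.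
  have c1 : (fun p => t0 + A p / (2 * pi)) p @[p --> p0] --> t0.
    have := cvgD (cvg_cst t0) (cvgM cA (cvg_cst (2 * pi)^-1)).
    by rewrite A0 mul0r addr0; exact.
  have c2 : (t0 + A p / (2 * pi), sec (proj p)) @[p --> p0] --> (t0, sec (proj p0)).
    exact: (cvg_pair c1 cs).
  have c3 := cvg_comp _ _ c2 (rm_cont (t := t0) (p := sec (proj p0)) (rtime_smooth act eta1 b_neq0)).
  have c4 : g p @[p --> p0] --> 2 * pi * rtime t0 (sec (proj p0)) by exact: (cvgM (cvg_cst (2 * pi)) c3).
  by rewrite /prop_for /continuous_at {2}/g A0 mul0r addr0.
have near_g : \forall p \near p0, phase p = rot (g p) (1, 0).
  have n1 : \forall p \near p0, 0 < cdot z0 (a p, b p).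
    have pos : 0 < cdot z0 (a p0, b p0) by rewrite -/z0 cdot0 ltr01.
    exact: (cvgr_gt _ ccdot _ pos).
  near=> p; have Up : U (proj p) by near: p; apply: (open_nbhs_at oP Up0).
  have dp : 0 < cdot z0 (a p, b p) by near: p; exact: n1.
  have [t tE] := theta_ex Up.
  (* The representative modulo integers that lies within half a turn of [t0]. *)
  pose k := Num.floor (t - t0 + 1 / 2); pose t1 := t - k%:~R.
  have k1 : k%:~R <= t - t0 + 1 / 2 by exact: floor_le_tmp.
  have k2 : t - t0 + 1 / 2 < (k + 1)%:~R by exact: floorD1_gt.
  have t1E : p = rho t1 (sec (proj p)).
    have [_ _ per _] := act.
    have -> : t1 = t + (- k)%:~R by rewrite /t1 intrN.
    by rewrite (actD act) [rho (- k)%:~R _](_ : _ = sec (proj p))//; apply/per; exists (- k).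
  have dt : - (1 / 2) <= t1 - t0 <= 1 / 2.
    by rewrite intrD in k2; apply/andP; rewrite /t1; split; lra.
  rewrite (phaseE t1E) /g; congr (rot (2 * pi * rtime _ _) _).
  have pi0 := pi_gt0 R.
  have zE : (a p, b p) = rot (2 * pi * (t1 - t0)) z0.
    by rewrite /z0 (abE _ _ Up t1E) (abE _ _ Up0 t0E) -rotD; congr rot; lra.
  (* Since the values of (a, b) at p0 and p are close, half a turn shrinks to a quarter turn, the
     range in which [angle] is faithful. *)
  have cpos : 0 < cos (2 * pi * (t1 - t0)).
    move: dp; rewrite zE (_ : cdot _ _ = cos (2 * pi * (t1 - t0)) * (z0.1 ^+ 2 + z0.2 ^+ 2)).
      by have -> : z0.1 ^+ 2 + z0.2 ^+ 2 = 1; [exact: ab1|rewrite mulr1].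
    by rewrite /cdot /rot /=; lra.
  rewrite /A zE angle_rotr.
  - have nz : 2 * pi != 0 :> R by rewrite mulf_neq0// lt0r_neq0.
    by rewrite [2 * pi * _]mulrC mulfK// addrC subrK.
  - by rewrite (_ : z0.1 ^+ 2 + z0.2 ^+ 2 = 1); [exact: ltr01|exact: ab1].
  - apply: cos_gt0_half cpos; rewrite normrM gtr0_norm ?mulr_gt0//.
    have : `|t1 - t0| <= 1 / 2 by rewrite ler_norml.
    by nra.
have cc : {for p0, continuous (fun p => cos (g p))} by exact: (continuous_comp cg (@continuous_cos R _)).
have cn : {for p0, continuous (fun p => sin (g p))} by exact: (continuous_comp cg (@continuous_sin R _)).
split.
  apply: (near_continuous _ cc); apply: filterS near_g => p ->.
  by rewrite /rot /= mulr1 mulr0 subr0.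
apply: (near_continuous _ cn); apply: filterS near_g => p ->.
by rewrite /rot /= mulr1 mulr0 addr0.
Unshelve. all: by end_near.
Qed.

End Local.

(* One component of an equivariant map to C^L: a phase multiplied by a cutoff
   function on the base. *)
Lemma local_equivariant x : exists (v : M -> R * R) (O1 : set N),
  [/\ continuous (fun p => (v p).1), continuous (fun p => (v p).2),
      forall t p, v (flow t p) = rot (2 * pi * t) (v p),
      open O1 /\ O1 x & forall p, O1 (proj p) -> (v p).1 != 0 \/ (v p).2 != 0].
Proof.
have [_ _ _ /(_ x)[U [sec [a [b [oU Ux triv]]]]]] := bundle.
have [c Ac cx] := chart_at x.
have [chi [F [ O1 [schi [cF FO] chi0 [ oO1 O1x] [ O1F chi1]]]]] := chart_bump Ac cx oU Ux.
pose v p : R * R := (chi (proj p) * (phase sec p).1, chi (proj p) * (phase sec p).2).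
have cchi : continuous (chi \o proj).
  move=> p; exact: (continuous_comp (@proj_cont p) (smooth_fun_cont schi (x := proj p))).
have oF : open (~` (proj @^-1` F)).
  by rewrite preimage_setC -(setTI (_ @^-1` _)); apply: open_preim openT _ (closed_openC cF) => p _; exact: proj_cont.
have cut (h : M -> R) p : (U (proj p) -> {for p, continuous h}) ->
    {for p, continuous (fun p => chi (proj p) * h p)}.
  move=> ch; have [Fp|Fp] := pselect (F (proj p)).
    by have [Up _] := FO _ Fp; exact: (cvgM (@cchi p) (ch Up)).
  apply: (near_continuous (f := fun=> 0)); last exact: cst_continuous.
  by apply: filterS (open_nbhs_at oF Fp) => q Fq; rewrite chi0 ?mul0r.
exists v, O1; split => //.
- by move=> p; apply: cut => Up; have [] := phase_cont oU triv Up.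
- by move=> p; apply: cut => Up; have [] := phase_cont oU triv Up.
- move=> t p; have pf : proj (flow t p) = proj p by rewrite reeb_flowE proj_act.
  rewrite /v pf; have [Fp|/chi0 ->] := pselect (F (proj p)).
    have [Up _] := FO _ Fp; rewrite (phase_flow triv t Up) /rot /=.
    by congr (_, _); lra.
  by rewrite /rot /= !mul0r !mulr0 subr0 addr0.
- move=> p O1p; rewrite /v /= (chi1 _ O1p) !mul1r /phase; set th := 2 * pi * _.
  have E := rot_sqr th ((1 : R), (0 : R)).
  have [e1|/eqP] := eqVneq (rot th (1, 0)).1 0; last by left; apply/eqP.
  right; apply/eqP => e2'; have e2 : (rot th (1, 0)).2 = 0 := e2'.
  move: E; rewrite e1 e2 [RHS]/= expr1n !expr0n !addr0 => /eqP.
  by rewrite eq_sym oner_eq0.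
Qed.

Lemma equivariant_map : compact [set: N] ->
  exists L (u : 'I_L -> M -> R * R),
  [/\ forall i, continuous (fun p => (u i p).1), forall i, continuous (fun p => (u i p).2),
      forall i t p, u i (flow t p) = rot (2 * pi * t) (u i p) &
      forall p, exists i, (u i p).1 != 0 \/ (u i p).2 != 0].
Proof.
move=> cN; have [v Hv] := choice local_equivariant; have [ O1 H] := choice Hv.
(* Compactness is used along the filter of finite sets ordered by inclusion, which yields a finite
   subcover. *)
pose FF : set_system {fset N} :=
  filter_from [set: {fset N}] (fun D0 => [set D | (D0 `<=` D)%fset]).
have fF : Filter FF.
  apply: filter_from_filter; first by exists fset0.
  move=> A B _ _; exists (A `|` B)%fset => // D /=.
  by rewrite fsubUset => /andP[].
have [|D _ HD] := (compact_near_coveringP _).1 cN {fset N} FF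
    (fun D p => exists2 x, x \in D & O1 x p) fF.
  move=> x _; exists (O1 x, [set D | ([fset x] `<=` D)%fset]).
    split; last by exists [fset x]%fset.
    by have [_ _ _ [h1 h2] _] := H x; exact: open_nbhs_at h1 h2.
  move=> [y D] [/= Oy xD]; exists x => //.
  by rewrite fsub1set in xD.
have cov := HD D (fsubset_refl D).
exists #|` D|, (fun i => v (tnth (in_tuple (enum_fset D)) i)); split.
- by move=> i; have [h _ _ _ _] := H (tnth (in_tuple (enum_fset D)) i); exact: h.
- by move=> i; have [_ h _ _ _] := H (tnth (in_tuple (enum_fset D)) i); exact: h.
- by move=> i t p; have [_ _ -> _ _] := H (tnth (in_tuple (enum_fset D)) i).
- move=> p; have [x xD Ox] := cov (proj p) Logic.I.
  have [i xi] := tnthP (in_tuple (enum_fset D)) x xD.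
  by exists i; rewrite -xi; have [_ _ _ _ K] := H x; exact: K.
Qed.

End Phase.

Lemma Cinf_eq (R : realType) n m (M : manifold R n) (N : manifold R m) (f g : Cinf M N) :
  cinf_fun f = cinf_fun g -> f = g.
Proof.
case: f g => f sf [g sg] /= E; subst g; congr MkCinf; exact: Prop_irrelevance.
Qed.

(** * Reeb loops in the Hamiltonian group *)

Section Hamiltonian.
Variables (R : realType) (n m : nat) (M : manifold R n) (N : manifold R m).
Variables (rho : R -> M -> M) (proj : M -> N) (eta : M -> functional M -> R).
Hypothesis bundle : circle_bundle rho proj.
Let act : free_circle_action rho. Proof. by have [H _ _ _] := bundle. Qed.
Hypothesis eta1 : one_form eta.
Hypothesis flat : forall p w, tangent p w -> dform eta p (act_field rho p) w = 0.
Hypothesis b_neq0 : forall p, act_form rho eta p != 0.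

Local Notation flow := (reeb_flow rho eta).
Local Notation T := (period rho eta).

(* The Reeb flow is generated by the Hamiltonian -T, the orbit period being
   constant along the fibres and locally constant. *)
Lemma reeb_flow_ham (r : R) : is_exp_ham proj eta (flow r).
Proof.
have [_ _ fib loc] := bundle.
have sT := period_smooth act eta1.
have ex x : exists p, proj p = x.
  have [U [sec [a [b [_ Ux [[_ hsec] _ _ _ _]]]]]] := loc x.
  by exists (sec x); have [-> _ _] := hsec x Ux.
have [lft lftP] := choice ex.
have Tproj p q : proj p = proj q -> T p = T q.
  by move=> /fib[t ->]; rewrite (period_act act eta1 flat).
(* The sign comes from eta(V) = - H. The lift is an arbitrary choice of points in the fibres; T is
   constant on fibres, and smoothness is read off local sections. *)
pose H x := - r * T (lft x).
have HE p : H (proj p) = - r * T p by rewrite /H (Tproj _ p (lftP (proj p))).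
have sH : smooth_fun H.
  apply: smooth_fun_cover => x.
  have [U [sec [a [b [ oU Ux [[ssec hsec] _ _ _ _]]]]]] := loc x.
  exists U => //; apply: (smooth_fun_on_eq oU (f := fun y => - r * T (sec y))).
    by move=> y Uy; rewrite /H (Tproj (sec y) (lft y))// lftP; have [-> _ _] := hsec y Uy.
  apply: (sfunM oU (sfun_cst oU _)) => c Ac.
  exact: (smooth_from_comp (im_setI_open Ac oU) openT (ssec c Ac) sT).
pose V p f := r * reeb rho eta p f.
have [TR sR] := reeb_vf act eta1 b_neq0.
exists H, V, (fun s => flow (s * r)); split; first exact: sH.
- split.
  + split=> [p|f sf]; last exact: (sfunM openT (sfun_cst openT r) (sR f sf)).
    have := tangent_lin r (TR p) (tangent_zero p).
    by have -> : (fun f => r * reeb rho eta p f + 0) = V p by apply/funext => f; rewrite addr0.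
  + by move=> p; rewrite HE /V (formZ eta1 r (TR p)) (eta_reeb act eta1 b_neq0) mulNr opprK.
  + move=> p w Tw; rewrite /V (dform_scale r eta1 (TR p) Tw) (dform_reeb act eta1 flat Tw) mulr0.
    have -> : H \o proj = (fun q => - r * T q) by apply/funext => q; exact: HE.
    by rewrite (tanZ Tw _ sT) (period_flat act eta1 flat Tw) mulr0.
- split=> [p|p f t sf]; first by rewrite mul0r (reeb_flow0 act eta1 flat b_neq0).
  have dr : is_derive t (1 : R) (fun u : R => u * r) r.
    have -> : (fun u : R => u * r) = r \*: (id : R -> R) by apply/funext => u; rewrite /= mulrC.
    by have := is_deriveZ r (is_derive_id t (1 : R)); rewrite /GRing.scale /= mulr1.
  have df := reeb_flow_deriv act eta1 flat b_neq0 (t * r) p sf.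
  have := @is_derive1_comp R (fun t => f (flow t p)) (fun u => u * r) t _ _ df dr.
  by rewrite mulrC.
- by rewrite mul1r.
Qed.

Definition reeb_Cinf t : Cinf M M := MkCinf (reeb_flow_map act eta1 flat b_neq0 t).

Lemma reeb_strict_Diff t : strict_Diff eta (reeb_Cinf t).
Proof.
split; last by move=> p v Tv; exact: (reeb_flow_strict act eta1 flat b_neq0).
exists (reeb_Cinf (- t)); split=> p /=;
  by rewrite -(reeb_flowD act eta1 flat b_neq0) ?addNr ?subrr (reeb_flow0 act eta1 flat b_neq0).
Qed.

Lemma reeb_G0bar t : G0bar proj eta (reeb_Cinf t).
Proof.
split; last exact: reeb_strict_Diff.
apply: subset_closure; rewrite /G0 /=.
exact: (ham_product_comp (reeb_flow_ham t) (@ham_product_id _ _ _ _ _ proj eta)).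
Qed.

Definition reeb_loop (j : int) (t : R) : Cinf M M := reeb_Cinf (j%:~R * t).

Lemma reeb_loop_continuous j : continuous (reeb_loop j).
Proof.
have C := @rmap_Cinf_continuous _ _ _ _ _ _ (reeb_flow_map act eta1 flat b_neq0) (reeb_flow_smooth act eta1 flat b_neq0).
move=> t; have cj : {for t, continuous (fun t : R => j%:~R * t)}.
  by exact: (cvgM (cvg_cst (j%:~R : R)) cvg_id).
exact: (continuous_comp cj (C (j%:~R * t))).
Qed.

Lemma reeb_loop_loop j : loop (G0bar proj eta) (Cinf_id M) (reeb_loop j).
Proof.
split.
- exact: continuous_subspaceT (@reeb_loop_continuous j).
- by move=> t _; exact: reeb_G0bar.
- by apply: Cinf_eq; apply/funext => p; rewrite /= mulr0 (reeb_flow0 act eta1 flat b_neq0).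
- by apply: Cinf_eq; apply/funext => p; rewrite /= mulr1 (reeb_flow_int act eta1 flat b_neq0).
Qed.

Lemma reeb_loop_refl j : loop_homotopic (G0bar proj eta) (Cinf_id M) (reeb_loop j) (reeb_loop j).
Proof.
exists (fun z => reeb_loop j z.2); split=> //.
- apply: continuous_subspaceT => z.
  have c2 : (fun z : R * R => z.2) y @[y --> z] --> z.2 by exact: cvg_snd.
  exact: (cvg_comp _ _ c2 (@reeb_loop_continuous j z.2)).
- by move=> s t _ _; exact: reeb_G0bar.
- by have [_ _ h0 h1] := reeb_loop_loop j.
Qed.

Hypothesis kernel : forall p Z, tangent p Z -> eta p Z = 0 ->
  (forall w, tangent p w -> dform eta p Z w = 0) -> Z = (fun=> 0).
Hypothesis N_compact : compact [set: N].

Lemma reeb_loop_injective i j (p0 : M) :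
  loop_homotopic (G0bar proj eta) (Cinf_id M) (reeb_loop i) (reeb_loop j) -> i = j.
Proof.
move=> [h [ch Gh h0 h1 hb]].
(* Clamping both parameters to [0, 1] extends the homotopy, continuous within the square, to a
   continuous map on the plane. *)
pose cl (x : R) := Num.max 0 (Num.min x 1).
have clP x : @unit_itv R (cl x).
  by rewrite /unit_itv /= in_itv /= /cl le_max lexx ge_max ler01 ge_min lexx orbT.
have clE x : 0 <= x <= 1 -> cl x = x.
  by move=> /andP[x0 x1]; rewrite /cl (min_idPl x1) (max_idPr x0).
have ccl : continuous cl.
  move=> x; have c0 : {for x, continuous (fun _ : R => 0 : R)} by exact: cst_continuous.
  have c1 : {for x, continuous (fun _ : R => 1 : R)} by exact: cst_continuous.
  have c2 : {for x, continuous (fun x : R => x)} by exact: cvg_id.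
  have c3 := continuous_max c0 (continuous_min c2 c1); exact: c3.
pose hc (z : R * R) := h (cl z.1, cl z.2).
have chc : continuous hc.
  move=> z; pose K (z : R * R) := (cl z.1, cl z.2).
  have cK : K y @[y --> z] --> K z.
    have c1 : (fun z : R * R => z.1) y @[y --> z] --> z.1 by exact: cvg_fst.
    have c2 : (fun z : R * R => z.2) y @[y --> z] --> z.2 by exact: cvg_snd.
    exact: (cvg_pair (cvg_comp _ _ c1 (ccl z.1)) (cvg_comp _ _ c2 (ccl z.2))).
  have KA y : (@unit_itv R `*` @unit_itv R) (K y) by split; exact: clP.
  have cw := (subspace_continuousP _ _).1 ch (K z) (KA z).
  move=> A nA; have nw := cw A nA.
  have nK : nbhs z (K @^-1` [set y | (@unit_itv R `*` @unit_itv R) y -> A (h y)]) := cK _ nw.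
  have sub : K @^-1` [set y | (@unit_itv R `*` @unit_itv R) y -> A (h y)] `<=` hc @^-1` A.
    by move=> y Hy; exact: Hy (KA y).
  exact: (filterS sub nK).
pose H s t p := cinf_fun (hc (s, t)) p.
have cH : continuous (fun z : R * R * M => H z.1.1 z.1.2 z.2).
  move=> z; have c1 : (fun z : R * R * M => z.1) y @[y --> z] --> z.1 by exact: cvg_fst.
  have c2 : (fun z : R * R * M => z.2) y @[y --> z] --> z.2 by exact: cvg_snd.
  have c3 := cvg_comp _ _ c1 (chc z.1).
  have c4 : (hc y.1, y.2) @[y --> z] --> (hc z.1, z.2) by exact: (cvg_pair c3 c2).
  have c5 := cvg_comp _ _ c4 (@Cinf_eval_cvg _ _ _ _ _ (hc z.1) z.2).
  have E : (fun z : R * R * M => H z.1.1 z.1.2 z.2) = (fun y => cinf_fun (hc y.1) y.2).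
    by apply/funext => -[[s t] p].
  by rewrite E; exact: c5.
have I0 : @unit_itv R 0 by rewrite /unit_itv /= in_itv /= lexx ler01.
have I1 : @unit_itv R 1 by rewrite /unit_itv /= in_itv /= lexx ler01.
have cl0 : cl 0 = 0 by rewrite clE// lexx ler01.
have cl1 : cl 1 = 1 by rewrite clE// lexx ler01.
have H_t0 s p : H s 0 p = p by rewrite /H /hc /= cl0; have [-> _] := hb _ (clP s).
have H_t1 s p : H s 1 p = p by rewrite /H /hc /= cl1; have [_ ->] := hb _ (clP s).
(* The path t |-> H s t p starts at p, and a locally constant function is constant along it. *)
have TH s t p : T (H s t p) = T p.
  have ct t0 : {for t0, continuous (fun t => H s t p)}.
    have c4 : (s, t, p) @[t --> t0] --> (s, t0, p).
      exact: (cvg_pair (cvg_pair (cvg_cst s) cvg_id) (cvg_cst p)).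
    exact: (cvg_comp _ _ c4 (cH (s, t0, p))).
  rewrite -[in RHS](H_t0 s p).
  have D (t0 : R) : is_derive t0 (1 : R) (fun t => T (H s t p)) 0.
    apply: (near_eq_is_derive _ (is_derive_cst (T (H s t0 p)) t0 (1 : R))).
    have nT := period_locally_constant act eta1 flat (H s t0 p).
    have nn : nbhs t0 ((fun t => H s t p) @^-1` [set q | T q = T (H s t0 p)]) := ct t0 _ nT.
    by apply: filterS nn => t1 e; exact: esym e.
  exact: (is_derive_0_is_cst t 0 D).
have HS s t r p : H s t (flow r p) = flow r (H s t p).
  have [_ [[g [k1 k2]] st]] := Gh _ _ (clP s) (clP t).
  exact: (strict_commute act eta1 flat b_neq0 kernel r p (cinf_smooth (hc (s, t)))
    (cinf_smooth g) k1 k2 st (TH s t)).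
have [L [u [u1 u2 uS u0]]] := equivariant_map bundle eta1 flat b_neq0 N_compact.
apply: (@rotation_classes_eq R L M u flow H i j p0 u1 u2 uS u0 cH) => //.
- move=> t p t01; have Ut : @unit_itv R t by rewrite /unit_itv /= in_itv.
  by rewrite /H /hc /= cl0 (clE _ t01) (h0 _ Ut).
- move=> t p t01; have Ut : @unit_itv R t by rewrite /unit_itv /= in_itv.
  by rewrite /H /hc /= cl1 (clE _ t01) (h1 _ Ut).
Qed.

End Hamiltonian.

Theorem theorem4p5 (R : realType) (k : nat)
    (N : manifold R (2 * k)) (om : N -> functional N -> functional N -> R)
    (M : manifold R (2 * k).+1) (rho : R -> M -> M) (proj : M -> N)
    (eta : M -> functional M -> R)
    (N_nonempty : [set: N] !=set0) (N_compact : compact [set: N])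
    (om_symplectic : symplectic om) (om_integral : integral_class om)
    (proj_bundle : circle_bundle rho proj) (eta_contact : contact_form eta)
    (deta : forall p v w, tangent p v -> tangent p w ->
       om (proj p) (dmap proj v) (dmap proj w) = dform eta p v w) :
  infinite_set (@pi1 R (Cinf M M) (G0bar proj eta) (Cinf_id M)).
Proof.
have [act sproj fib loc] := proj_bundle; have [eta1 _] := eta_contact.
have [[om_lin _ _] _ _] := om_symplectic.
have vert p : dmap proj (act_field rho p) = (fun=> 0).
  apply/funext => f; have [sf|nf] := pselect (smooth_fun f); last exact: dmap_nonsmooth.
  rewrite (dmap_smooth _ _ sf) (act_fieldE _ _ (smooth_map_comp sproj sf)) /dt.
  have -> : (fun s => (f \o proj) (rho s p)) = cst (f (proj p)).
    by apply/funext => s; rewrite /= (proj_act proj_bundle).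
  by have [_ ->] := is_derive_cst (f (proj p)) (0 : R) (1 : R).
(* Vertical vectors are killed by [proj], and d eta is the pullback of [om]. *)
have flat p w : tangent p w -> dform eta p (act_field rho p) w = 0.
  move=> Tw; rewrite -(deta p _ _ (act_tangent act p) Tw) vert.
  have Tw' := dmap_tangent sproj Tw; have T0 := tangent_zero (proj p).
  (* Linearity applied to 0 = 1 * 0 + 0 gives the value 0 on the zero vector. *)
  have := om_lin (proj p) 1 _ _ _ T0 T0 Tw'.
  have -> : (fun _ : N -> R => 1 * 0 + 0) = (fun=> 0 : R) by apply/funext => f; rewrite mulr0 addr0.
  by lra.
have kernel := contact_kernel eta_contact.
have b_neq0 p : act_form rho eta p != 0.
  apply/eqP => b0; apply: (act_field_neq0 act (p := p)).
  by apply: (kernel _ _ (act_tangent act p) b0) => w; exact: flat.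
(* A local section over a point of N provides the point of M at which the homotopies are
   evaluated. *)
have [x _] := N_nonempty; have [U [sec [a [b _]]]] := loc x.
pose c (j : nat) := reeb_loop proj_bundle eta1 flat b_neq0 j.
pose cls j := [set d | loop (G0bar proj eta) (Cinf_id M) d /\
  loop_homotopic (G0bar proj eta) (Cinf_id M) (c j) d].
have cls_inj : injective cls.
  move=> i j E; have : cls j (c j) by split; [exact: reeb_loop_loop|exact: reeb_loop_refl].
  rewrite -E => -[_ hij].
  by have [] := reeb_loop_injective kernel N_compact (sec x) hij.
(* If pi_1 were finite, so would be its preimage under the injection [cls], which is the whole of
   [nat]. *)
move=> fin; apply: infinite_nat.
have := finite_preimage (f := cls) (in2W cls_inj) fin.
have -> // : cls @^-1` pi1 (G0bar proj eta) (Cinf_id M) = [set: nat].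
apply/seteqP; split=> // j _; exists (c j) => //; exact: reeb_loop_loop.
Qed.
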